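(* Let $A$ be an Arens-Michael algebra and $I\subset A_+$ a closed left ideal. Let $X=(A_+/I)^{\sim}$ be the completion of $A_+/I$. Suppose that there exists an Arens-Michael decomposition $A=\varprojlim(A_\lambda)_{\lambda\in\Lambda}$, with canonical maps $\sigma_\lambda\colon A\to A_\lambda$, such that for each $\lambda\in\Lambda$ the ideal $I_\lambda=\overline{(\sigma_\lambda)_+(I)}$ is weakly complemented in $(A_\lambda)_+$. Then the following conditions are equivalent: (i) $I$ has a right locally bounded approximate identity; (ii) the functor $(\,\cdot\,)\mathbin{\widehat\otimes}_A X$ takes every exact pair of right $A$-$\widehat\otimes$-modules to an exact pair of complete locally convex spaces; (iii) the functor $(\,\cdot\,)\mathbin{\widehat\otimes}_A X$ takes every exact pair of right Banach $A$-modules to an exact pair of Banach spaces; (iv) the functor $(\,\cdot\,)\mathbin{\widehat\otimes}_A X$ takes every exact pair of right $A$-$\widehat\otimes$-modules which splits as a sequence of complete locally convex spaces to an exact pair of complete locally convex spaces; (v) the functor $(\,\cdot\,)\mathbin{\widehat\otimes}_A X$ takes every exact pair of right Banach $A$-modules which splits as a sequence of Banach spaces to an exact pair of Banach spaces.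
   Context: All spaces are over $\mathbb C$. Complete locally convex spaces (l.c.s.) are Hausdorff by convention; the completion $E^{\sim}$ of an l.c.s. $E$ is the completion of its associated Hausdorff space. An Arens-Michael algebra is a complete topological algebra whose topology is given by a family of submultiplicative seminorms. $A_+$ is the unitization of $A$ (an identity is always adjoined); a homomorphism $\varphi\colon A\to B$ extends uniquely to a unital homomorphism $\varphi_+\colon A_+\to B_+$. An Arens-Michael decomposition $A=\varprojlim A_\lambda$ is the isomorphism obtained from a directed family $\{\|\cdot\|_\lambda:\lambda\in\Lambda\}$ of submultiplicative seminorms generating the topology of $A$: $A_\lambda$ is the Banach algebra completion of $A$ with respect to $\|\cdot\|_\lambda$, $\sigma_\lambda\colon A\to A_\lambda$ is the canonical map, and the linking maps $A_\mu\to A_\lambda$ (for $\|\cdot\|_\lambda\le\|\cdot\|_\mu$) are the canonical ones. A closed left ideal $J$ of a Banach algebra $B$ is weakly complemented if its annihilator $J^\perp=\{f\in B^*: f|_J=0\}$ is a complemented subspace of the Banach space $B^*$. A (left or right) $A$-$\widehat\otimes$-module is a complete l.c.s. with a jointly continuous $A$-module structure; a Banach $A$-module is one whose underlying l.c.s. is a Banach space. Morphisms are continuous $A$-module maps. $\widehat\otimes$ is the completed projective tensor product. For a right module $Y$ and a left module $X$, $Y\mathbin{\widehat\otimes}_A X=((Y\mathbin{\widehat\otimes}X)/N)^{\sim}$, where $N$ is the closed linear span of all $y\cdot a\otimes x-y\otimes a\cdot x$. An exact pair is a sequence $Y_1\xrightarrow{i}Y_2\xrightarrow{p}Y_3$ with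 $i=\ker p$ and $p=\operatorname{coker} i$. For complete l.c.s.'s and for right $A$-$\widehat\otimes$-modules this means: $i$ is a homeomorphism onto $p^{-1}(0)$, and $p$ is an open map onto a dense subspace of $Y_3$. For Banach spaces and Banach modules it means that $0\to Y_1\to Y_2\to Y_3\to0$ is algebraically exact. ''Splits'' means that $0\to Y_1\to Y_2\to Y_3\to0$ is split exact by continuous linear maps (not necessarily module maps). A topological algebra $B$ (here $B=I$ with the subspace topology) has a right locally bounded approximate identity if for each $0$-neighborhood $U\subset B$ there exists $C>0$ such that for each finite subset $F\subset B$ there exists $b\in CU$ with $a-ab\in U$ for all $a\in F$. *)

(* Defs.v *)
From mathcomp Require Import all_boot all_order all_algebra.
From mathcomp Require Import all_classical all_reals all_analysis.
From mathcomp Require Export complex.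
Set Implicit Arguments.
Unset Strict Implicit.
Unset Printing Implicit Defensive.
Import Order.TTheory GRing.Theory Num.Theory.
Import numFieldNormedType.Exports.

Local Open Scope classical_set_scope.
Local Open Scope ring_scope.

(* Everything is set up over an arbitrary numFieldType K; the theorem takes
   K := R[i].  For such K a seminorm may be K-valued, like the norm of a
   normedModType K: the order of R[i] makes 0 <= c mean "c is a nonnegative
   real". *)

Section LocallyConvexSpaces.
Variable K : numFieldType.

(* The uniform structure carried by a tvsType is only required to induce its
   topology, so it may differ from the one given by the addition.  Completeness
   is therefore stated with the additive uniformity rather than with [cauchy]. *)
Definition tvs_cauchy (E : tvsType K) (F : set_system E) : Prop :=
  forall U : set E, nbhs 0 U ->
    exists2 V, F V & forall x y, V x -> V y -> U (x - y).

Definition complete_lcs (E : tvsType K) : Prop :=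
  hausdorff_space E /\
  forall F : set_system E, ProperFilter F -> tvs_cauchy F ->
    exists x : E, F --> x.

Definition seminorm (E : lmodType K) (p : E -> K) : Prop :=
  (forall x y, p (x + y) <= p x + p y) /\
  (forall (a : K) x, p (a *: x) = `|a| * p x).

Definition generates_topology (E : tvsType K) (L : Type) (p : L -> E -> K) :
    Prop :=
  forall U : set E, nbhs 0 U <->
    exists n (s : 'I_n -> L) (e : K),
      0 < e /\ [set x | forall k, p (s k) x < e] `<=` U.

Definition banach_space (E : tvsType K) : Prop :=
  complete_lcs E /\
  exists p : E -> K, [/\ seminorm p, forall x, p x = 0 -> x = 0 &
    generates_topology (fun _ : unit => p)].

Definition continuous_linear (E F : tvsType K) (f : E -> F) : Prop :=
  linear f /\ continuous f.

Definition continuous_bilinear (E F G : tvsType K) (b : E -> F -> G) : Prop :=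
  bilinear_for *:%R *:%R b /\ continuous (fun z : E * F => b z.1 z.2).

Definition linear_subspace (E : lmodType K) (S : set E) : Prop :=
  S 0 /\ forall (a : K) x y, S x -> S y -> S (a *: x + y).

(* [q] exhibits F as the completion of the quotient space E / N: it vanishes on
   N and has dense range, and the 0-neighbourhoods of E / N (the images of the
   sets U + N) are those induced from F.  The induced map E / N -> F is
   injective exactly when E / N is Hausdorff. *)
Record completed_quotient (E : tvsType K) (N : set E) (F : tvsType K)
    (q : E -> F) : Prop := CompletedQuotient {
  completed_quotient_complete : complete_lcs F;
  completed_quotient_linear : continuous_linear q;
  completed_quotient_ker : forall x, N x -> q x = 0;
  completed_quotient_dense : dense (range q);
  completed_quotient_nbhs : forall U : set E, nbhs 0 U ->
    exists2 V : set F, nbhs 0 V &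
      q @^-1` V `<=` [set x | exists2 u, U u & N (x - u)]
}.

(* [t] exhibits T as the completed projective tensor product of E and F. *)
Record projective_tensor (E F T : tvsType K) (t : E -> F -> T) : Prop :=
  ProjectiveTensor {
  projective_tensor_complete : complete_lcs T;
  projective_tensor_bilinear : continuous_bilinear t;
  projective_tensor_univ : forall (G : tvsType K) (b : E -> F -> G),
    complete_lcs G -> continuous_bilinear b ->
    exists! f : T -> G, continuous_linear f /\ forall x y, f (t x y) = b x y
}.

Record exact_pair_lcs (E1 E2 E3 : tvsType K) (i : E1 -> E2) (p : E2 -> E3) :
    Prop := ExactPairLcs {
  exact_lcs_i : continuous_linear i;
  exact_lcs_p : continuous_linear p;
  exact_lcs_i_inj : injective i;
  exact_lcs_i_range : range i = p @^-1` [set 0];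
  exact_lcs_i_homeo : forall U : set E1, open U ->
    exists2 W : set E2, open W & i @` U = W `&` range i;
  exact_lcs_p_open : forall U : set E2, open U ->
    exists2 W : set E3, open W & p @` U = W `&` range p;
  exact_lcs_p_dense : dense (range p)
}.

Record exact_pair_banach (E1 E2 E3 : tvsType K) (i : E1 -> E2) (p : E2 -> E3) :
    Prop := ExactPairBanach {
  exact_banach1 : banach_space E1;
  exact_banach2 : banach_space E2;
  exact_banach3 : banach_space E3;
  exact_banach_i : continuous_linear i;
  exact_banach_p : continuous_linear p;
  exact_banach_i_inj : injective i;
  exact_banach_i_range : range i = p @^-1` [set 0];
  exact_banach_p_surj : range p = setT
}.

(* The three equations imply the algebraic exactness of 0 -> E1 -> E2 -> E3 -> 0:
   they give s p i = i - i r i = 0, hence p i = p s p i = 0. *)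
Definition splits (E1 E2 E3 : tvsType K) (i : E1 -> E2) (p : E2 -> E3) : Prop :=
  exists (r : E2 -> E1) (s : E3 -> E2),
    [/\ continuous_linear r, continuous_linear s,
        (forall x, r (i x) = x), (forall z, p (s z) = z) &
        (forall y, i (r y) + s (p y) = y)].

End LocallyConvexSpaces.

Section WeakComplement.
Variables (K : numFieldType) (B : normedModType K).

Definition dual : set (B -> K^o) := [set f | linear f /\ continuous f].

Definition annihilator (J : set B) : set (B -> K^o) :=
  [set f | dual f /\ forall x, J x -> f x = 0].

(* ||f|| <= c for the norm of B^* *)
Definition dual_norm_le (f : B -> K^o) (c : K) : Prop :=
  forall x, `|f x| <= c * `|x|.

(* Only the values of the projection P on B^* matter. *)
Definition weakly_complemented (J : set B) : Prop :=
  exists P : (B -> K^o) -> (B -> K^o),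
    [/\ (forall f, dual f -> annihilator J (P f)),
        (forall f, annihilator J f -> P f = f),
        (forall (a : K) f g, dual f -> dual g ->
           forall x, P (fun y => a *: f y + g y) x = a *: P f x + P g x) &
        (exists M : K, 0 <= M /\ forall f c, dual f ->
           dual_norm_le f c -> dual_norm_le (P f) (M * c))].

End WeakComplement.

Section Algebras.
Variable K : numFieldType.

(* Algebras are not assumed unital. *)

Definition submultiplicative (E : lmodType K) (mul : E -> E -> E) (p : E -> K) :
    Prop :=
  seminorm p /\ forall x y, p (mul x y) <= p x * p y.

Record arens_michael_algebra := ArensMichaelAlgebra {
  am_space :> tvsType K;
  am_mul : am_space -> am_space -> am_space;
  am_complete : complete_lcs am_space;
  am_bilinear : bilinear_for *:%R *:%R am_mul;
  am_assoc : associative am_mul;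
  am_seminorms : exists (L : Type) (p : L -> am_space -> K),
    (forall l, submultiplicative am_mul (p l)) /\ generates_topology p
}.

Record banach_algebra := BanachAlgebra {
  ba_space :> completeNormedModType K;
  ba_mul : ba_space -> ba_space -> ba_space;
  ba_bilinear : bilinear_for *:%R *:%R ba_mul;
  ba_assoc : associative ba_mul;
  ba_submult : forall x y, `|ba_mul x y| <= `|x| * `|y|
}.

(* The unitization E_+ is E * K^o, with (a, s) standing for a + s 1. *)
Definition unitization_mul (E : lmodType K) (mul : E -> E -> E)
    (u v : E * K^o) : E * K^o :=
  (mul u.1 v.1 + u.2 *: v.1 + v.2 *: u.1, u.2 * v.2).

Definition unitization_map (E F : lmodType K) (f : E -> F) (u : E * K^o) :
    F * K^o := (f u.1, u.2).

Variable A : arens_michael_algebra.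

Definition amu_mul : A * K^o -> A * K^o -> A * K^o :=
  unitization_mul (@am_mul A).

Record arens_michael_decomposition := ArensMichaelDecomposition {
  amd_index : Type;
  amd_norm : amd_index -> A -> K;
  amd_alg : amd_index -> banach_algebra;
  amd_map : forall l, A -> amd_alg l;
  amd_submult : forall l, submultiplicative (@am_mul A) (amd_norm l);
  amd_inhabited : inhabited amd_index;
  amd_directed : forall l m, exists n,
    forall x, amd_norm l x <= amd_norm n x /\ amd_norm m x <= amd_norm n x;
  amd_generates : generates_topology amd_norm;
  amd_map_linear : forall l, linear (@amd_map l);
  amd_map_mul : forall l x y,
    amd_map l (am_mul x y) = ba_mul (amd_map l x) (amd_map l y);
  amd_map_norm : forall l x, `|amd_map l x| = amd_norm l x;
  amd_map_dense : forall l, dense (range (@amd_map l))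
}.

Record closed_left_ideal (I : set (A * K^o)) : Prop := ClosedLeftIdeal {
  ideal_closed : closed I;
  ideal_subspace : linear_subspace I;
  ideal_mul : forall u v, I v -> I (amu_mul u v)
}.

(* [within I (nbhs 0)] is the filter of 0-neighbourhoods of I. *)
Definition right_locally_bounded_ai (I : set (A * K^o)) : Prop :=
  forall U : set (A * K^o), within I (nbhs (0 : A * K^o)) U ->
    exists c : K, 0 < c /\
      forall F : set (A * K^o), finite_set F -> F `<=` I ->
        exists u, [/\ I u, U u &
          forall a, F a -> U (a - amu_mul a (c *: u))].

Record left_module := LeftModule {
  lm_space :> tvsType K;
  lm_act : A -> lm_space -> lm_space;
  lm_complete : complete_lcs lm_space;
  lm_bilinear : continuous_bilinear lm_act;
  lm_assoc : forall a b x, lm_act (am_mul a b) x = lm_act a (lm_act b x)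
}.

Record right_module := RightModule {
  rm_space :> tvsType K;
  rm_act : rm_space -> A -> rm_space;
  rm_complete : complete_lcs rm_space;
  rm_bilinear : continuous_bilinear rm_act;
  rm_assoc : forall y a b, rm_act y (am_mul a b) = rm_act (rm_act y a) b
}.

Definition right_module_map (Y Y' : right_module) (f : Y -> Y') : Prop :=
  continuous_linear f /\ forall y a, f (rm_act y a) = rm_act (f y) a.

(* [pi] exhibits the left module X as the completion of A_+ / I. *)
Definition cyclic_module (I : set (A * K^o)) (X : left_module)
    (pi : A * K^o -> X) : Prop :=
  completed_quotient I pi /\
  forall (a : A) (u : A * K^o), pi (amu_mul (a, 0) u) = lm_act a (pi u).

Definition balancing (Y : right_module) (X : left_module) (T : tvsType K)
    (t : Y -> X -> T) : set T :=
  closure (smallest (@linear_subspace K T)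
    [set z | exists y a x, z = t (rm_act y a) x - t y (lm_act a x)]).

(* A realization of the tensor product of Y and X over A as the completion of
   (Y (x) X) / N, where Y (x) X = [tensor_full] is the completed projective
   tensor product.  It is unique up to a unique isomorphism. *)
Record module_tensor (Y : right_module) (X : left_module) := ModuleTensor {
  tensor_full : tvsType K;
  tensor_pure : Y -> X -> tensor_full;
  tensor_fullP : projective_tensor tensor_pure;
  tensor_space :> tvsType K;
  tensor_quot : tensor_full -> tensor_space;
  tensor_quotP : completed_quotient (balancing tensor_pure) tensor_quot
}.

Definition tensor_elem (Y : right_module) (X : left_module)
    (T : module_tensor Y X) (y : Y) (x : X) : T :=
  tensor_quot (@tensor_pure Y X T y x).

(* [g] is the map f (x) 1_X; it is unique since the elements y (x) x have dense
   linear span. *)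
Definition tensor_map (Y Y' : right_module) (X : left_module)
    (T : module_tensor Y X) (T' : module_tensor Y' X) (f : Y -> Y')
    (g : T -> T') : Prop :=
  continuous_linear g /\
  forall y x, g (tensor_elem T y x) = tensor_elem T' (f y) x.

Definition exact_pair_modules (Y1 Y2 Y3 : right_module) (i : Y1 -> Y2)
    (p : Y2 -> Y3) : Prop :=
  [/\ right_module_map i, right_module_map p & exact_pair_lcs i p].

Definition exact_pair_banach_modules (Y1 Y2 Y3 : right_module) (i : Y1 -> Y2)
    (p : Y2 -> Y3) : Prop :=
  [/\ right_module_map i, right_module_map p & exact_pair_banach i p].

(* The functor of tensoring with X over A takes the sequences of right modules
   satisfying S to sequences of locally convex spaces satisfying S'. *)
Definition tensor_takes (X : left_module)
    (S : forall Y1 Y2 Y3 : right_module, (Y1 -> Y2) -> (Y2 -> Y3) -> Prop)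
    (S' : forall E1 E2 E3 : tvsType K, (E1 -> E2) -> (E2 -> E3) -> Prop) :
    Prop :=
  forall (Y1 Y2 Y3 : right_module) (i : Y1 -> Y2) (p : Y2 -> Y3),
    S Y1 Y2 Y3 i p ->
    forall (T1 : module_tensor Y1 X) (T2 : module_tensor Y2 X)
           (T3 : module_tensor Y3 X) (i' : T1 -> T2) (p' : T2 -> T3),
      tensor_map i i' -> tensor_map p p' -> S' T1 T2 T3 i' p'.

End Algebras.

Arguments amd_map {K A} D l x : rename.

(* Main.v *)
(* Since X is cyclic, Y (x)_A X is the completion of Y / Y.I.  It comes for free
   that Y2 (x) X -> Y3 (x) X is open onto a dense subspace and that the image of
   Y1 (x) X is dense in its kernel, so flatness says that
   Y1 / Y1.I -> Y2 / Y2.I is always a topological embedding.  A locally bounded approximate identity of I gives this, because y and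
   y (1 - b) have the same class modulo Y1.I for every b in I.

   Conversely, write B for the unitization of A_l and J for I_l.  The sequence
   J^perp -> B^* -> J^* of dual right modules splits when J is weakly
   complemented.  Evaluation at 1 on J^perp vanishes on J^perp.I; if
   J^perp / J^perp.I embeds in B^* / B^*.I, it follows that |g(1)| <= c |g|_J|
   for all g in B^*.I, and by Hahn-Banach this is the existence of a right
   approximate identity of J bounded by c.  The approximate identities obtained
   at the levels l amount to a locally bounded one of I. *)

From HB Require Import structures.
Require Import Defs.
From mathcomp Require Import all_boot all_order all_algebra.
From mathcomp Require Import all_classical all_reals all_analysis.
From mathcomp Require Import ring lra.
Set Implicit Arguments.
Unset Strict Implicit.
Unset Printing Implicit Defensive.
Import Order.TTheory GRing.Theory Num.Theory.
Import numFieldNormedType.Exports.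
Local Open Scope classical_set_scope.
Local Open Scope ring_scope.
Local Open Scope complex_scope.

Local Notation Re := complex.Re.
Local Notation Im := complex.Im.
Local Notation normc := Normc.normc.
Arguments Normc.normc : simpl never.

(** * Seminorms and the Hahn-Banach theorem *)

(** The bound of g(1) by the norm of g on J comes from writing g = P g + (g - P g), where P is the
    projection onto J^perp. The second summand depends only on the restriction of g to J, and its
    norm is at most 1 + m times that of the restriction, m bounding P. For g in B^*.I the class of P
    g modulo B^*.I is that of P g - g, so the embedding bounds P g at 1 as well. The Hahn-Banach
    argument runs in B times a finite power of B, since one element has to serve a whole finite set,
    and it separates from the image of I itself, so that the approximate identity is found in I and
    not only in the closure J.

    The test sequence consists of Banach modules and splits, and by the open mapping theorem a
    Banach exact pair is also one of locally convex spaces; hence one sequence settles both (iv) and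
    (v). The conditions range over realizations of tensor products and say something only once these
    exist. Completions, projective tensor products and duals are therefore built as spaces of
    functions with uniform convergence, for which completeness is proved once. *)

Section Modulus.
Variable R : realType.
Local Notation C := R[i].
Implicit Types (z w : C) (x : R).

Lemma normrE z : `|z| = (normc z)%:C. Proof. by []. Qed.

Lemma normc_ge0 z : 0 <= normc z.
Proof. by case: z => a b; exact: sqrtr_ge0. Qed.

Lemma normcM z w : normc (z * w) = normc z * normc w.
Proof. exact: Normc.normcM. Qed.

Lemma normcD z w : normc (z + w) <= normc z + normc w.
Proof. by have := ler_normD z w; rewrite !normrE -raddfD /= lecR. Qed.

Lemma normcN z : normc (- z) = normc z.
Proof. by have := normrN z; rewrite !normrE => -[]. Qed.

Lemma normcB z w : normc (z - w) = normc (w - z).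
Proof. by rewrite -normcN opprB. Qed.

Lemma normc_eq0 z : normc z = 0 -> z = 0.
Proof. exact: Normc.eq0_normc. Qed.

Lemma normc0 : normc (0 : C) = 0. Proof. exact: Normc.normc0. Qed.

Lemma normc1 : normc (1 : C) = 1. Proof. exact: Normc.normc1. Qed.

Lemma normc_real x : normc x%:C = `|x|.
Proof. by rewrite /normc /= expr0n /= addr0 sqrtr_sqr. Qed.

Lemma normcV z : normc z^-1 = (normc z)^-1.
Proof. exact: Normc.normcV. Qed.

Lemma normc_gt0 z : (0 < normc z) = (z != 0).
Proof.
rewrite lt_neqAle normc_ge0 andbT eq_sym; congr (~~ _).
by apply/eqP/eqP => [/normc_eq0//|->]; rewrite normc0.
Qed.

Lemma absRe_le_normc z : `|Re z| <= normc z.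
Proof. by have := normc_ge_Re z; rewrite normrE lecR. Qed.

Lemma absIm_le_normc z : `|Im z| <= normc z.
Proof.
rewrite -ler_sqr ?nnegrE ?normc_ge0// real_normK ?num_real//.
case: z => a b /=; rewrite sqr_sqrtr ?addr_ge0 ?sqr_ge0//.
by rewrite lerDr sqr_ge0.
Qed.

Lemma normc_le_ReIm z : normc z <= `|Re z| + `|Im z|.
Proof.
case: z => a b; have -> : a +i* b = a%:C + 'i%C * b%:C.
  by rewrite {1}(complexE (a +i* b)).
rewrite (le_trans (normcD _ _))// normcM normc_real normc_real /=.
rewrite lerD//; first by rewrite mulr0 mul0r subr0 addr0.
by rewrite /normc /= expr0n expr1n add0r sqrtr1 mul1r mul0r mul1r !add0r.
Qed.

(** Equality in [Re z <= |z|] forces the imaginary part to vanish; this turns the value of the real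
    part of a functional at [x0] into its full value. *)
Lemma normc_le_Re z : normc z <= Re z -> z = (Re z)%:C.
Proof.
case: z => a b h; have a0 : 0 <= a by apply: le_trans h; exact: normc_ge0.
move: h; rewrite /normc /= -ler_sqr ?nnegrE ?sqrtr_ge0//.
rewrite sqr_sqrtr ?addr_ge0 ?sqr_ge0// gerDl => hb.
have : b ^+ 2 == 0 by rewrite eq_le hb sqr_ge0.
by rewrite sqrf_eq0 => /eqP ->.
Qed.

Lemma gt0_complexE z : 0 < z -> exists2 x : R, 0 < x & z = x%:C.
Proof.
case: z => a b; rewrite ltcE /= => /andP[/eqP -> a0].
by exists a.
Qed.

Lemma ge0_complexE z : 0 <= z -> exists2 x : R, 0 <= x & z = x%:C.
Proof.
case: z => a b; rewrite lecE /= => /andP[/eqP -> a0].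
by exists a.
Qed.

End Modulus.

Section LinearMap.
Variables (R : realType) (V W : lmodType R[i]) (f : V -> W).
Hypothesis fl : linear f.

Lemma lin0 : f 0 = 0.
Proof. by have := fl (-1) 0 0; rewrite scaler0 addr0 scaleN1r addNr. Qed.
Lemma linD x y : f (x + y) = f x + f y.
Proof. by have := fl 1 x y; rewrite !scale1r. Qed.
Lemma linZ a x : f (a *: x) = a *: f x.
Proof. by have := fl a x 0; rewrite lin0 !addr0. Qed.
Lemma linN x : f (- x) = - f x.
Proof. by rewrite -scaleN1r linZ scaleN1r. Qed.
Lemma linB x y : f (x - y) = f x - f y.
Proof. by rewrite linD linN. Qed.
End LinearMap.

Section Seminorms.
Variable R : realType.
Local Notation C := R[i].

(* Seminorms are taken with values in [R] rather than in [R[i]]. *)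
Definition rseminorm (V : lmodType C) (p : V -> R) : Prop :=
  (forall x y, p (x + y) <= p x + p y) /\
  (forall (a : C) x, p (a *: x) = normc a * p x).

Section Basics.
Variables (V : lmodType C) (p : V -> R).
Hypothesis sp : rseminorm p.

Lemma sn_add x y : p (x + y) <= p x + p y. Proof. exact: sp.1. Qed.
Lemma snZ a x : p (a *: x) = normc a * p x. Proof. exact: sp.2. Qed.
Lemma sn0 : p 0 = 0. Proof. by rewrite -(scale0r 0) snZ normc0 mul0r. Qed.
Lemma snN x : p (- x) = p x.
Proof. by rewrite -scaleN1r snZ normcN normc1 mul1r. Qed.
Lemma snBC x y : p (x - y) = p (y - x).
Proof. by rewrite -snN opprB. Qed.
Lemma sn_ge0 x : 0 <= p x.
Proof. by have := sn_add x (- x); rewrite subrr sn0 snN; lra. Qed.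
Lemma snB x y : p (x - y) <= p x + p y.
Proof. by rewrite -(snN y) sn_add. Qed.
Lemma sn_tri z x y : p (x - y) <= p (x - z) + p (z - y).
Proof. by rewrite -[x - y](subrKA z) sn_add. Qed.
Lemma sn_le_sub x y : p x <= p y + p (x - y).
Proof. by rewrite -{1}(subrK y x) addrC sn_add. Qed.
Lemma snZr (t : R) x : 0 <= t -> p (t%:C *: x) = t * p x.
Proof. by move=> t0; rewrite snZ normc_real ger0_norm. Qed.
End Basics.

Lemma rseminormD (V : lmodType C) (p q : V -> R) :
  rseminorm p -> rseminorm q -> rseminorm (fun x => p x + q x).
Proof.
move=> sp sq; split=> [x y|a x]; last by rewrite (snZ sp) (snZ sq) mulrDr.
by rewrite addrACA lerD// ?(sn_add sp)// (sn_add sq).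
Qed.

Lemma rseminorm_scale (V : lmodType C) (p : V -> R) (c : R) :
  0 <= c -> rseminorm p -> rseminorm (fun x => c * p x).
Proof.
move=> c0 sp; split=> [x y|a x]; last by rewrite (snZ sp) mulrCA.
by rewrite -mulrDr ler_wpM2l// (sn_add sp).
Qed.

Lemma rseminorm_comp (V W : lmodType C) (f : V -> W) (p : W -> R) :
  linear f -> rseminorm p -> rseminorm (p \o f).
Proof.
move=> lf sp; split=> [x y|a x] /=; first by rewrite (linD lf) (sn_add sp).
by rewrite (linZ lf) (snZ sp).
Qed.

Lemma rseminorm_normc : rseminorm (fun z : C^o => normc z).
Proof. by split=> [x y|a x]; [exact: normcD|exact: normcM]. Qed.

End Seminorms.

Section RealInf.
Variables (R : realType) (T : Type).
Implicit Types (P : set T) (f : T -> R).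

Definition infim P f : R := inf [set f t | t in P].

Lemma infim_le P f b t : (forall t, P t -> b <= f t) -> P t -> infim P f <= f t.
Proof.
move=> lb Pt; apply: ge_inf; last by exists t.
by exists b => _ [u Pu <-]; exact: lb.
Qed.

Lemma infim_ge P f b t : P t -> (forall t, P t -> b <= f t) -> b <= infim P f.
Proof.
move=> Pt lb; apply: lb_le_inf; first by exists (f t); exists t.
by move=> _ [u Pu <-]; exact: lb.
Qed.

Lemma infim_lt P f a t : P t -> infim P f < a -> exists2 t, P t & f t < a.
Proof.
move=> Pt ltia; apply: contrapT => h; move: ltia; apply/negP; rewrite -leNgt.
apply: (infim_ge Pt) => u Pu; rewrite leNgt; apply/negP => fua.
by apply: h; exists u.
Qed.

End RealInf.

Section HahnBanach.
Variables (R : realType) (V : lmodType R[i]).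
Local Notation C := R[i].

(** Positive homogeneity is asked as an inequality only, which passes to infima directly; applying
    it to the inverse scalar recovers equality. *)
Definition sublinear (s : V -> R) : Prop :=
  (forall x y, s (x + y) <= s x + s y) /\
  (forall (t : R) x, 0 < t -> s (t%:C *: x) <= t * s x).

Section SublinearBasics.
Variable s : V -> R.
Hypothesis sl : sublinear s.

Lemma sublinear0 : s 0 = 0.
Proof.
have h1 : s 0 <= s 0 + s 0 by rewrite -{1}(addr0 0) sl.1.
have h2 : s 0 <= 2^-1 * s 0 by rewrite -{1}(scaler0 V (2^-1)%:C) sl.2.
lra.
Qed.

Lemma sublinearZ t x : 0 <= t -> s (t%:C *: x) = t * s x.
Proof.
rewrite le_eqVlt => /predU1P[<-|t0]; first by rewrite scale0r sublinear0 mul0r.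
apply/le_anti; rewrite sl.2//=.
have : s (t^-1%:C *: (t%:C *: x)) <= t^-1 * s (t%:C *: x).
  by rewrite sl.2// invr_gt0.
rewrite scalerA -rmorphM mulVf ?gt_eqF// scale1r.
by rewrite -(@ler_pM2l _ t)// mulrA mulfV ?gt_eqF// mul1r.
Qed.

Lemma sublinear_ge x : - s (- x) <= s x.
Proof. by have := sl.1 x (- x); rewrite subrr sublinear0; lra. Qed.

End SublinearBasics.

(* The largest sublinear functional below [s] which is at most [- s x] at [- x]. *)
Definition slide (s : V -> R) (x y : V) : R :=
  infim [set t : R | 0 <= t] (fun t => s (y + t%:C *: x) - t * s x).

(** The bound does not involve [t], so the infimum in [slide] is a genuine one: it is
    [s (t x) <= s (y + t x) + s (- y)]. *)
Lemma slide_lb s x y t : sublinear s -> 0 <= t ->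
  - s (- y) <= s (y + t%:C *: x) - t * s x.
Proof.
move=> sl t0; rewrite -(sublinearZ sl)//.
have := sl.1 (y + t%:C *: x) (- y).
by rewrite addrC addKr; lra.
Qed.

Lemma slide_le s x y t : sublinear s -> 0 <= t ->
  slide s x y <= s (y + t%:C *: x) - t * s x.
Proof.
move=> sl t0.
by apply: (@infim_le _ _ _ _ (- s (- y))) => // u u0; exact: slide_lb.
Qed.

Lemma slide_ge s x y b :
  (forall t, 0 <= t -> b <= s (y + t%:C *: x) - t * s x) -> b <= slide s x y.
Proof. by move=> h; apply: (@infim_ge _ _ _ _ _ 0) => //=. Qed.

Lemma slide_sublinear s x : sublinear s -> sublinear (slide s x).
Proof.
move=> sl; split=> [y z|c y c0].
  rewrite -lerBlDr; apply: slide_ge => t t0.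
  rewrite lerBlDr [leRHS]addrC -lerBlDr; apply: slide_ge => u u0.
  rewrite lerBlDr; have tu0 : 0 <= t + u by rewrite addr_ge0.
  apply: le_trans (slide_le x (y + z) sl tu0) _.
  have -> : y + z + (t + u)%:C *: x = (y + t%:C *: x) + (z + u%:C *: x).
    by rewrite rmorphD scalerDl addrACA.
  by have := sl.1 (y + t%:C *: x) (z + u%:C *: x); lra.
rewrite mulrC -ler_pdivrMr//; apply: slide_ge => t t0; rewrite ler_pdivrMr//.
have ct0 : 0 <= c * t by rewrite mulr_ge0// ltW.
apply: le_trans (slide_le x (c%:C *: y) sl ct0) _.
have -> : c%:C *: y + (c * t)%:C *: x = c%:C *: (y + t%:C *: x).
  by rewrite scalerDr scalerA rmorphM.
by rewrite (sublinearZ sl) ?(ltW c0)//; lra.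
Qed.

Lemma slide_base s x y : sublinear s -> slide s x y <= s y.
Proof.
move=> sl; apply: le_trans (slide_le x y sl (lexx 0)) _.
by rewrite scale0r addr0 mul0r subr0.
Qed.

(** Zorn's lemma on the sublinear functionals below [r], with the order reversed. A chain is bounded
    by its pointwise infimum, finite because every member is at least [- r (- x)] at [x]. *)
Lemma minimal_sublinear (r : V -> R) : sublinear r ->
  exists2 s, sublinear s /\ (forall x, s x <= r x) &
    forall s', sublinear s' -> (forall x, s' x <= s x) -> s' = s.
Proof.
move=> slr.
pose T := {s : V -> R | sublinear s /\ forall x, s x <= r x}.
pose ord (s t : T) : bool := `[< forall x, sval t x <= sval s x >].
have [| | | |[s [sl sr]] smin] := @Zorn T ord.
- by move=> t; apply/asboolP.
- move=> a b c /asboolP ab /asboolP bc; apply/asboolP => x.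
  exact: le_trans (bc x) (ab x).
- move=> [a pa] [b pb] /asboolP /= ab /asboolP /= ba.
  have e : a = b by apply/funext => x; apply/le_anti; rewrite ab ba.
  by subst b; congr exist; exact: Prop_irrelevance.
- move=> A totA; have [[t0 At0]|A0] := pselect (exists t, A t); last first.
    have h : sublinear r /\ forall x, r x <= r x by [].
    by exists (exist _ r h) => s As; exfalso; apply: A0; exists s.
  pose m x := infim A (fun t => sval t x).
  have lb x t : A t -> - r (- x) <= sval t x.
    case: t => t [slt tr] /= _; apply: le_trans (sublinear_ge slt x).
    by rewrite lerN2.
  have mle x t : A t -> m x <= sval t x.
    by move=> At; apply: (infim_le (b := - r (- x))) => // u; exact: lb.
  have mge x b : (forall t, A t -> b <= sval t x) -> b <= m x.
    by move=> h; exact: (infim_ge At0).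
  have slm : sublinear m.
    split=> [x y|c x c0].
      rewrite -lerBlDr; apply: (mge) => t At.
      rewrite lerBlDr [leRHS]addrC -lerBlDr; apply: (mge) => u Au; rewrite lerBlDr.
      (* Subadditivity of the infimum needs one member below both [t] and [u], which the chain
         provides. *)
      case: (totA _ _ At Au) => /asboolP tu.
        apply: le_trans (mle (x + y) _ Au) _.
        by have := (svalP u).1.1 x y; have := tu x; lra.
      apply: le_trans (mle (x + y) _ At) _.
      by have := (svalP t).1.1 x y; have := tu y; lra.
    rewrite mulrC -ler_pdivrMr//; apply: (mge) => t At; rewrite ler_pdivrMr//.
    apply: le_trans (mle (c%:C *: x) _ At) _.
    by rewrite mulrC; exact: (svalP t).1.2.
  have mr x : m x <= r x by apply: le_trans (mle x _ At0) ((svalP t0).2 x).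
  by exists (exist _ m (conj slm mr)) => s As; apply/asboolP => x; exact: mle.
- exists s => // s' sl' s's.
  have s'r x : s' x <= r x by apply: le_trans (s's x) (sr x).
  have := smin (exist _ s' (conj sl' s'r)).
  by move=> /(_ (introT (asboolP _) s's)) /(congr1 sval).
Qed.

(* A minimal sublinear functional is unchanged by [slide], hence additive. *)
Lemma minimal_sublinear_additive s : sublinear s ->
  (forall s', sublinear s' -> (forall x, s' x <= s x) -> s' = s) ->
  forall x y, s (x + y) = s x + s y.
Proof.
move=> sl smin x y; apply/le_anti; rewrite sl.1 /=.
have e := smin _ (slide_sublinear x sl) (fun z => slide_base x z sl).
have := slide_le x y sl ler01; rewrite e scale1r mul1r [y + x]addrC; lra.
Qed.

(** No partial functional is extended: a minimal sublinear functional below [slide r x0] is already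
    linear, and [slide r x0 (- x0) <= - r x0] forces the value [r x0] at [x0]. *)
Lemma real_hahn_banach (r : V -> R) x0 : sublinear r -> exists f : V -> R,
  [/\ forall x y, f (x + y) = f x + f y,
      forall (t : R) x, f (t%:C *: x) = t * f x,
      forall x, f x <= r x & f x0 = r x0].
Proof.
move=> slr; have slr' := slide_sublinear x0 slr.
have [f [slf fr] fmin] := minimal_sublinear slr'.
have fD := minimal_sublinear_additive slf fmin.
have f0 := sublinear0 slf.
have fN x : f (- x) = - f x by have := fD x (- x); rewrite subrr f0; lra.
have fle x : f x <= r x by apply: le_trans (fr x) (slide_base x0 x slr).
exists f; split => //.
  move=> t x; have [t0|/ltW t0] := leP 0 t; first exact: sublinearZ.
  rewrite -[t]opprK rmorphN scaleNr fN mulNr; congr (- _).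
  by rewrite (sublinearZ slf) ?oppr_ge0.
apply/le_anti; rewrite fle /=.
have := fr (- x0); have := slide_le x0 (- x0) slr ler01.
by rewrite scale1r addNr (sublinear0 slr) mul1r fN; lra.
Qed.

Lemma hahn_banach (r : V -> R) x0 : rseminorm r -> exists f : V -> C^o,
  [/\ linear f, forall x, normc (f x) <= r x & f x0 = (r x0)%:C].
Proof.
move=> sr; have slr : sublinear r.
  split=> [x y|t x t0]; first exact: sn_add.
  by rewrite (snZr sr)// ltW.
have [f [fD fZ fr fx0]] := real_hahn_banach x0 slr.
(* The complex-linear functional with real part [f]. *)
pose F x : C^o := f x -i* f ('i%C *: x).
have fN x : f (- x) = - f x.
  by rewrite -scaleN1r -[X in X *: x](_ : (-1)%:C = _) ?fZ ?mulN1r// rmorphN.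
have linF : linear F.
  move=> a x y.
  have fc z : f (a *: z) = Re a * f z + Im a * f ('i%C *: z).
    by rewrite {1}(complexE a) ['i%C * _]mulrC scalerDl -scalerA fD !fZ.
  rewrite /F scalerDr !fD; apply/eqP; rewrite eq_complex /=.
  have -> : f ('i%C *: (a *: x)) = Re a * f ('i%C *: x) - Im a * f x.
    rewrite scalerA mulrC -scalerA fc scalerA.
    have -> : 'i%C * 'i%C = -1 :> C by rewrite -expr2 sqr_i.
    by rewrite scaleN1r fN mulrN.
  rewrite fc; case: a {fc} => a b /=; apply/andP; split; apply/eqP; ring.
have rF x : normc (F x) <= r x.
  have [->|Fx0] := eqVneq (F x) 0; first by rewrite normc0 (sn_ge0 sr).
  (* Rotating [x] makes [F x] real and nonnegative, where it coincides with [f], and leaves [r x]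
     unchanged. *)
  pose a : C := (normc (F x))%:C / F x.
  have aF : F (a *: x) = (normc (F x))%:C :> C.
    by rewrite (linZ linF) /a /GRing.scale /= mulfVK.
  have na : normc a = 1.
    rewrite /a normcM normc_real normcV ger0_norm ?normc_ge0// mulfV//.
    by rewrite gt_eqF// normc_gt0.
  have -> : r x = r (a *: x) by rewrite (snZ sr) na mul1r.
  by move/(congr1 (@Re _)): aF => /= <-.
exists F; split=> //; have ReF : Re (F x0) = r x0 by rewrite /= fx0.
by rewrite -ReF; apply: normc_le_Re; rewrite ReF.
Qed.

End HahnBanach.

(** * Continuous seminorms of a locally convex space *)

Section Gauge.
Variables (R : realType) (V : lmodType R[i]).
Local Notation C := R[i].

Definition disk (U : set V) : Prop :=
  forall (a b : C) x y, normc a + normc b <= 1 -> U x -> U y ->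
    U (a *: x + b *: y).

Definition absorbing (U : set V) : Prop :=
  forall x, exists2 t : R, 0 < t & U (t^-1%:C *: x).

Definition gauge (U : set V) (x : V) : R :=
  infim [set t : R | 0 < t /\ U (t^-1%:C *: x)] id.

Variable U : set V.
Hypotheses (dU : disk U) (aU : absorbing U).

Lemma disk_scale a x : normc a <= 1 -> U x -> U (a *: x).
Proof.
move=> a1 Ux; rewrite -[_ *: _]addr0 -(scale0r x).
by apply: dU => //; rewrite normc0 addr0.
Qed.

Lemma gauge_le t x : 0 < t -> U (t^-1%:C *: x) -> gauge U x <= t.
Proof.
move=> t0 Ut; apply: (@infim_le _ _ _ _ 0) => //.
by move=> u [/ltW].
Qed.

Lemma gauge_ge b x :
  (forall t, 0 < t -> U (t^-1%:C *: x) -> b <= t) -> b <= gauge U x.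
Proof.
move=> h; have [t t0 Ut] := aU x.
by apply: (@infim_ge _ _ _ _ _ t) => // u [u0 Uu]; exact: h.
Qed.

Lemma gauge_lt t x : gauge U x < t -> U (t^-1%:C *: x).
Proof.
move=> gt; have [u u0 Uu] := aU x.
have [s [s0 Us] /= st] := infim_lt (conj u0 Uu) gt.
have -> : t^-1%:C *: x = (s / t)%:C *: (s^-1%:C *: x).
  by rewrite scalerA -rmorphM mulrAC mulfV ?mul1r// gt_eqF.
apply: disk_scale => //; rewrite normc_real ger0_norm.
  by rewrite ler_pdivrMr ?mul1r ?ltW// (lt_trans s0).
by rewrite divr_ge0// ltW// (lt_trans s0).
Qed.

Lemma gauge_seminorm : rseminorm (gauge U).
Proof.
have gD x y : gauge U (x + y) <= gauge U x + gauge U y.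
  rewrite -lerBlDr; apply: gauge_ge => t t0 Ut.
  rewrite lerBlDr [leRHS]addrC -lerBlDr; apply: gauge_ge => u u0 Uu.
  rewrite lerBlDr; apply: gauge_le; first by rewrite addr_gt0.
  have tu0 : u + t != 0 by rewrite gt_eqF// addr_gt0.
  have -> : (u + t)^-1%:C *: (x + y) =
      (t / (u + t))%:C *: (t^-1%:C *: x) + (u / (u + t))%:C *: (u^-1%:C *: y).
    rewrite !scalerA -!rmorphM mulrAC mulfV ?gt_eqF// mul1r.
    by rewrite mulrAC mulfV ?gt_eqF// mul1r scalerDr.
  have t0' := ltW t0; have u0' := ltW u0.
  apply: dU => //; rewrite !normc_real !ger0_norm ?divr_ge0 ?addr_ge0//.
  by rewrite -mulrDl [t + u]addrC mulfV.
have g0 x : 0 <= gauge U x by apply: gauge_ge => t /ltW.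
have gZ a x : gauge U (a *: x) <= normc a * gauge U x.
  have [->|a0] := eqVneq a 0.
    rewrite scale0r normc0 mul0r; apply/ler_addgt0Pl => e e0; rewrite addr0.
    have [t t0 Ut] := aU 0.
    by apply: gauge_le => //; move: Ut; rewrite !scaler0.
  have na : 0 < normc a by rewrite normc_gt0.
  rewrite mulrC -ler_pdivrMr//; apply: gauge_ge => t t0 Ut.
  rewrite ler_pdivrMr//; apply: gauge_le; first by rewrite mulr_gt0.
  have -> : (t * normc a)^-1%:C *: (a *: x) =
      (a / (normc a)%:C) *: (t^-1%:C *: x).
    rewrite !scalerA; congr (_ *: _).
    by rewrite invfM rmorphM -!fmorphV mulrC mulrA mulrAC.
  apply: disk_scale => //.
  by rewrite normcM normcV normc_real ger0_norm ?(ltW na)// mulfV// gt_eqF.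
split=> // a x; apply/le_anti; rewrite gZ /=.
have [->|a0] := eqVneq a 0; first by rewrite normc0 mul0r.
have na : 0 < normc a by rewrite normc_gt0.
rewrite -ler_pdivlMl// -normcV; apply: le_trans (gZ _ _).
by rewrite scalerA mulVf// scale1r.
Qed.

Lemma gauge_lt1 x : gauge U x < 1 -> U x.
Proof. by move=> /gauge_lt; rewrite invr1 scale1r. Qed.

Lemma gauge_le1 x : U x -> gauge U x <= 1.
Proof. by move=> Ux; apply: gauge_le => //; rewrite invr1 scale1r. Qed.

End Gauge.

Section ContinuousSeminorms.
Variable R : realType.
Local Notation C := R[i].

Definition cseminorm (E : tvsType C) (p : E -> R) : Prop :=
  rseminorm p /\ nbhs 0 [set x | p x < 1].

Lemma nbhs0_normc (A : set C^o) : nbhs 0 A <->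
  exists2 t : R, 0 < t & forall z, normc z < t -> A z.
Proof.
split=> [/nbhs_ballP[e /= /gt0_complexE[t t0 ->] eA]|[t t0 tA]].
  exists t => // z zt; apply: eA; rewrite -ball_normE /= sub0r normrN.
  by move: zt; rewrite -ltcR.
apply/nbhs_ballP; exists t%:C; first by rewrite /= ltcR.
move=> z; rewrite -ball_normE /= sub0r normrN => h; apply: tA.
by rewrite -ltcR.
Qed.

Section OneSpace.
Variable E : tvsType C.
Implicit Types (p q : E -> R) (U : set E) (x y : E).

Lemma nbhs_translate x U : nbhs x U <-> nbhs 0 [set y | U (x + y)].
Proof.
split=> [xU|/(nbhsT x)]; last first.
  by apply: filterS => _ [y Uy <-].
have := nbhsB (- x) xU; rewrite addNr; apply: filterS => _ [z Uz <-] /=.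
by rewrite addrA subrr add0r.
Qed.

Lemma nbhs0_scale t U : 0 < t -> nbhs 0 U -> nbhs 0 [set x : E | U (t%:C *: x)].
Proof.
move=> t0 U0; have tC : t%:C != 0 :> C.
  by apply/eqP => -[] /eqP; rewrite gt_eqF.
have := nbhs0Z (invr_neq0 tC) U0; apply: filterS => _ [x Ux <-] /=.
by rewrite scalerA mulfV// scale1r.
Qed.

Lemma cseminorm_nbhs p t : cseminorm p -> 0 < t -> nbhs 0 [set x | p x < t].
Proof.
move=> [sp p0] t0; have ti0 : 0 < t^-1 by rewrite invr_gt0.
have := nbhs0_scale ti0 p0; apply: filterS => x /=.
by rewrite (snZr sp) ?(ltW ti0)// ltr_pdivrMl// mulr1.
Qed.

Lemma cseminorm_nbhs_at p t x : cseminorm p -> 0 < t ->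
  nbhs x [set y | p (y - x) < t].
Proof.
move=> cp t0; apply/nbhs_translate.
have := cseminorm_nbhs cp t0; apply: filterS => y /=.
by rewrite [x + y]addrC addrK.
Qed.

Lemma nbhs0_absorb U x : nbhs 0 U -> exists2 t : R, 0 < t & U (t^-1%:C *: x).
Proof.
move=> U0; have := @scale_continuous _ E (0, x) U.
rewrite /= scale0r => /(_ U0)[[A B] [/= A0 Bx]] AB.
have [t t0 tA] := (nbhs0_normc A).1 A0.
exists (t / 2)^-1; first by rewrite invr_gt0 divr_gt0.
apply: (AB ((t / 2)^-1^-1%:C, x)); split=> /=; last exact: nbhs_singleton.
apply: tA; rewrite invrK normc_real.
by rewrite ger0_norm ?divr_ge0 ?(ltW t0)//; lra.
Qed.

(** The convex base need not consist of circled sets, so [D] is the circled core of a convex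
    neighbourhood [b]; it is still a neighbourhood of 0 by joint continuity of scalar multiplication
    at the origin. *)
Lemma nbhs0_disk U : nbhs 0 U ->
  exists D : set E, [/\ disk D, absorbing D, nbhs 0 D & D `<=` U].
Proof.
move=> U0; have [B Bconv [Bopen Bbase]] := @locally_convex C E.
have [b [Bb b0] bU] := Bbase 0 U U0.
have nb : nbhs 0 b by apply: open_nbhs_nbhs; split=> //; exact: Bopen.
have bconv (t : R) x y : 0 <= t -> t <= 1 -> b x -> b y ->
    b (t%:C *: x + (1 - t)%:C *: y).
  move=> t0 t1 bx yb.
  have t0' : 0 <= t%:C :> C by rewrite ler0c.
  have t1' : t%:C <= 1 :> C by rewrite lecR.
  have := Bconv b (mem_set Bb) x y (Itv01 t0' t1') (mem_set bx) (mem_set yb).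
  move/set_mem; by rewrite /conv /= rmorphB.
pose D := [set x : E | forall a : C, normc a <= 1 -> b (a *: x)].
have dD : disk D.
  move=> a c x y ac1 Dx Dy d d1; rewrite scalerDr !scalerA.
  have [s0|s0] := eqVneq (normc a + normc c) 0.
    have a0 : a = 0.
      by apply: normc_eq0; have := normc_ge0 a; have := normc_ge0 c; lra.
    have c0 : c = 0.
      by apply: normc_eq0; have := normc_ge0 a; have := normc_ge0 c; lra.
    by rewrite a0 c0 mulr0 !scale0r addr0.
  set s := normc a + normc c in s0 ac1.
  have sge0 : 0 <= s by rewrite addr_ge0 ?normc_ge0.
  have sgt0 : 0 < s by rewrite lt_neqAle eq_sym s0.
  (* Moving the phases of [a] and [c] into the vectors turns [d (a x + c y)] into a convex
     combination of multiples of [x] and [y] by scalars of modulus at most 1. *)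
  have polar (z : C) : z = (normc z)%:C * (z / (normc z)%:C).
    have [->|z0] := eqVneq z 0; first by rewrite mul0r mulr0.
    rewrite mulrCA mulfV ?mulr1//; apply/eqP => -[] /eqP.
    by rewrite gt_eqF// normc_gt0.
  have npolar (z : C) : normc (z / (normc z)%:C) <= 1.
    rewrite normcM normcV normc_real ger0_norm ?normc_ge0//.
    have [->|z0] := eqVneq z 0; first by rewrite normc0 mul0r.
    by rewrite mulfV// gt_eqF// normc_gt0.
  have sd (z : C) : normc z <= 1 -> normc (d * s%:C * z) <= 1.
    move=> z1; rewrite !normcM normc_real ger0_norm//.
    by rewrite mulr_ile1 ?mulr_ge0 ?normc_ge0// mulr_ile1 ?normc_ge0.
  have := bconv (normc a / s) _ _ _ _ (Dx _ (sd _ (npolar a)))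
    (Dy _ (sd _ (npolar c))).
  have -> : 1 - normc a / s = normc c / s.
    rewrite -{1}(mulfV s0) -mulrBl; congr (_ / _).
    by rewrite /s addrC addrA addNr add0r.
  have e (z : C) : (normc z / s)%:C * (d * s%:C * (z / (normc z)%:C)) = d * z.
    rewrite [in RHS](polar z); set w := z / _; rewrite rmorphM /= fmorphV.
    have sC : s%:C != 0 :> C by apply/eqP => -[] /eqP; rewrite (negbTE s0).
    by field.
  rewrite !scalerA !e; apply.
    by rewrite divr_ge0 ?normc_ge0.
  by rewrite ler_pdivrMr// mul1r lerDl normc_ge0.
have nD : nbhs 0 D.
  have := @scale_continuous _ E (0, 0) b.
  rewrite /= scale0r => /(_ nb)[[A W] [/= A0 W0]] AW.
  have [t t0 tA] := (nbhs0_normc A).1 A0.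
  have t20 : 0 < (t / 2)^-1 by rewrite invr_gt0 divr_gt0.
  have := nbhs0_scale t20 W0; apply: filterS => x Wx a a1.
  have := AW (a * (t / 2)%:C, (t / 2)^-1%:C *: x).
  rewrite /= scalerA -mulrA -rmorphM mulfV ?gt_eqF ?divr_gt0// mulr1; apply.
  split=> //; apply: tA; rewrite normcM normc_real ger0_norm ?divr_ge0 ?(ltW t0)//.
  have t20' : 0 <= t / 2 by rewrite divr_ge0 ?(ltW t0).
  by have := ler_wpM2r t20' a1; lra.
exists D; split=> //.
  by move=> x; exact: nbhs0_absorb.
by move=> x Dx; apply: bU; have := Dx 1; rewrite scale1r; apply; rewrite normc1.
Qed.

Lemma nbhs0_cseminorm U : nbhs 0 U ->
  exists2 p, cseminorm p & forall x, p x < 1 -> U x.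
Proof.
move=> /nbhs0_disk[D [dD aD nD DU]]; exists (gauge D); last first.
  by move=> x /(gauge_lt1 dD aD)/DU.
split; first exact: gauge_seminorm.
(* On [D] the gauge is only at most 1; halving [D] gives the strict inequality. *)
have := nbhs0_scale (ltr0Sn R 1) nD; apply: filterS => x Dx /=.
have : gauge D ((2 : R)%:C *: x) <= 1 by exact: gauge_le1.
by rewrite (snZr (gauge_seminorm dD aD))//; lra.
Qed.

Lemma nbhs_cseminorm x U : nbhs x U <->
  exists2 p, cseminorm p & forall y, p (y - x) < 1 -> U y.
Proof.
split=> [/nbhs_translate/nbhs0_cseminorm[p cp pU]|[p cp pU]].
  by exists p => // y /pU /=; rewrite addrC subrK.
by apply: filterS (cseminorm_nbhs_at x cp ltr01) => y /pU.
Qed.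

Lemma cseminormD p q : cseminorm p -> cseminorm q ->
  cseminorm (fun x => p x + q x).
Proof.
move=> cp cq; split; first exact: rseminormD cp.1 cq.1.
have h : 0 < 2^-1 :> R by rewrite invr_gt0.
apply: filterS (filterI (cseminorm_nbhs cp h) (cseminorm_nbhs cq h)) => x /= [].
lra.
Qed.

Lemma cseminorm_scale p c : 0 <= c -> cseminorm p ->
  cseminorm (fun x => c * p x).
Proof.
move=> c0 cp; split; first exact: rseminorm_scale cp.1.
have c1 : 0 < (c + 1)^-1 by rewrite invr_gt0 ltr_wpDl.
apply: filterS (cseminorm_nbhs cp c1) => x /=.
rewrite -[(c + 1)^-1]mul1r ltr_pdivlMr ?ltr_wpDl// => h.
by apply: le_lt_trans h; rewrite mulrC ler_wpM2l ?(sn_ge0 cp.1)// lerDl.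
Qed.

Lemma cseminorm_le p q : rseminorm q -> cseminorm p ->
  (forall x, q x <= p x) -> cseminorm q.
Proof.
move=> sq [sp np] qp; split=> //.
by apply: filterS np => x /=; exact: le_lt_trans.
Qed.

Lemma cseminorm0 : cseminorm (fun _ : E => 0 : R).
Proof.
split; first by split=> [x y|a x]; rewrite ?addr0 ?mulr0.
by apply: filterS filterT => x _ /=.
Qed.

Lemma closure_cseminorm (S : set E) x : closure S x <->
  forall p, cseminorm p -> exists2 y, S y & p (y - x) < 1.
Proof.
split=> [cS p cp|h B /nbhs_cseminorm[p cp pB]].
  by have [y [Sy py]] := cS _ (cseminorm_nbhs_at x cp ltr01); exists y.
by have [y Sy py] := h p cp; exists y; split=> //; exact: pB.
Qed.

Lemma closure_cseminorm_lt (S : set E) x p e : closure S x -> cseminorm p ->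
  0 < e -> exists2 y, S y & p (y - x) < e.
Proof.
move=> cS cp e0.
by have [y [Sy py]] := cS _ (cseminorm_nbhs_at x cp e0); exists y.
Qed.

Lemma dense_closure (S : set E) : dense S <-> forall x, closure S x.
Proof.
split=> [dS x B /nbhs_interior xB|cS O [x Ox] oO].
  have [||y [By Sy]] := dS B°.
  - by exists x; exact: nbhs_singleton xB.
  - exact: open_interior.
  by exists y; split=> //; exact: interior_subset By.
have [y [Sy Oy]] := cS x O (open_nbhs_nbhs (conj oO Ox)).
by exists y.
Qed.

Lemma hausdorff_cseminorm : hausdorff_space E <->
  forall x, (forall p, cseminorm p -> p x = 0) -> x = 0.
Proof.
split=> [hE x px0|h x y xy].
  apply: hE => A B /nbhs_cseminorm[p cp pA] /nbhs_cseminorm[q cq qB].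
  exists x; split; first by apply: pA; rewrite subrr (sn0 cp.1).
  by apply: qB; rewrite subr0 px0.
apply/eqP; rewrite -subr_eq0; apply/eqP/h => p cp; apply/le_anti.
rewrite (sn_ge0 cp.1) andbT; apply/ler_addgt0Pl => e e0; rewrite addr0.
have e2 : 0 < e / 2 by rewrite divr_gt0.
have [z [/= zx zy]] := xy _ _ (cseminorm_nbhs_at x cp e2)
  (cseminorm_nbhs_at y cp e2).
by rewrite (le_trans (sn_tri cp.1 z _ _))// (snBC cp.1 x z); lra.
Qed.

Lemma tvs_cauchy_cseminorm (F : set_system E) : ProperFilter F ->
  tvs_cauchy F <-> forall p, cseminorm p ->
    exists2 V, F V & forall x y, V x -> V y -> p (x - y) < 1.
Proof.
move=> PF; split=> [cF p cp|h U /nbhs0_cseminorm[p cp pU]].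
  exact: cF (cseminorm_nbhs cp ltr01).
by have [V FV pV] := h p cp; exists V => // x y Vx Vy; apply/pU/pV.
Qed.

End OneSpace.

Lemma linear_continuous_cseminorm (E F : tvsType C) (f : E -> F) : linear f ->
  (forall q, cseminorm q -> exists2 p, cseminorm p & forall x, q (f x) <= p x) ->
  continuous_linear f.
Proof.
move=> lf h; split=> // x U /nbhs_cseminorm[q cq qU].
have [p cp pq] := h q cq.
apply: filterS (cseminorm_nbhs_at x cp ltr01) => y /= py.
by apply: qU; rewrite -(linB lf) (le_lt_trans (pq _)).
Qed.

Lemma cseminorm_comp (E F : tvsType C) (f : E -> F) (q : F -> R) :
  continuous_linear f -> cseminorm q -> cseminorm (q \o f).
Proof.
move=> [lf cf] [sq nq]; split; first exact: rseminorm_comp.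
have := cf 0 [set y | q y < 1]; rewrite /= (lin0 lf).
exact.
Qed.

End ContinuousSeminorms.

(** * Separation and extension of functionals *)

Section HahnBanachConsequences.
Variables (R : realType) (V : lmodType R[i]).
Local Notation C := R[i].

Lemma lsubspaceZ (N : set V) a x : linear_subspace N -> N x -> N (a *: x).
Proof. by move=> [N0 NL] Nx; rewrite -[_ *: _]addr0; exact: NL. Qed.

Lemma lsubspaceD (N : set V) x y : linear_subspace N -> N x -> N y -> N (x + y).
Proof. by move=> [N0 NL] Nx Ny; rewrite -[x]scale1r; exact: NL. Qed.

Lemma lsubspaceN (N : set V) x : linear_subspace N -> N x -> N (- x).
Proof. by move=> sN Nx; rewrite -scaleN1r; exact: lsubspaceZ. Qed.

Lemma lsubspaceB (N : set V) x y : linear_subspace N -> N x -> N y -> N (x - y).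
Proof. by move=> sN Nx Ny; apply: lsubspaceD => //; exact: lsubspaceN. Qed.

(** The set [U] below is the unit ball of the quotient seminorm of [p] modulo [N], and its gauge is
    that seminorm. As [x0] lies outside [U], the functional attaining the gauge at [x0] does not
    vanish there. *)
Lemma hahn_banach_quotient (p : V -> R) (N : set V) x0 :
  rseminorm p -> linear_subspace N -> (forall n, N n -> 1 <= p (x0 - n)) ->
  exists f : V -> C^o, [/\ linear f, forall x, normc (f x) <= p x,
    forall n, N n -> f n = 0 & f x0 = 1].
Proof.
move=> sp sN x0N; pose U := [set x | exists2 n, N n & p (x - n) < 1].
have dU : disk U.
  move=> a b x y ab [n Nn xn] [m Nm ym]; exists (a *: n + b *: m).
    by apply: lsubspaceD => //; exact: lsubspaceZ.
  rewrite opprD addrACA -!scalerBr (le_lt_trans (sn_add sp _ _))// !(snZ sp).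
  have := normc_ge0 a; have := normc_ge0 b.
  have := sn_ge0 sp (x - n); have := sn_ge0 sp (y - m).
  by have [le1|/ltW le1] := leP (p (x - n)) (p (y - m)); nra.
have aU : absorbing U.
  move=> x; exists (p x + 1); first by rewrite ltr_wpDl ?(sn_ge0 sp).
  exists 0; first exact: sN.1.
  have px1 : 0 < p x + 1 by rewrite ltr_wpDl ?(sn_ge0 sp).
  rewrite subr0 (snZr sp) ?invr_ge0 ?(ltW px1)//.
  by rewrite ltr_pdivrMl// mulr1 ltrDl.
have sg := gauge_seminorm dU aU.
have gp x : gauge U x <= p x.
  apply/ler_addgt0Pr => e e0.
  have pxe : 0 < p x + e by rewrite ltr_wpDl ?(sn_ge0 sp).
  apply: gauge_le => //; exists 0; first exact: sN.1.
  rewrite subr0 (snZr sp) ?invr_ge0 ?(ltW pxe)//.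
  by rewrite ltr_pdivrMl// mulr1 ltrDl.
have gN n : N n -> gauge U n = 0.
  move=> Nn; apply/le_anti; rewrite (sn_ge0 sg) andbT.
  apply/ler_addgt0Pl => e e0; rewrite addr0; apply: gauge_le => //.
  by exists (e^-1%:C *: n); [exact: lsubspaceZ|rewrite subrr (sn0 sp)].
have g1 : 1 <= gauge U x0.
  rewrite leNgt; apply/negP => /(gauge_lt1 dU aU)[n Nn].
  by rewrite ltNge x0N.
have [f [lf fg fx0]] := hahn_banach x0 sg.
have g0 : 0 < gauge U x0 by apply: lt_le_trans g1.
have nfg x : normc (f x) <= p x by apply: le_trans (fg x) (gp x).
(* The gauge at [x0] is at least 1, so normalizing the value to 1 keeps the functional below [p]. *)
exists (fun x => (gauge U x0)^-1%:C * f x); split.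
- move=> a x y; rewrite lf mulrDr /GRing.scale /=; congr (_ + _).
  by rewrite mulrCA.
- move=> x; rewrite normcM normc_real ger0_norm ?invr_ge0 ?(ltW g0)//.
  rewrite ler_pdivrMl//; apply: le_trans (nfg x) _.
  by rewrite ler_peMl ?(sn_ge0 sp).
- move=> n Nn; apply: normc_eq0; rewrite normcM; apply/le_anti/andP; split.
    by rewrite mulr_ge0_le0 ?normc_ge0// -(gN n Nn).
  by rewrite mulr_ge0 ?normc_ge0.
- by rewrite fx0 -rmorphM mulVf ?gt_eqF.
Qed.

End HahnBanachConsequences.

(* Apply [hahn_banach_quotient] to the graph of [- f] in [V * C]. *)
Lemma hahn_banach_extension (R : realType) (V : lmodType R[i]) (p : V -> R)
    (S : set V) (f : V -> R[i]^o) :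
  rseminorm p -> linear_subspace S ->
  (forall a x y, S x -> S y -> f (a *: x + y) = a *: f x + f y) ->
  (forall x, S x -> normc (f x) <= p x) ->
  exists F : V -> R[i]^o, [/\ linear F, forall x, normc (F x) <= p x &
    forall x, S x -> F x = f x].
Proof.
move=> sp sS fl fp.
have f0 : f 0 = 0.
  have := fl (-1) 0 0 sS.1 sS.1.
  by rewrite scaler0 addr0 scaleN1r addNr.
have fZ a x : S x -> f (a *: x) = a *: f x.
  by move=> Sx; have := fl a x 0 Sx sS.1; rewrite f0 !addr0.
pose N := [set z : V * R[i]^o | S z.1 /\ z.2 = - f z.1].
pose q (z : V * R[i]^o) := p z.1 + normc z.2.
have sq : rseminorm q.
  split=> [[x s] [y t]|a [x s]]; rewrite /q /=.
    by rewrite addrACA lerD ?(sn_add sp)// normcD.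
  by rewrite (snZ sp) /GRing.scale /= normcM mulrDr.
have sN : linear_subspace N.
  split; first by split; [exact: sS.1|rewrite /= f0 oppr0].
  move=> a [x s] [y t] [/= Sx ->] [/= Sy ->]; split=> /=; first exact: sS.2.
  by rewrite fl// opprD scalerN.
have [|F [lF Fq FN F1]] := hahn_banach_quotient (x0 := (0, 1)) sq sN.
  move=> [x s] [/= Sx ->]; rewrite /q /= sub0r (snN sp) opprK.
  apply: le_trans (lerD (fp x Sx) (lexx _)); rewrite addrC.
  by have := normcB (1 + f x) (f x); rewrite addrK;
     have := normcD (1 + f x) (- f x); rewrite addrK normc1 normcN; lra.
exists (fun x => F (x, 0)); split.
- move=> a x y; rewrite -lF.
  have <- : (a *: x + y, a *: 0 + 0) = a *: (x, 0) + (y, 0) :> V * R[i]^o by [].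
  by rewrite scaler0 addr0.
- by move=> x; have := Fq (x, 0); rewrite /q /= normc0 addr0.
- move=> x Sx; have := FN (x, - f x) (conj Sx erefl).
  have -> : (x, - f x) = - (f x) *: (0, 1) + (x, 0) :> V * R[i]^o.
    have <- : (- f x *: 0 + x, - f x *: 1 + 0) = - f x *: (0, 1) + (x, 0)
      :> V * R[i]^o by [].
    by rewrite scaler0 add0r addr0 /GRing.scale /= mulr1.
  rewrite lF F1 => /eqP; rewrite addrC addr_eq0 => /eqP ->.
  by rewrite scaleNr opprK /GRing.scale /= mulr1.
Qed.

(** * Spaces defined by seminorms and spaces of functions *)

Section SeminormedSpace.
Variable R : realType.
Local Notation C := R[i].

Record seminormed := Seminormed {
  sn_carrier : lmodType C;
  sn_index : Type;
  sn_family : sn_index -> sn_carrier -> R;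
  sn_familyP : forall l, rseminorm (sn_family l)
}.

(** An alias of the carrier, so that a topology depending on [d] can be registered on it. *)
Definition lcs_of (d : seminormed) : Type := sn_carrier d.

Variable d : seminormed.
Local Notation E := (lcs_of d).
HB.instance Definition _ := GRing.Lmodule.copy E (sn_carrier d).

(** The form that the continuous seminorms must have, given before the topology exists;
    [lcs_cseminormP] confirms it afterwards. Sums are taken because the family need not be
    directed. *)
Definition dominated (p : E -> R) : Prop :=
  rseminorm p /\ exists (s : seq (sn_index d)) (c : R), 0 <= c /\
    forall x, p x <= c * \sum_(l <- s) sn_family l x.

Definition lcs_nbhs (x : E) (U : set E) : Prop :=
  exists2 p, dominated p & forall y, p (y - x) < 1 -> U y.

Lemma sum_family_ge0 (s : seq (sn_index d)) (x : E) :
  0 <= \sum_(l <- s) sn_family l x.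
Proof. by apply: sumr_ge0 => l _; exact: sn_ge0 (sn_familyP l) _. Qed.

Lemma dominatedD p q : dominated p -> dominated q ->
  dominated (fun x => p x + q x).
Proof.
move=> [sp [s [b [b0 ps]]]] [sq [t [c [c0 qt]]]].
split; first exact: rseminormD.
exists (s ++ t), (b + c); split; first exact: addr_ge0.
move=> x; rewrite big_cat /=.
have := ps x; have := qt x.
by have := sum_family_ge0 s x; have := sum_family_ge0 t x; nra.
Qed.

Lemma dominated_scale c p : 0 <= c -> dominated p ->
  dominated (fun x => c * p x).
Proof.
move=> c0 [sp [s [b [b0 ps]]]]; split; first exact: rseminorm_scale.
exists s, (c * b); split; first exact: mulr_ge0.
by move=> x; rewrite -mulrA ler_wpM2l.
Qed.

Lemma dominated_family l : dominated (@sn_family d l).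
Proof.
split; first exact: sn_familyP.
by exists [:: l], 1; split=> // x; rewrite big_seq1 mul1r.
Qed.

Lemma dominated0 : dominated (fun=> 0).
Proof.
split; first by split=> [x y|a x]; rewrite ?addr0 ?mulr0.
by exists [::], 0; split=> // x; rewrite mul0r.
Qed.

HB.instance Definition _ := hasNbhs.Build E lcs_nbhs.

Let lcs_nbhs_filter (x : E) : ProperFilter (nbhs x).
Proof.
split; first by move=> [p [sp _]] /(_ x); apply; rewrite subrr (sn0 sp).
split.
- by exists (fun=> 0); first exact: dominated0.
- move=> A B [p dp pA] [q dq qB]; exists (fun x => p x + q x).
    exact: dominatedD.
  move=> y h; have := sn_ge0 dp.1 (y - x); have := sn_ge0 dq.1 (y - x).
  by split; [apply: pA|apply: qB]; lra.
- by move=> A B AB [p dp pA]; exists p => // y /pA/AB.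
Qed.

Let lcs_nbhs_singleton (x : E) A : nbhs x A -> A x.
Proof. by move=> [p [sp _] pA]; apply: pA; rewrite subrr (sn0 sp). Qed.

Lemma lcs_nbhs_ball (x y : E) p : dominated p -> p (y - x) < 1 ->
  nbhs y [set z | p (z - x) < 1].
Proof.
move=> dp yx; have r0 : 0 < 1 - p (y - x) by rewrite subr_gt0.
exists (fun z => (1 - p (y - x))^-1 * p z).
  by apply: dominated_scale => //; rewrite invr_ge0 ltW.
move=> z; rewrite ltr_pdivrMl// mulr1 => h /=.
by apply: le_lt_trans (sn_tri dp.1 y _ _) _; lra.
Qed.

Let lcs_nbhs_nbhs (x : E) A : nbhs x A -> nbhs x (nbhs^~ A).
Proof.
move=> [p dp pA]; exists p => // y yx.
have ? := @filter_filter _ _ (lcs_nbhs_filter y).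
by apply: filterS (lcs_nbhs_ball dp yx) => z; exact: pA.
Qed.

HB.instance Definition _ := Nbhs_isNbhsTopological.Build E
  lcs_nbhs_filter lcs_nbhs_singleton lcs_nbhs_nbhs.

Let lcs_add_continuous : continuous (fun x : E * E => x.1 + x.2).
Proof.
move=> [x y] U [p dp pU].
have d2 : dominated (fun z => 2 * p z) by exact: dominated_scale.
exists ([set z | 2 * p (z - x) < 1], [set z | 2 * p (z - y) < 1]).
  by split=> /=; exists (fun z => 2 * p z).
move=> [z w] [/= h1 h2]; apply: pU => /=; rewrite opprD addrACA.
by apply: le_lt_trans (sn_add dp.1 _ _) _; lra.
Qed.

Let lcs_scale_continuous : continuous (fun z : C^o * E => z.1 *: z.2).
Proof.
move=> [a x] U [p dp pU].
pose r : R := (2 * (p x + 1))^-1.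
have px := sn_ge0 dp.1 x; have na := normc_ge0 a.
have r0 : 0 < r by rewrite invr_gt0; lra.
have rp : r * p x < 2^-1.
  by rewrite /r ltr_pdivrMl; lra.
pose c : R := 2 * (normc a + r).
have c0 : 0 < c by rewrite /c; lra.
exists ([set b : C^o | normc (b - a) < r], [set z | c * p (z - x) < 1]).
  split=> /=; last first.
    by exists (fun z => c * p z) => //; exact: dominated_scale (ltW c0) _.
  apply/(@nbhs_translate _ C^o); apply/nbhs0_normc; exists r => // z /=.
  by rewrite [a + z]addrC addrK.
move=> [b z] [/= h1 h2]; apply: pU => /=.
have -> : b *: z - a *: x = b *: (z - x) + (b - a) *: x.
  by rewrite scalerBr scalerBl addrA subrK.
apply: le_lt_trans (sn_add dp.1 _ _) _; rewrite !(snZ dp.1).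
have nb : normc b <= normc a + r.
  by have := normcD a (b - a); rewrite addrC subrK; lra.
have pz := sn_ge0 dp.1 (z - x).
have h3 : normc b * p (z - x) <= (normc a + r) * p (z - x).
  by rewrite ler_wpM2r.
have h4 : normc (b - a) * p x <= r * p x by rewrite ler_wpM2r// ltW.
move: h2; rewrite /c -mulrA; lra.
Qed.

Let lcs_locally_convex :
  exists2 B : set_system E, (forall b, b \in B -> convex_set b) & basis B.
Proof.
exists [set b | exists2 x, exists2 p, dominated p &
    b = [set y | p (y - x) < 1] & True].
  move=> b /set_mem [x [p dp ->] _] y z t.
  move=> /set_mem /= hy /set_mem /= hz; apply/mem_set => /=.
  have [u u0 tu] : exists2 u : R, 0 <= u & t%:inum = u%:C :> C.
    by apply: ge0_complexE; rewrite ge0.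
  have u1 : u <= 1 by rewrite -lecR -tu le1.
  have -> : conv t y z - x = u%:C *: (y - x) + (1 - u)%:C *: (z - x).
    rewrite /conv /= tu rmorphB !scalerBr addrACA -opprD -scalerDl.
    by rewrite [u%:C + _]addrC subrK rmorph1 scale1r.
  apply: le_lt_trans (sn_add dp.1 _ _) _.
  rewrite !(snZr dp.1) ?subr_ge0//.
  have := sn_ge0 dp.1 (y - x); have := sn_ge0 dp.1 (z - x).
  have [->|un0] := eqVneq u 0; first lra.
  by have := u0; rewrite le_eqVlt eq_sym (negbTE un0) /=; nra.
split.
  move=> b [x [p dp ->] _]; rewrite openE => y /= yx.
  exact: lcs_nbhs_ball.
move=> x U [p dp pU]; exists [set y | p (y - x) < 1] => //.
by split; [exists x => //; exists p|rewrite /= subrr (sn0 dp.1)].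
Qed.

HB.instance Definition _ := PreTopologicalLmod_isTvs.Build C E
  lcs_add_continuous lcs_scale_continuous lcs_locally_convex.

HB.instance Definition _ :=
  PreTopologicalNmodule_isTopologicalNmodule.Build E lcs_add_continuous.
HB.instance Definition _ :=
  TopologicalNmodule_isTopologicalLmodule.Build C E lcs_scale_continuous.
HB.instance Definition _ := Uniform_isTvs.Build C E lcs_locally_convex.

Lemma lcs_cseminormP (p : E -> R) : cseminorm p <-> dominated p.
Proof.
split=> [[sp [q dq qp]]|dp]; last first.
  by split; [exact: dp.1|exists p => // y /=; rewrite subr0].
have [s [c [c0 qs]]] := dq.2.
split=> //; exists s, c; split=> // x; apply: le_trans (qs x).
apply/ler_addgt0Pr => e e0.
(* Dividing by [q x + e] instead of [q x] covers the vectors with [q x = 0]. *)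
have qe : 0 < q x + e by rewrite ltr_wpDl ?(sn_ge0 dq.1).
have := qp ((q x + e)^-1%:C *: x); rewrite subr0 /=.
rewrite (snZr dq.1) ?(snZr sp) ?invr_ge0 ?(ltW qe)//.
by rewrite !ltr_pdivrMl// !mulr1 ltrDl => /(_ e0)/ltW.
Qed.

Lemma cseminorm_family l : cseminorm (@sn_family d l : E -> R).
Proof. exact/lcs_cseminormP/dominated_family. Qed.

End SeminormedSpace.

Section FilterCompleteness.
Variables (R : realType) (T : Type) (F : set_system T).
Hypothesis PF : ProperFilter F.

Lemma real_filter_complete (u : T -> R) :
  (forall e : R, 0 < e -> exists2 V, F V &
    forall x y, V x -> V y -> `|u x - u y| <= e) ->
  exists z, forall e, 0 < e -> F [set x | `|u x - z| <= e].
Proof.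
move=> cu; have /cauchy_cvg/cvg_ex[z zF] : cauchy (u @ F).
  apply: cauchy_exP => e e0; have e2 : 0 < e / 2 by rewrite divr_gt0.
  have [V FV uV] := cu _ e2; have [x Vx] := filter_ex FV.
  exists (u x); apply: (@filterS T F _ V) => // y Vy; rewrite /= -ball_normE /=.
  by apply: le_lt_trans (uV _ _ Vx Vy) _; lra.
exists z => e e0; move/cvgrPdist_le : zF => /(_ e e0).
by apply: filterS => x; rewrite distrC.
Qed.

Lemma complex_filter_complete (u : T -> R[i]) :
  (forall e : R, 0 < e -> exists2 V, F V &
    forall x y, V x -> V y -> normc (u x - u y) <= e) ->
  exists z, forall e, 0 < e -> F [set x | normc (u x - z) <= e].
Proof.
move=> cu.
have [|a ha] := real_filter_complete (u := fun x => Re (u x)).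
  move=> e /cu[V FV uV]; exists V => // x y Vx Vy.
  by apply: le_trans (uV x y Vx Vy); rewrite -raddfB absRe_le_normc.
have [|b hb] := real_filter_complete (u := fun x => Im (u x)).
  move=> e /cu[V FV uV]; exists V => // x y Vx Vy.
  by apply: le_trans (uV x y Vx Vy); rewrite -raddfB absIm_le_normc.
exists (a +i* b) => e e0; have e2 : 0 < e / 2 by rewrite divr_gt0.
apply: filterS (filterI (ha _ e2) (hb _ e2)) => x /= [h1 h2].
apply: le_trans (normc_le_ReIm _) _.
by move: h1 h2; case: (u x) => c d /=; lra.
Qed.

End FilterCompleteness.

(** * Complete spaces of functions with uniform convergence on a family of sets *)

Section FunctionSpace.
Variable R : realType.
Local Notation C := R[i].

(* The space defined by these data is the closure of [fd_dense] for uniform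
   convergence on the sets [fd_sets l].  Dual Banach spaces, projective tensor
   products and completed quotients are all realized in this way, the last two
   as functions on a set of bilinear forms or functionals. *)
Record fdata := FData {
  fd_point : Type;
  fd_index : Type;
  fd_sets : fd_index -> set fd_point;
  fd_dense : set (fd_point -> C^o);
  fd_cover : forall x, exists l, fd_sets l x;
  fd_subspace : linear_subspace fd_dense;
  fd_bounded : forall f l, fd_dense f ->
    exists b, forall x, fd_sets l x -> normc (f x) <= b
}.

Variable d : fdata.
Local Notation G := (fd_point d).
Local Notation L := (fd_index d).
Local Notation S := (@fd_sets d).
Local Notation D := (@fd_dense d).

(** Finitely many indices are handled at once, since the sets [fd_sets l] need not form a directed
    family. *)
Definition fd_closure (g : G -> C^o) : Prop :=
  forall (s : seq L) (e : R), 0 < e -> exists2 f, D f &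
    forall l x, List.In l s -> S l x -> normc (f x - g x) <= e.

Definition fs_pred : {pred G -> C^o} := [pred g | `[< fd_closure g >]].

Lemma fs_pred_submod : GRing.subsemimod_closed fs_pred.
Proof.
split; first split.
- apply/asboolP => s e e0; exists 0; first exact: (fd_subspace d).1.
  by move=> l x _ _; rewrite subrr normc0 ltW.
- move=> f g /asboolP cf /asboolP cg; apply/asboolP => s e e0.
  have e2 : 0 < e / 2 by rewrite divr_gt0.
  have [f' Df' ff'] := cf s _ e2; have [g' Dg' gg'] := cg s _ e2.
  exists (f' + g'); first exact: lsubspaceD (fd_subspace d) _ _.
  move=> l x ls Sx.
  rewrite -[_ - _]/(f' x + g' x - (f x + g x)) opprD addrACA.
  apply: le_trans (normcD _ _) _.
  by have := ff' l x ls Sx; have := gg' l x ls Sx; lra.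
- move=> a f /asboolP cf; apply/asboolP => s e e0.
  have a1 : 0 < normc a + 1 by rewrite ltr_wpDl ?normc_ge0.
  have e2 : 0 < e / (normc a + 1) by rewrite divr_gt0.
  have [f' Df' ff'] := cf s _ e2.
  exists (a *: f'); first exact: lsubspaceZ (fd_subspace d) _.
  move=> l x ls Sx; have := ff' l x ls Sx; rewrite ler_pdivlMr// => h.
  have -> : (a *: f') x - (a *: f) x = a * (f' x - f x) by rewrite mulrBr.
  rewrite normcM; apply: le_trans h; rewrite mulrC ler_wpM2l ?normc_ge0//.
  by rewrite lerDl.
Qed.

HB.instance Definition _ :=
  GRing.isSubmodClosed.Build C (G -> C^o) fs_pred fs_pred_submod.

Record fspace := FSpace { fs_val :> G -> C^o; fs_valP : fs_val \in fs_pred }.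

HB.instance Definition _ := [isSub for fs_val].
HB.instance Definition _ := [Choice of fspace by <:].
HB.instance Definition _ := [SubChoice_isSubLmodule of fspace by <:].

Lemma fspace_ext (f g : fspace) : (forall x, f x = g x) -> f = g.
Proof. by move=> fg; apply: val_inj; apply/funext. Qed.

Lemma fspaceD (f g : fspace) x : (f + g) x = f x + g x. Proof. by []. Qed.
Lemma fspaceZ a (f : fspace) x : (a *: f) x = a * f x. Proof. by []. Qed.
Lemma fspaceB (f g : fspace) x : (f - g) x = f x - g x. Proof. by []. Qed.

Lemma fspace_closure (f : fspace) : fd_closure f.
Proof. by have /asboolP := fs_valP f. Qed.

Lemma fd_dense_closure f : D f -> fd_closure f.
Proof. by move=> Df s e e0; exists f => // l x _ _; rewrite subrr normc0 ltW. Qed.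

Lemma fspace_bounded (f : fspace) l :
  exists b, forall x, S l x -> normc (f x) <= b.
Proof.
have [g Dg gf] := fspace_closure f [:: l] ltr01.
have [b gb] := fd_bounded l Dg; exists (b + 1) => x Sx.
have := gf l x (or_introl erefl) Sx; have := gb x Sx.
by have := normcB (g x) (f x); have := normcD (f x - g x) (g x); rewrite subrK; lra.
Qed.

Definition fs_ball l : set fspace :=
  [set f | forall x, S l x -> normc (f x) <= 1].

Lemma fs_ball_disk l : disk (fs_ball l).
Proof.
move=> a b f g ab Uf Ug x Sx; rewrite fspaceD !fspaceZ.
apply: le_trans (normcD _ _) _; rewrite !normcM.
have := Uf x Sx; have := Ug x Sx; have := normc_ge0 a; have := normc_ge0 b.
by have := normc_ge0 (f x); have := normc_ge0 (g x); nra.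
Qed.

Lemma fs_ball_absorbing l : absorbing (fs_ball l).
Proof.
move=> f; have [b fb] := fspace_bounded f l.
have b1 : 0 < `|b| + 1 by rewrite ltr_wpDl.
exists (`|b| + 1) => // x Sx.
rewrite fspaceZ normcM normc_real ger0_norm ?invr_ge0 ?(ltW b1)//.
rewrite ler_pdivrMl// mulr1; apply: le_trans (fb x Sx) _.
by apply: le_trans (ler_norm b) _; rewrite lerDl.
Qed.

(** The supremum of [|f|] over [fd_sets l], obtained as a gauge so that the seminorm laws are
    inherited and an empty [fd_sets l] is no exception. *)
Definition fs_norm l : fspace -> R := gauge (fs_ball l).

Lemma fs_norm_seminorm l : rseminorm (fs_norm l).
Proof. exact: (gauge_seminorm (@fs_ball_disk l) (@fs_ball_absorbing l)). Qed.

Lemma fs_norm_le l (f : fspace) (b : R) : 0 <= b ->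
  (forall x, S l x -> normc (f x) <= b) -> fs_norm l f <= b.
Proof.
move=> b0 fb; apply/ler_addgt0Pr => e e0.
have be : 0 < b + e by rewrite ltr_wpDl.
apply: gauge_le => // x Sx.
rewrite fspaceZ normcM normc_real ger0_norm ?invr_ge0 ?(ltW be)//.
by rewrite ler_pdivrMl// mulr1; apply: le_trans (fb x Sx) _; lra.
Qed.

Lemma fs_norm_eval l (f : fspace) x : S l x -> normc (f x) <= fs_norm l f.
Proof.
move=> Sx; apply/ler_addgt0Pr => e e0.
have fe : 0 < fs_norm l f + e by rewrite ltr_wpDl ?(sn_ge0 (fs_norm_seminorm l)).
have fe' : fs_norm l f < fs_norm l f + e by rewrite ltrDl.
have := gauge_lt (@fs_ball_disk l) (@fs_ball_absorbing l) fe' x Sx.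
rewrite fspaceZ normcM normc_real ger0_norm ?invr_ge0 ?(ltW fe)//.
by rewrite ler_pdivrMl// mulr1.
Qed.

Definition fs_seminormed : seminormed R :=
  @Seminormed R fspace L fs_norm fs_norm_seminorm.

Definition fs_lcs : tvsType C := lcs_of fs_seminormed.

Definition fs_of (f : fs_lcs) : fspace := f.

Lemma fs_cseminorm l : @cseminorm R fs_lcs (fs_norm l).
Proof. exact: (@cseminorm_family R fs_seminormed l). Qed.

Lemma fs_dominated (p : fs_lcs -> R) : cseminorm p ->
  exists (s : seq L) (c : R), 0 <= c /\
    forall (f : fs_lcs) b, 0 <= b ->
      (forall l x, List.In l s -> S l x -> normc (fs_of f x) <= b) ->
      p f <= c * b.
Proof.
move=> /(@lcs_cseminormP R fs_seminormed)[_ [s [c [c0 ps]]]].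
exists s, (c * (size s)%:R); split; first by rewrite mulr_ge0.
move=> f b b0 fb; apply: le_trans (ps f) _; rewrite -mulrA ler_wpM2l//.
elim: s {ps} fb => [|l s IH] fb; first by rewrite big_nil mul0r.
rewrite big_cons /= -[(size s).+1]add1n natrD mulrDl mul1r lerD//.
  by apply: fs_norm_le => // x; apply: fb; left.
by apply: IH => m x ms; apply: fb; right.
Qed.

(** A Cauchy filter converges at each point by completeness of the scalars, and uniformly on each
    [fd_sets l]; the limit is approximated by members of the space, hence by [fd_dense], and so
    stays in the space. *)
Lemma fs_complete : complete_lcs fs_lcs.
Proof.
split.
  apply/hausdorff_cseminorm => f pf0; apply: fspace_ext => x.
  have [l Sx] := fd_cover x; apply: normc_eq0; apply/le_anti.
  rewrite normc_ge0 andbT; have := fs_norm_eval (fs_of f) Sx.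
  by rewrite (pf0 _ (fs_cseminorm l)).
move=> F PF /tvs_cauchy_cseminorm cF.
have ucF l e : 0 < e -> exists2 V, F V & forall (f g : fs_lcs) x,
    V f -> V g -> S l x -> normc (fs_of f x - fs_of g x) <= e.
  move=> e0; have ei : 0 <= e^-1 by rewrite invr_ge0 ltW.
  have [V FV hV] := cF _ (cseminorm_scale ei (fs_cseminorm l)).
  exists V => // f g x Vf Vg Sx.
  have := hV f g Vf Vg; rewrite ltr_pdivrMl// mulr1 => h.
  by apply: le_trans (ltW h); rewrite -fspaceB; exact: fs_norm_eval.
have hz x : exists z : C, forall e, 0 < e ->
    F [set f : fs_lcs | normc (fs_of f x - z) <= e].
  have [l Sx] := fd_cover x.
  apply: (@complex_filter_complete R fs_lcs F PF (fun f => fs_of f x)) => e e0.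
  by have [V FV hV] := ucF l e e0; exists V => // f h Vf Vh; exact: hV.
have [g hg] := choice hz.
have ug l e : 0 < e ->
    F [set f | forall x, S l x -> normc (fs_of f x - g x) <= e].
  move=> e0; have [V FV hV] := ucF l e e0.
  apply: (filterS _ (FV)) => f Vf x Sx; apply/ler_addgt0Pr => r r0.
  have [h [/= hx Vh]] := filter_ex (filterI (hg x r r0) FV).
  have := hV f h x Vf Vh Sx.
  by have := normcD (fs_of f x - fs_of h x) (fs_of h x - g x); rewrite subrKA; lra.
have us (s : seq L) e : 0 < e ->
    F [set f | forall l x, List.In l s -> S l x -> normc (fs_of f x - g x) <= e].
  move=> e0; elim: s => [|l s IH]; first by apply: filterS filterT => f _ l x [].
  apply: filterS (filterI (ug l e e0) IH) => f [/= h1 h2] m x [<-|ms].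
    exact: h1.
  exact: h2.
have cg : fd_closure g.
  move=> s e e0; have e2 : 0 < e / 2 by rewrite divr_gt0.
  have [f fg] := filter_ex (us s _ e2).
  have [h Dh hf] := fspace_closure (fs_of f) s e2.
  exists h => // l x ls Sx; have := fg l x ls Sx; have := hf l x ls Sx.
  by have := normcD (h x - fs_of f x) (fs_of f x - g x); rewrite subrKA; lra.
pose g' : fs_lcs := FSpace (introT (asboolP _) cg).
exists g' => U /nbhs_cseminorm[p cp pU].
have [s [c [c0 pc]]] := fs_dominated cp.
have c1 : 0 < (c + 1)^-1 by rewrite invr_gt0 ltr_wpDl.
apply: filterS (us s _ c1) => f hf; apply: pU.
have := pc (f - g') _ (ltW c1) hf => /le_lt_trans; apply.
by rewrite ltr_pdivrMr ?ltr_wpDl// mul1r ltrDl.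
Qed.

Lemma fs_dense (f : fs_lcs) p e : cseminorm p -> 0 < e ->
  exists2 g : fs_lcs, D (fs_of g) & p (g - f) < e.
Proof.
move=> cp e0; have [s [c [c0 pc]]] := fs_dominated cp.
have c1 : 0 < e / (c + 1) by rewrite divr_gt0// ltr_wpDl.
have [g Dg gf] := fspace_closure (fs_of f) s c1.
pose g' : fs_lcs := FSpace (introT (asboolP _) (fd_dense_closure Dg)).
exists g' => //; have := pc (g' - f) _ (ltW c1) gf => /le_lt_trans; apply.
by rewrite mulrA ltr_pdivrMr ?ltr_wpDl// mulrC ltr_pM2l// ltrDl.
Qed.

End FunctionSpace.

(** * Completed quotients and projective tensor products *)

Section Extension.
Variable R : realType.
Local Notation C := R[i].

(** Lets an approximation argument end with any fixed multiple of [e], without tuning the errors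
    beforehand. *)
Lemma le0_small (a k : R) : (forall e : R, 0 < e -> a <= k * e) -> a <= 0.
Proof.
move=> h; rewrite leNgt; apply/negP => a0.
have k1 : 0 < `|k| + 1 by rewrite ltr_wpDl.
have e0 : 0 < a / (2 * (`|k| + 1)) by rewrite divr_gt0// mulr_gt0.
have := h _ e0; have /ler_wpM2r := ler_norm k => /(_ _ (ltW e0)).
have := mulrVK (unitf_gt0 (mulr_gt0 (ltr0Sn R 1) k1)) a.
by rewrite [a / _]mulrC; nra.
Qed.

Section Hausdorff.
Variable E : tvsType C.
Hypothesis hE : hausdorff_space E.

Lemma cseminorm_eq0 (x : E) : (forall p, cseminorm p -> p x <= 0) -> x = 0.
Proof.
move=> h; apply: (hausdorff_cseminorm E).1 => // p cp.
by apply/le_anti; rewrite h//= (sn_ge0 cp.1).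
Qed.

Lemma cseminorm_eq (x y : E) : (forall p, cseminorm p -> p (x - y) <= 0) -> x = y.
Proof. by move=> h; apply/eqP; rewrite -subr_eq0; apply/eqP/cseminorm_eq0. Qed.

End Hausdorff.

Lemma continuous_linear_dense_eq (E F : tvsType C) (f g : E -> F) (S : set E) :
  hausdorff_space F -> continuous_linear f -> continuous_linear g ->
  (forall x, closure S x) -> (forall x, S x -> f x = g x) -> f = g.
Proof.
move=> hF cf cg dS fg; apply/funext => x; apply: cseminorm_eq => // q cq.
apply: (@le0_small _ 1) => e e0; rewrite mul1r.
have := cseminormD (cseminorm_comp cf cq) (cseminorm_comp cg cq).
move=> cp; have [y Sy /ltW] := closure_cseminorm_lt (dS x) cp e0.
apply: le_trans => /=; rewrite (linB cf.1) (linB cg.1) (fg y Sy).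
rewrite (snBC cq.1 _ (f x)); exact: sn_tri cq.1 _ _ _.
Qed.

(** Extension by continuity of a densely defined map given by its graph. The bound makes the graph
    single-valued, so a map may be prescribed on generators or representatives without a separate
    check that it is well defined. *)
Lemma extend_relation (F G : tvsType C) (r : set (F * G)) :
  complete_lcs G -> linear_subspace r ->
  (forall q, cseminorm q -> exists2 p, cseminorm p &
    forall x z, r (x, z) -> q z <= p x) ->
  (forall x : F, closure [set y | exists z, r (y, z)] x) ->
  exists2 g : F -> G, continuous_linear g & forall x z, r (x, z) -> g x = z.
Proof.
move=> [hG cG] sr rc rd.
have rB x y z w : r (x, z) -> r (y, w) -> r (x - y, z - w).
  by move=> h1 h2; exact: (lsubspaceB sr h1 h2).
(* The value at [x] is the limit of the [z] related to points near [x]. It is recorded by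
   simultaneous approximation of point and value, the only form in which it is used below. *)
have gex (x : F) : exists z0 : G, forall p q e, cseminorm p -> cseminorm q ->
    0 < e -> exists y z, [/\ r (y, z), p (y - x) < e & q (z - z0) < e].
  pose base (p : F -> R) := [set z | exists2 y, r (y, z) & p (y - x) < 1].
  pose Fx := filter_from [set p : F -> R | cseminorm p] base.
  have FF : ProperFilter Fx.
    apply: filter_from_proper.
      apply: filter_from_filter; first by exists (fun=> 0); exact: cseminorm0.
      move=> p q cp cq; exists (fun x => p x + q x); first exact: cseminormD.
      move=> z [y ryz h]; have := sn_ge0 cp.1 (y - x).
      by have := sn_ge0 cq.1 (y - x); split; exists y => //; lra.
    move=> p cp; have [y [z ryz] h] := closure_cseminorm_lt (rd x) cp ltr01.
    by exists z, y.
  have [|z zF] := cG Fx FF.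
    apply/tvs_cauchy_cseminorm => q cq; have [p cp pq] := rc q cq.
    exists (base (fun x => 2 * p x)).
      by exists (fun x => 2 * p x) => //; exact: cseminorm_scale.
    move=> z1 z2 [y1 r1 h1] [y2 r2 h2].
    apply: le_lt_trans (pq _ _ (rB _ _ _ _ r1 r2)) _.
    apply: le_lt_trans (sn_tri cp.1 x _ _) _.
    by rewrite (snBC cp.1 x y2); lra.
  exists z => p q e cp cq e0.
  have [p' cp' sub] := zF _ (cseminorm_nbhs_at z cq e0).
  have ei : 0 <= e^-1 by rewrite invr_ge0 ltW.
  have cpp := cseminormD cp' (cseminorm_scale ei cp).
  have [y [w ryw] h] := closure_cseminorm_lt (rd x) cpp ltr01.
  have p0 := sn_ge0 cp.1 (y - x); have p'0 := sn_ge0 cp'.1 (y - x).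
  have ep0 : 0 <= e^-1 * p (y - x) by rewrite mulr_ge0.
  exists y, w; split=> //.
    have : e^-1 * p (y - x) < 1 by lra.
    by rewrite ltr_pdivrMl// mulr1.
  by apply: sub; exists y => //; lra.
have [g gP] := choice gex; exists g.
  apply: linear_continuous_cseminorm.
    move=> a x y; apply: cseminorm_eq => // q cq; have [p cp pq] := rc q cq.
    apply: (@le0_small _ (2 * normc a + 4)) => e e0.
    change (q (g (a *: x + y) - (a *: g x + g y)) <= (2 * normc a + 4) * e).
    have [x1 [z1 [r1 p1 q1]]] := gP x p q e cp cq e0.
    have [x2 [z2 [r2 p2 q2]]] := gP y p q e cp cq e0.
    have [x3 [z3 [r3 p3 q3]]] := gP (a *: x + y) p q e cp cq e0.
    have r4 : r (a *: x1 + x2, a *: z1 + z2) := sr.2 a _ _ r1 r2.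
    have h1 : q (a *: z1 + z2 - (a *: g x + g y)) <= (normc a + 1) * e.
      rewrite opprD addrACA -scalerBr; apply: le_trans (sn_add cq.1 _ _) _.
      by rewrite (snZ cq.1) mulrDl mul1r lerD ?(ltW q2)// ler_wpM2l ?normc_ge0 ?ltW.
    have h2 : p (a *: x + y - (a *: x1 + x2)) <= (normc a + 1) * e.
      rewrite opprD addrACA -scalerBr; apply: le_trans (sn_add cp.1 _ _) _.
      rewrite (snZ cp.1) (snBC cp.1 x) (snBC cp.1 y) mulrDl mul1r.
      by rewrite lerD ?(ltW p2)// ler_wpM2l ?normc_ge0 ?ltW.
    have t1 : q (z3 - (a *: z1 + z2)) <= p (x3 - (a *: x1 + x2)).
      exact: pq _ _ (rB _ _ _ _ r3 r4).
    have t2 := sn_tri cp.1 (a *: x + y) x3 (a *: x1 + x2).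
    have t3 := sn_tri cq.1 z3 (g (a *: x + y)) (a *: g x + g y).
    have t4 := sn_tri cq.1 (a *: z1 + z2) z3 (a *: g x + g y).
    rewrite (snBC cq.1 (g (a *: x + y)) z3) in t3.
    apply: le_trans t3 _.
    by have := lerD (ltW q3) (le_trans t4 (lerD (le_trans t1 t2) h1)); lra.
  move=> q cq; have [p cp pq] := rc q cq; exists p => // x.
  apply/ler_addgt0Pr => e e0; have e2 : 0 < e / 2 by rewrite divr_gt0.
  have [y [z [ryz h1 h2]]] := gP x p q _ cp cq e2.
  have := pq _ _ ryz; have := sn_le_sub cq.1 (g x) z.
  by have := sn_le_sub cp.1 y x; rewrite (snBC cq.1 (g x)); lra.
move=> x z rxz; apply: cseminorm_eq => // q cq; have [p cp pq] := rc q cq.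
apply: (@le0_small _ 2) => e e0.
have [y [w [ryw h1 h2]]] := gP x p q e cp cq e0.
have := pq _ _ (rB _ _ _ _ ryw rxz); have := sn_tri cq.1 w (g x) z.
by rewrite (snBC cq.1 (g x) w); lra.
Qed.

Lemma cseminorm_sum (E : tvsType C) (s : seq {p : E -> R | cseminorm p}) :
  cseminorm (fun x => \sum_(p <- s) sval p x).
Proof.
elim: s => [|p s IH].
  by under eq_fun do rewrite big_nil; exact: cseminorm0.
by under eq_fun do rewrite big_cons; exact: cseminormD (svalP p) IH.
Qed.

Lemma sum_cseminorm_ge (E : tvsType C) (s : seq {p : E -> R | cseminorm p}) p x :
  List.In p s -> sval p x <= \sum_(p <- s) sval p x.
Proof.
elim: s => // q s IH [->|ps]; rewrite big_cons.
  by rewrite lerDl (sn_ge0 (cseminorm_sum s).1).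
by apply: le_trans (IH ps) _; rewrite lerDr (sn_ge0 (svalP q).1).
Qed.

End Extension.

(** * Completed quotients as functions on the dual of the quotient *)

Section CompletedQuotient.
Variables (R : realType) (E : tvsType R[i]) (N : set E).
Local Notation C := R[i].
Hypothesis sN : linear_subspace N.

Definition cq_dominated (p : E -> R) (f : E -> C^o) : Prop :=
  [/\ linear f, forall n, N n -> f n = 0 & forall x, normc (f x) <= p x].

(** The continuous functionals on E / N; uniform convergence on the polars [cq_sets p] restores the
    quotient topology. *)
Definition cq_point : Type :=
  {f : E -> C^o | exists2 p, cseminorm p & cq_dominated p f}.

Definition cq_sets (p : {p : E -> R | cseminorm p}) : set cq_point :=
  [set f | cq_dominated (sval p) (sval f)].

Definition cq_eval (x : E) (f : cq_point) : C^o := sval f x.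

Definition cq_dense : set (cq_point -> C^o) := range cq_eval.

Let cq_cover (f : cq_point) : exists p, cq_sets p f.
Proof. by case: f => f [p cp pf]; exists (exist _ p cp). Qed.

Lemma cq_eval_linear : linear cq_eval.
Proof.
move=> a x y; apply/funext => f; rewrite /cq_eval.
by have [p _ [lf _ _]] := svalP f; exact: lf.
Qed.

Let cq_subspace : linear_subspace cq_dense.
Proof.
split; first by exists 0 => //; rewrite (lin0 cq_eval_linear).
move=> a _ _ [x _ <-] [y _ <-]; exists (a *: x + y) => //.
exact: cq_eval_linear.
Qed.

Let cq_bounded f p : cq_dense f ->
  exists b, forall x, cq_sets p x -> normc (f x) <= b.
Proof. by move=> [x _ <-]; exists (sval p x) => f0 [_ _ h]; exact: h. Qed.

Definition cq_data : fdata R :=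
  FData cq_cover cq_subspace cq_bounded.

Definition cq_map (x : E) : fs_lcs cq_data :=
  FSpace (introT (asboolP _)
    (@fd_dense_closure R cq_data (cq_eval x) (imageT cq_eval x))).

(** The substance is in the neighbourhood condition: if [x] has [p]-distance at least 1 from [N],
    Hahn-Banach yields a functional dominated by [p], zero on [N] and equal to 1 at [x], so the
    image of [x] lies outside the corresponding open unit ball. *)
Lemma completed_quotient_exists : completed_quotient N cq_map.
Proof.
split.
- exact: fs_complete.
- apply: linear_continuous_cseminorm.
    move=> a x y; apply: fspace_ext => f.
    by have /(congr1 (fun g => g f)) := cq_eval_linear a x y.
  move=> q /fs_dominated[s [c [c0 qc]]].
  exists (fun x => c * \sum_(p <- s) sval p x).
    exact: cseminorm_scale (cseminorm_sum s).
  move=> x; apply: qc; first exact: (sn_ge0 (cseminorm_sum s).1).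
  move=> p f ps [_ _ pf]; apply: le_trans (pf x) _.
  exact: (sum_cseminorm_ge x ps).
- move=> x Nx; apply: fspace_ext => f.
  by have [p _ [_ fN _]] := svalP f; exact: fN.
- apply/dense_closure => f; apply/closure_cseminorm => p cp.
  have [g [x _ xg] gf] := fs_dense f cp ltr01.
  exists (cq_map x); first by exists x.
  have -> : cq_map x = g by apply: fspace_ext => h; rewrite -xg.
  exact: gf.
- move=> U /nbhs0_cseminorm[p cp pU].
  pose P := @fs_norm R cq_data (exist _ p cp).
  exists [set f | P f < 1]; first exact: (cseminorm_nbhs (fs_cseminorm _) ltr01).
  move=> x Px /=; apply: contrapT => h.
  have [|f [lf fp fN fx]] := hahn_banach_quotient (x0 := x) cp.1 sN.
    move=> n Nn; rewrite leNgt; apply/negP => /pU Uxn; apply: h.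
    by exists (x - n) => //; rewrite subKr.
  have df : cq_dominated p f by [].
  pose F : cq_point := exist _ f (ex_intro2 _ _ p cp df).
  have SF : @fd_sets R cq_data (exist _ p cp) F by [].
  have := @fs_norm_eval R cq_data (exist _ p cp) (cq_map x) F SF.
  have -> : fs_val (cq_map x) F = 1 by [].
  rewrite normc1 => P1; move: Px; rewrite /P /=.
  by rewrite ltNge P1.
Qed.

End CompletedQuotient.

Section Bilinear.
Variables (R : realType) (E F G : tvsType R[i]) (b : E -> F -> G).
Local Notation C := R[i].

Lemma bilinear_l (h : bilinear_for *:%R *:%R b) y : linear (b^~ y).
Proof. exact: h.1. Qed.

Lemma bilinear_r (h : bilinear_for *:%R *:%R b) x : linear (b x).
Proof. exact: h.2. Qed.

Lemma continuous_bilinear_bound (r : G -> R) : continuous_bilinear b ->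
  cseminorm r -> exists p q, [/\ cseminorm p, cseminorm q &
    forall x y, r (b x y) <= p x * q y].
Proof.
move=> [bb bc] cr.
have [[A B] [/= nA nB] AB] := bc (0, 0) [set z | r z < 1]
  (ltac:(by rewrite /= (lin0 (bilinear_r bb 0)); exact: cr.2)).
have [p cp pA] := nbhs0_cseminorm nA; have [q cq qB] := nbhs0_cseminorm nB.
exists p, q; split=> // x y.
have hs s t : p x < s -> q y < t -> r (b x y) <= s * t.
  move=> ps qt; have s0 : 0 < s := le_lt_trans (sn_ge0 cp.1 x) ps.
  have t0 : 0 < t := le_lt_trans (sn_ge0 cq.1 y) qt.
  have := AB (s^-1%:C *: x, t^-1%:C *: y).
  rewrite /= (linZ (bilinear_l bb _)) (linZ (bilinear_r bb _)).
  have s0' : 0 <= s^-1 by rewrite invr_ge0 ltW.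
  have t0' : 0 <= t^-1 by rewrite invr_ge0 ltW.
  rewrite !(snZr cr.1)// ltr_pdivrMl// ltr_pdivrMl// mulr1.
  move=> h; rewrite mulrC; apply/ltW/h; split.
    by apply: pA; rewrite (snZr cp.1)// ltr_pdivrMl// mulr1.
  by apply: qB; rewrite (snZr cq.1)// ltr_pdivrMl// mulr1.
have p0 := sn_ge0 cp.1 x; have q0 := sn_ge0 cq.1 y.
rewrite -subr_le0; apply: (@le0_small _ _ (p x + q y + 1)) => e e0.
(* For [e <= 1] the product of the enlarged factors exceeds [p x * q y] by at most
   [(p x + q y + 1) * e]; a larger [e] follows from the case of 1. *)
have [e1|e1] := leP e 1.
  have := hs (p x + e) (q y + e); rewrite !ltrDl => /(_ e0 e0).
  by nra.
have := hs (p x + 1) (q y + 1); rewrite !ltrDl => /(_ ltr01 ltr01).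
by nra.
Qed.

Lemma bilinear_continuous : bilinear_for *:%R *:%R b ->
  (forall r, cseminorm r -> exists p q, [/\ cseminorm p, cseminorm q &
    forall x y, r (b x y) <= p x * q y]) -> continuous_bilinear b.
Proof.
move=> bb hb; split=> // -[x0 y0] U /= /nbhs_cseminorm[r cr rU].
have [p [q [cp cq rpq]]] := hb r cr.
have p0 := sn_ge0 cp.1 x0; have q0 := sn_ge0 cq.1 y0.
pose e : R := (2 + p x0 + q y0)^-1.
have k0 : 0 < 2 + p x0 + q y0 by lra.
have e0 : 0 < e by rewrite invr_gt0.
have ek : e * (2 + p x0 + q y0) = 1 by rewrite mulVf// gt_eqF.
exists ([set x | p (x - x0) < e], [set y | q (y - y0) < e]).
  by split; exact: cseminorm_nbhs_at.
move=> [x y] [/= px qy]; apply: rU.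
have -> : b x y - b x0 y0 =
    b (x - x0) (y - y0) + (b (x - x0) y0 + b x0 (y - y0)).
  rewrite (linB (bilinear_r bb x0)) (linB (bilinear_r bb (x - x0))).
  rewrite (linB (bilinear_l bb y)) (linB (bilinear_l bb y0)).
  by rewrite addrA subrK addrA subrK.
apply: le_lt_trans (sn_add cr.1 _ _) _.
have := sn_add cr.1 (b (x - x0) y0) (b x0 (y - y0)).
have := rpq (x - x0) (y - y0); have := rpq (x - x0) y0.
have := rpq x0 (y - y0).
have px0 := sn_ge0 cp.1 (x - x0); have qy0 := sn_ge0 cq.1 (y - y0).
have h1 : p (x - x0) * q (y - y0) <= e * e.
  by apply: ler_pM => //; exact: ltW.
have h2 : p (x - x0) * q y0 <= e * q y0 by rewrite ler_wpM2r// ltW.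
have h3 : p x0 * q (y - y0) <= p x0 * e by rewrite ler_wpM2l// ltW.
have e1 : e < 1 by nra.
have h4 : e * e < e * 1 by rewrite ltr_pM2l.
nra.
Qed.

End Bilinear.

Lemma smallest_lsubspace (R : realType) (V : lmodType R[i]) (G : set V) :
  linear_subspace (smallest (@linear_subspace R[i] V) G).
Proof.
split=> [S [sS _]|a x y Sx Sy S hS]; first exact: sS.1.
by apply: hS.1.2; [exact: Sx|exact: Sy].
Qed.

(** * Projective tensor products as functions on bilinear forms *)

Section ProjectiveTensor.
Variables (R : realType) (E F : tvsType R[i]).
Local Notation C := R[i].

Definition pt_index : Type :=
  ({p : E -> R | cseminorm p} * {q : F -> R | cseminorm q})%type.

Definition pt_dominated (i : pt_index) (b : E -> F -> C^o) : Prop :=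
  bilinear_for *:%R *:%R b /\
  forall x y, normc (b x y) <= sval i.1 x * sval i.2 y.

(** The continuous bilinear forms; an elementary tensor acts on them by evaluation. Uniform
    convergence on the forms bounded by [p x * q y] gives the projective seminorm of [p] and [q]. *)
Definition pt_point : Type :=
  {b : E -> F -> C^o | exists i, pt_dominated i b}.

Definition pt_sets (i : pt_index) : set pt_point :=
  [set b | pt_dominated i (sval b)].

Definition pt_eval (x : E) (y : F) (b : pt_point) : C^o := sval b x y.

Definition pt_dense : set (pt_point -> C^o) :=
  smallest (@linear_subspace C (pt_point -> C^o))
    [set f | exists x y, f = pt_eval x y].

Let pt_cover (b : pt_point) : exists i, pt_sets i b.
Proof. by case: b => b [i ib]; exists i. Qed.

Let pt_bounded f i : pt_dense f ->
  exists c, forall b, pt_sets i b -> normc (f b) <= c.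
Proof.
pose S : set (pt_point -> C^o) :=
  [set f | exists c, forall b, pt_sets i b -> normc (f b) <= c].
move=> /(_ S); apply; split; last first.
  by move=> _ [x [y ->]]; exists (sval i.1 x * sval i.2 y) => b [_ h]; exact: h.
split; first by exists 0 => b _; rewrite normc0.
move=> a f1 f2 [c1 h1] [c2 h2]; exists (normc a * c1 + c2) => b ib.
apply: le_trans (normcD _ _) _; rewrite normcM lerD ?h2//.
by rewrite ler_wpM2l ?normc_ge0 ?h1.
Qed.

Definition pt_data : fdata R :=
  FData pt_cover (smallest_lsubspace _) pt_bounded.

Lemma pt_eval_closure x y : fd_closure (d := pt_data) (pt_eval x y).
Proof. by apply: fd_dense_closure => S [_]; apply; exists x, y. Qed.

Definition pt_pure (x : E) (y : F) : fs_lcs pt_data :=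
  FSpace (introT (asboolP _) (pt_eval_closure x y)).

Lemma pt_pure_bilinear : bilinear_for *:%R *:%R pt_pure.
Proof.
split=> [y a x x'|x a y y']; apply: fspace_ext => b.
  by have [i [bb _]] := svalP b; exact: bb.1.
by have [i [bb _]] := svalP b; exact: bb.2.
Qed.

Lemma pt_pure_continuous : continuous_bilinear pt_pure.
Proof.
apply: bilinear_continuous; first exact: pt_pure_bilinear.
move=> r /fs_dominated[s [c [c0 rc]]].
exists (fun x => c * \sum_(p <- map fst s) sval p x).
exists (fun y => \sum_(q <- map snd s) sval q y); split.
- exact: cseminorm_scale (cseminorm_sum _).
- exact: cseminorm_sum.
move=> x y; rewrite -mulrA.
have p0 := sn_ge0 (cseminorm_sum (map fst s)).1 x.
have q0 := sn_ge0 (cseminorm_sum (map snd s)).1 y.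
apply: rc; first exact: mulr_ge0.
move=> i b si [_ ib]; apply: le_trans (ib x y) _.
apply: ler_pM; rewrite ?(sn_ge0 (svalP i.1).1) ?(sn_ge0 (svalP i.2).1)//.
  by apply: sum_cseminorm_ge; exact: List.in_map.
by apply: sum_cseminorm_ge; exact: List.in_map.
Qed.

Section Universal.
Variables (G : tvsType C) (b : E -> F -> G).
Hypotheses (cG : complete_lcs G) (cb : continuous_bilinear b).

(** Graph of the map that [b] induces on the algebraic tensor product, to be fed to
    [extend_relation]. *)
Definition pt_relation : set (fs_lcs pt_data * G) :=
  smallest (@linear_subspace C _)
    [set z | exists x y, z = (pt_pure x y, b x y)].

(** Take a functional [h] below [r] that attains [r z]. Composed with [b] it is a bilinear form
    dominated by [p] and [q], hence a point at which [f] takes the value [h z]. *)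
Lemma pt_relation_bound (r : G -> R) : cseminorm r ->
  exists2 p : fs_lcs pt_data -> R, cseminorm p & forall f z, pt_relation (f, z) -> r z <= p f.
Proof.
move=> cr; have [p [q [cp cq bpq]]] := continuous_bilinear_bound cb cr.
pose i : pt_index := (exist _ p cp, exist _ q cq).
exists (@fs_norm R pt_data i); first exact: fs_cseminorm.
move=> f z fz; have [h [lh hr hz]] := hahn_banach z cr.1.
have di : pt_dominated i (fun x y => h (b x y)).
  split; last by move=> x y; apply: le_trans (hr _) (bpq x y).
  split=> [y a x x'|x a y y'].
    by rewrite (cb.1.1 y a x x') lh.
  by rewrite (cb.1.2 x a y y') lh.
pose B : pt_point := exist _ _ (ex_intro _ i di).
suff hB : fs_of f B = h z.
  have := @fs_norm_eval R pt_data i f B di; rewrite -[fs_val _ _]/(fs_of f B).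
  by rewrite hB hz normc_real ger0_norm ?(sn_ge0 cr.1).
pose S := [set u : fs_lcs pt_data * G | fs_of u.1 B = h u.2].
apply: (fz S); split; last by move=> _ [x [y ->]].
split; first by rewrite /S /= (lin0 lh).
move=> a [u1 u2] [v1 v2] /= Su Sv; rewrite /S /= lh -Su -Sv.
by [].
Qed.

Lemma pt_dense_pure (f : fs_lcs pt_data) (P : set (fs_lcs pt_data)) :
  linear_subspace P -> (forall x y, P (pt_pure x y)) ->
  pt_dense (fs_of f) -> P f.
Proof.
move=> sP Ppure Df.
pose S : set (pt_point -> C^o) := [set g | exists2 f, P f & fs_val (fs_of f) = g].
have [g Pg gf] : S (fs_of f).
  apply: Df; split; last by move=> _ [x [y ->]]; exists (pt_pure x y).
  split; first by exists 0; [exact: sP.1|].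
  move=> a _ _ [g Pg <-] [h Ph <-]; exists (a *: g + h) => //.
  exact: sP.2.
by have <- : g = f by exact: val_inj.
Qed.

Lemma pt_universal : exists! f : fs_lcs pt_data -> G,
  continuous_linear f /\ forall x y, f (pt_pure x y) = b x y.
Proof.
have [|||f cf fr] := extend_relation (r := pt_relation) cG.
- exact: smallest_lsubspace.
- by move=> q cq; have [p cp pr] := pt_relation_bound cq; exists p.
- move=> f; apply/closure_cseminorm => p cp.
  have [g Dg gf] := fs_dense f cp ltr01; exists g => //.
  pose dom := [set y : fs_lcs pt_data | exists z, pt_relation (y, z)].
  apply: (pt_dense_pure (P := dom)) => //.
    split; first by exists 0 => S [sS _]; exact: sS.1.
    move=> a x y [z xz] [w yw]; exists (a *: z + w).
    exact: (smallest_lsubspace _).2 a (x, z) (y, w) xz yw.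
  by move=> x y; exists (b x y) => S [_]; apply; exists x, y.
- exists f; split.
    by split=> // x y; apply: fr => S [_]; apply; exists x, y.
  move=> g [cg gb].
  pose dense_part := [set h : fs_lcs pt_data | pt_dense (fs_of h)].
  apply: (continuous_linear_dense_eq (S := dense_part)) => //.
  + exact: cG.1.
  + move=> h; apply/closure_cseminorm => p cp.
    by have [k Dk kh] := fs_dense h cp ltr01; exists k.
  + move=> h Dh; apply: (pt_dense_pure (P := [set h : fs_lcs pt_data | f h = g h])) Dh.
      split; first by rewrite /= (lin0 cf.1) (lin0 cg.1).
      by move=> a x y /= fx fy; rewrite cf.1 cg.1 fx fy.
    by move=> x y /=; rewrite gb; apply: fr => S [_]; apply; exists x, y.
Qed.

End Universal.

Lemma projective_tensor_exists : projective_tensor pt_pure.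
Proof.
split; [exact: fs_complete|exact: pt_pure_continuous|].
by move=> G b; exact: pt_universal.
Qed.

End ProjectiveTensor.

Section Functoriality.
Variable R : realType.
Local Notation C := R[i].

(** The neighbourhood condition at every scale: [r] controls the [p]-distance to [N]. *)
Lemma completed_quotient_bound (E : tvsType C) (N : set E) (F : tvsType C)
    (q : E -> F) (p : E -> R) : linear_subspace N -> completed_quotient N q ->
  cseminorm p -> exists2 r, cseminorm r &
    forall x e, 0 < e -> r (q x) < e -> exists2 n, N n & p (x - n) < e.
Proof.
move=> sN [_ lq _ _ nq] cp.
have [V /nbhs0_cseminorm[r cr rV] VU] := nq _ cp.2.
exists r => // x e e0 rx; have ei : 0 <= e^-1 by rewrite invr_ge0 ltW.
have /VU[u pu] : V (q (e^-1%:C *: x)).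
  by apply: rV; rewrite (linZ lq.1) (snZr cr.1)// ltr_pdivrMl// mulr1.
move=> Nxu; exists (e%:C *: (e^-1%:C *: x - u)); first exact: lsubspaceZ.
rewrite scalerBr scalerA -rmorphM mulfV ?gt_eqF// scale1r subKr.
by rewrite (snZr cp.1) ?(ltW e0)// -ltr_pdivlMl// mulVf ?gt_eqF.
Qed.

Lemma completed_quotient_extend (E : tvsType C) (N : set E) (F G : tvsType C)
    (q : E -> F) (f : E -> G) : linear_subspace N -> completed_quotient N q ->
  complete_lcs G -> continuous_linear f -> (forall n, N n -> f n = 0) ->
  exists2 g : F -> G, continuous_linear g & forall x, g (q x) = f x.
Proof.
move=> sN cq cG cf fN; have [_ lq _ dq _] := cq.
have [|||g cg gr] :=
    extend_relation (r := [set z | exists x, z = (q x, f x)]) cG.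
- split; first by exists 0; rewrite (lin0 lq.1) (lin0 cf.1).
  move=> a _ _ [x ->] [y ->]; exists (a *: x + y).
  by rewrite lq.1 cf.1.
- move=> p cp.
  have [r cr rq] := completed_quotient_bound sN cq (cseminorm_comp cf cp).
  exists r => // _ _ [x [-> ->]]; apply/ler_addgt0Pr => e e0.
  have re : r (q x) < r (q x) + e by rewrite ltrDl.
  have [n Nn] := rq x _ (le_lt_trans (sn_ge0 cr.1 _) re) re.
  by rewrite /= (linB cf.1) (fN n Nn) subr0 => /ltW.
- move=> y; have [dq' _] := dense_closure (range q).
  by have := dq' dq y; apply: closure_subset => _ [x _ <-]; exists (f x), x.
- by exists g => // x; apply: gr; exists x.
Qed.

(** Density follows from uniqueness in the universal property: the map to the completed quotient by
    [S] and the zero map agree on elementary tensors, hence everywhere, so every [z] is a limit of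
    elements of [S]. *)
Lemma projective_tensor_dense (E F T : tvsType C) (t : E -> F -> T)
    (S : set T) : projective_tensor t -> linear_subspace S ->
  (forall x y, S (t x y)) -> forall z, closure S z.
Proof.
move=> [cT bt ut] sS St z.
have cq := completed_quotient_exists sS.
have [_ lq qS _ _] := cq.
have cF : complete_lcs (fs_lcs (cq_data S)) := completed_quotient_complete cq.
have [f [_ fu]] := ut _ (fun x y => cq_map S (t x y)) cF (ltac:(
  split=> [|[x y]]; [split=> [y a x x'|x a y y']|];
  [by rewrite (bt.1.1 y a x x') lq.1|by rewrite (bt.1.2 x a y y') lq.1|
   by apply: (continuous_comp (bt.2 (x, y))); exact: lq.2])).
have e1 := fu _ (conj lq (fun x y => erefl)).
have e2 : f = fun=> 0.
  apply: fu; split; last by move=> x y; rewrite qS.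
  split; first by move=> a x y; rewrite scaler0 addr0.
  by move=> x; exact: cst_continuous.
apply/closure_cseminorm => p cp.
have [r cr rq] := completed_quotient_bound sS cq cp.
have qz0 : cq_map S z = 0 by rewrite -e1 e2.
have [|n Sn pn] := rq z 1 ltr01; first by rewrite qz0 (sn0 cr.1).
by exists n => //; rewrite (snBC cp.1).
Qed.

End Functoriality.

Section BilinearExtension.
Variable R : realType.
Local Notation C := R[i].

Lemma continuous_linear_comp (E F G : tvsType C) (g : F -> G) (f : E -> F) :
  continuous_linear g -> continuous_linear f -> continuous_linear (g \o f).
Proof.
move=> [lg cg] [lf cf]; split; first by move=> a x y /=; rewrite lf lg.
by move=> x; apply: continuous_comp; [exact: cf|exact: cg].
Qed.

Lemma continuous_linear_combine (E F : tvsType C) (f g : E -> F) a :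
  continuous_linear f -> continuous_linear g ->
  continuous_linear (fun x => a *: f x + g x).
Proof.
move=> cf cg; apply: linear_continuous_cseminorm.
  move=> c x y; rewrite cf.1 cg.1 !scalerDr !scalerA [a * c]mulrC.
  by rewrite addrACA.
move=> q cq; exists (fun x => normc a * q (f x) + q (g x)).
  apply: cseminormD; last exact: cseminorm_comp cg cq.
  by apply: cseminorm_scale; [exact: normc_ge0|exact: cseminorm_comp cf cq].
by move=> x; apply: le_trans (sn_add cq.1 _ _) _; rewrite (snZ cq.1).
Qed.

Lemma continuous_bilinear_l (E F G : tvsType C) (b : E -> F -> G) y :
  continuous_bilinear b -> continuous_linear (b^~ y).
Proof.
move=> cb; apply: linear_continuous_cseminorm; first exact: bilinear_l cb.1 y.
move=> r cr; have [p [q [cp cq h]]] := continuous_bilinear_bound cb cr.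
exists (fun x => q y * p x); last by move=> x; rewrite mulrC.
by apply: cseminorm_scale => //; exact: sn_ge0 cq.1 _.
Qed.

Lemma continuous_bilinear_r (E F G : tvsType C) (b : E -> F -> G) x :
  continuous_bilinear b -> continuous_linear (b x).
Proof.
move=> cb; apply: linear_continuous_cseminorm; first exact: bilinear_r cb.1 x.
move=> r cr; have [p [q [cp cq h]]] := continuous_bilinear_bound cb cr.
exists (fun y => p x * q y) => //.
by apply: cseminorm_scale => //; exact: sn_ge0 cp.1 _.
Qed.

Lemma closure_lsubspace (E : tvsType C) (S : set E) :
  linear_subspace S -> linear_subspace (closure S).
Proof.
move=> sS; split; first by apply: subset_closure; exact: sS.1.
move=> a x y Sx Sy; apply/closure_cseminorm => p cp.
have na := normc_ge0 a; have k0 : 0 < (normc a + 1)^-1 by rewrite invr_gt0; lra.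
have kk : (normc a + 1) * (normc a + 1)^-1 = 1 by rewrite mulfV// gt_eqF; lra.
have [x' Sx' xx] := closure_cseminorm_lt Sx cp k0.
have [y' Sy' yy] := closure_cseminorm_lt Sy cp k0.
exists (a *: x' + y'); first exact: sS.2.
rewrite opprD addrACA -scalerBr; apply: le_lt_trans (sn_add cp.1 _ _) _.
have := ler_wpM2l na (ltW xx); rewrite (snZ cp.1); lra.
Qed.

Lemma closure_closure (E : topologicalType) (S : set E) :
  closure (closure S) `<=` closure S.
Proof. by rewrite -(closure_id _).1//; exact: closed_closure. Qed.

Lemma continuous_linear_closure (E F : tvsType C) (f : E -> F) (S : set E)
    (S' : set F) x : continuous_linear f -> (forall y, S y -> S' (f y)) ->
  closure S x -> closure S' (f x).
Proof.
move=> cf SS' Sx; apply/closure_cseminorm => q cq.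
have [y Sy yx] := closure_cseminorm_lt Sx (cseminorm_comp cf cq) ltr01.
by exists (f y); [exact: SS'|rewrite -(linB cf.1)].
Qed.

Lemma continuous_linear_closed_eq0 (E F : tvsType C) (f : E -> F) (S : set E) x :
  hausdorff_space F -> continuous_linear f -> (forall y, S y -> f y = 0) ->
  closure S x -> f x = 0.
Proof.
move=> hF cf S0 Sx; apply: cseminorm_eq0 => // q cq.
apply: (@le0_small _ _ 1) => e e0; rewrite mul1r.
have [y Sy yx] := closure_cseminorm_lt Sx (cseminorm_comp cf cq) e0.
by move: yx; rewrite /= (linB cf.1) (S0 y Sy) sub0r (snN cq.1) => /ltW.
Qed.

(** The extension is made for each [y] separately; linearity in [y] is checked on the dense range of
    [q], and joint continuity comes from a bound for [b0] that passes to the quotient. *)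
Lemma bilinear_extend (Y E X Z : tvsType C) (N : set E) (q : E -> X)
    (b0 : Y -> E -> Z) : linear_subspace N -> completed_quotient N q ->
  complete_lcs Z -> continuous_bilinear b0 ->
  (forall y n, N n -> b0 y n = 0) ->
  exists2 b : Y -> X -> Z, continuous_bilinear b &
    forall y u, b y (q u) = b0 y u.
Proof.
move=> sN cq cZ cb0 b0N; have [_ lq _ dq _] := cq.
have gex (y : Y) : exists g : X -> Z,
    continuous_linear g /\ forall u, g (q u) = b0 y u.
  have [||g cg gq] := completed_quotient_extend sN cq (f := b0 y) cZ.
  - exact: continuous_bilinear_r.
  - exact: b0N.
  - by exists g.
have [b hb] := choice gex; exists b; last by move=> y u; exact: (hb y).2.
have rq x : closure (range q) x by apply: (dense_closure _).1.
apply: bilinear_continuous.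
  split=> [x a y y'|y]; last exact: (hb y).1.1.
  suff -> : b (a *: y + y') = fun x => a *: b y x + b y' x by [].
  apply: (continuous_linear_dense_eq (S := range q)) => //.
  - exact: cZ.1.
  - exact: (hb _).1.
  - by apply: continuous_linear_combine; exact: (hb _).1.
  - by move=> _ [u _ <-]; rewrite !(hb _).2 (cb0.1.1 u a y y').
move=> r cr; have [p [p' [cp cp' rpp]]] := continuous_bilinear_bound cb0 cr.
have [s cs sq] := completed_quotient_bound sN cq cp'.
exists p, s; split=> // y x; have py := sn_ge0 cp.1 y.
rewrite -subr_le0; apply: (@le0_small _ _ (2 * p y + 1)) => e e0.
have c2 := cseminormD (cseminorm_comp (hb y).1 cr) cs.
have [_ [u _ <-] ux] := closure_cseminorm_lt (rq x) c2 e0.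
have r1 := sn_ge0 cr.1 (b y (q u - x)); have s1 := sn_ge0 cs.1 (q u - x).
have sue : s (q u) < s (q u) + e by rewrite ltrDl.
have [n Nn un] := sq u _ (le_lt_trans (sn_ge0 cs.1 _) sue) sue.
have h1 : r (b y (q u)) <= p y * (s (q u) + e).
  rewrite (hb y).2; have -> : b0 y u = b0 y (u - n).
    by rewrite (linB (bilinear_r cb0.1 y)) (b0N y n Nn) subr0.
  by apply: le_trans (rpp _ _) _; rewrite ler_wpM2l// ltW.
have h2 := sn_le_sub cr.1 (b y x) (b y (q u)).
have h3 := sn_le_sub cs.1 (q u) x.
move: ux h2; rewrite /= (snBC cr.1 (b y x)) -(linB (hb y).1.1) => ux h2.
have h4 : p y * (s (q u) + e) <= p y * (s x + 2 * e).
  by rewrite ler_wpM2l//; lra.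
lra.
Qed.

End BilinearExtension.

(** * Tensor products with a cyclic module *)

Section CyclicTensor.
Variables (R : realType) (A : arens_michael_algebra R[i]).
Local Notation C := R[i].
Variables (I : set (A * C^o)) (X : left_module A) (pi : A * C^o -> X).
Hypotheses (hI : closed_left_ideal I) (hX : cyclic_module I pi).

Section OneModule.
Variable Y : right_module A.

(** The unital action of the unitization of A. *)
Definition rm_actu (y : Y) (u : A * C^o) : Y := rm_act y u.1 + u.2 *: y.

Lemma rm_act_linl a : linear (fun y : Y => rm_act y a).
Proof. exact: bilinear_l (@rm_bilinear _ _ Y).1 a. Qed.

Lemma rm_act_linr (y : Y) : linear (fun a : A => rm_act y a).
Proof. exact: bilinear_r (@rm_bilinear _ _ Y).1 y. Qed.

Lemma rm_actu_bilinear : bilinear_for *:%R *:%R rm_actu.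
Proof.
split=> [u a y y'|y a u v]; rewrite /rm_actu /=.
  rewrite rm_act_linl !scalerDr !scalerA [u.2 * a]mulrC.
  by rewrite addrACA.
by rewrite (rm_act_linr y a u.1 v.1) scalerDl scalerDr -scalerA addrACA.
Qed.

Lemma rm_actu_continuous : continuous_bilinear rm_actu.
Proof.
apply: bilinear_continuous; first exact: rm_actu_bilinear.
move=> r cr; have [p [q [cp cq h]]] := continuous_bilinear_bound (@rm_bilinear _ _ Y) cr.
exists (fun y => p y + r y), (fun u => q u.1 + normc u.2); split.
- exact: cseminormD.
- split.
    split=> [u v|a u] /=.
      by rewrite addrACA lerD ?(sn_add cq.1)// normcD.
    by rewrite (snZ cq.1) normcM mulrDr.
  exists ([set a | q a < 2^-1], [set s : C^o | normc s < 2^-1]).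
    split; first by apply: cseminorm_nbhs.
    by apply/nbhs0_normc; exists 2^-1.
  by move=> [a s] [/= h1 h2]; lra.
move=> y [a s]; rewrite /rm_actu /=; apply: le_trans (sn_add cr.1 _ _) _.
rewrite (snZ cr.1); have := h y a.
have := sn_ge0 cp.1 y; have := sn_ge0 cr.1 y; have := sn_ge0 cq.1 a.
by have := normc_ge0 s; nra.
Qed.

Lemma rm_actu_mul (y : Y) u v : rm_actu (rm_actu y u) v = rm_actu y (amu_mul u v).
Proof.
rewrite /rm_actu /amu_mul /unitization_mul /=.
rewrite (linD (rm_act_linl _)) (linZ (rm_act_linl _)).
rewrite !(linD (rm_act_linr _)) !(linZ (rm_act_linr _)) rm_assoc scalerDr.
by rewrite scalerA [u.2 * v.2]mulrC addrA.
Qed.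

Lemma rm_actu_act (y : Y) a u :
  rm_actu (rm_act y a) u = rm_actu y (amu_mul (a, 0) u).
Proof.
rewrite -rm_actu_mul; congr rm_actu.
by rewrite /rm_actu /= scale0r addr0.
Qed.

(** The algebraic span Y.I; passing to a completed quotient absorbs its closure. *)
Definition ideal_span : set Y :=
  smallest (@linear_subspace C Y) [set z | exists y u, I u /\ z = rm_actu y u].

Lemma ideal_span_act y u : I u -> ideal_span (rm_actu y u).
Proof. by move=> Iu S [_]; apply; exists y, u. Qed.

Definition cyclic_gen : X := pi (0, 1).

Lemma pi_linear : continuous_linear pi.
Proof. exact: completed_quotient_linear hX.1. Qed.

Lemma pi_pair (a : A) s : pi (a, s) = lm_act a cyclic_gen + s *: cyclic_gen.
Proof.
rewrite /cyclic_gen -hX.2 -(linZ pi_linear.1) -(linD pi_linear.1); congr pi.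
have am0 : am_mul a 0 = 0 by exact: lin0 (bilinear_r (@am_bilinear _ A) a).
rewrite /amu_mul /unitization_mul /= am0 scaler0 scale1r !add0r mul0r.
have <- : (a + s *: 0, 0 + s * 1) = (a, 0) + s *: (0, 1) :> A * C^o by [].
by rewrite scaler0 addr0 add0r mulr1.
Qed.

Variable T : module_tensor Y X.

Lemma balancing_lsubspace : linear_subspace (balancing (@tensor_pure _ _ Y X T)).
Proof. exact/closure_lsubspace/smallest_lsubspace. Qed.

Lemma tensor_elem_bilinear : continuous_bilinear (@tensor_elem _ _ Y X T).
Proof.
have bt := projective_tensor_bilinear (@tensor_fullP _ _ Y X T).
have cq := completed_quotient_linear (@tensor_quotP _ _ Y X T).
apply: bilinear_continuous.
  split=> [x a y y'|y a x x']; rewrite /tensor_elem.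
    by rewrite (bt.1.1 x a y y') cq.1.
  by rewrite (bt.1.2 y a x x') cq.1.
by move=> r cr; exact: continuous_bilinear_bound bt (cseminorm_comp cq cr).
Qed.

Lemma tensor_elem_balanced y a x :
  tensor_elem T (rm_act y a) x = tensor_elem T y (lm_act a x).
Proof.
have cq := completed_quotient_linear (@tensor_quotP _ _ Y X T).
apply/eqP; rewrite -subr_eq0 /tensor_elem -(linB cq.1); apply/eqP.
apply: (completed_quotient_ker (@tensor_quotP _ _ Y X T)).
by apply: subset_closure => S [_]; apply; exists y, a, x.
Qed.

Lemma tensor_elem_pi y u :
  tensor_elem T y (pi u) = tensor_elem T (rm_actu y u) cyclic_gen.
Proof.
have bt := tensor_elem_bilinear.1; case: u => a s; rewrite pi_pair /rm_actu /=.
rewrite (linD (bilinear_r bt y)) (linZ (bilinear_r bt y)).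
rewrite (linD (bilinear_l bt cyclic_gen)) (linZ (bilinear_l bt cyclic_gen)).
by rewrite tensor_elem_balanced.
Qed.

Definition tensor_gen (y : Y) : T := tensor_elem T y cyclic_gen.

(* Y (x)_A X is the completion of Y / Y.I, through y |-> y (x) (1 + I). *)
Lemma tensor_gen_quotient : completed_quotient ideal_span tensor_gen.
Proof.
have cT := @tensor_quotP _ _ Y X T; have pT := @tensor_fullP _ _ Y X T.
have cq := completed_quotient_linear cT.
have cX := hX.1; have sI := ideal_subspace hI.
have ck : continuous_linear tensor_gen.
  exact: continuous_bilinear_l tensor_elem_bilinear.
have k0 y : ideal_span y -> tensor_gen y = 0.
  move=> /(_ [set y | tensor_gen y = 0]); apply; split.
    split; first exact: lin0 ck.1.
    by move=> a x x' /= h h'; rewrite ck.1 h h' scaler0 addr0.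
  move=> _ [z [u [Iu ->]]]; rewrite /= /tensor_gen -tensor_elem_pi.
  rewrite (completed_quotient_ker cX Iu).
  exact: lin0 (bilinear_r tensor_elem_bilinear.1 z).
split=> //; first exact: completed_quotient_complete cT.
  apply/dense_closure => z.
  have sr : linear_subspace (range tensor_gen).
    split; first by exists 0 => //; exact: lin0 ck.1.
    move=> a _ _ [y _ <-] [y' _ <-]; exists (a *: y + y') => //.
    exact: ck.1.
  (* Elementary tensors whose second factor is some [pi u] lie in the range of [tensor_gen], by
     moving [u] to the first factor; the range of [pi] is dense. *)
  have qd z' : closure (range tensor_gen) (tensor_quot z').
    pose S := [set w | closure (range tensor_gen) (@tensor_quot _ _ Y X T w)].
    have sS : linear_subspace S.
      split; first by rewrite /S /= (lin0 cq.1); exact: (closure_lsubspace sr).1.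
      move=> a w w' Sw Sw'; rewrite /S /= cq.1.
      exact: (closure_lsubspace sr).2.
    have SS y x : S (tensor_pure T y x).
      have := (dense_closure _).1 (completed_quotient_dense cX) x.
      have cy := continuous_bilinear_r y tensor_elem_bilinear.
      apply: continuous_linear_closure cy _ => _ [u _ <-].
      by exists (rm_actu y u) => //; rewrite /tensor_gen -tensor_elem_pi.
    have Sz' := projective_tensor_dense pT sS SS.
    apply: closure_closure.
    exact: (continuous_linear_closure (S' := closure (range tensor_gen)) cq _ (Sz' z')).
  have := (dense_closure _).1 (completed_quotient_dense cT) z.
  move=> h; apply: closure_closure.
  by apply: closure_subset h => _ [w _ <-].
(* The neighbourhood condition calls for a continuous inverse: (y, u + I) |-> y u + Y.I induces a
   map from the module tensor product to the completion of Y / Y.I, which sends [tensor_gen y] back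
   to the class of [y]. *)
have cZ := completed_quotient_exists (smallest_lsubspace
  [set z | exists (y : Y) u, I u /\ z = rm_actu y u]).
rewrite -/ideal_span in cZ; set rho := cq_map ideal_span in cZ.
have [cZc crho rhoN _ nrho] := cZ.
have cb0 : continuous_bilinear (fun (y : Y) u => rho (rm_actu y u)).
  have ab := rm_actu_continuous; apply: bilinear_continuous.
    split=> [u a y y'|y a u u'].
      by rewrite (ab.1.1 u a y y') crho.1.
    by rewrite (ab.1.2 y a u u') crho.1.
  by move=> r cr; exact: continuous_bilinear_bound ab (cseminorm_comp crho cr).
have [|b cb bpi] := bilinear_extend sI cX cZc cb0.
  by move=> y n In; apply: rhoN; exact: ideal_span_act.
have [g [[cg gb] _]] := projective_tensor_univ pT cZc cb.
have gbal : forall w, balancing (@tensor_pure _ _ Y X T) w -> g w = 0.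
  move=> w; apply: continuous_linear_closed_eq0 => //; first exact: cZc.1.
  move=> v /(_ [set v | g v = 0]); apply; split.
    split; first exact: lin0 cg.1.
    by move=> a x x' /= h h'; rewrite cg.1 h h' scaler0 addr0.
  move=> _ [y [a [x ->]]] /=; rewrite (linB cg.1) !gb; apply/eqP.
  rewrite subr_eq0; apply/eqP.
  have cact : continuous_linear (fun x : X => lm_act a x).
    exact: continuous_bilinear_r (@lm_bilinear _ _ X).
  have e := continuous_linear_dense_eq (S := range pi) cZc.1
    (continuous_bilinear_r (rm_act y a) cb)
    (continuous_linear_comp (continuous_bilinear_r y cb) cact).
  rewrite e//; first by apply/dense_closure; exact: completed_quotient_dense cX.
  by move=> _ [u _ <-] /=; rewrite -hX.2 !bpi rm_actu_act.
have [h ch hq] := completed_quotient_extend balancing_lsubspace cT cZc cg gbal.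
move=> U /nrho[V V0 VU]; exists (h @^-1` V).
  have := ch.2 0 V; rewrite (lin0 ch.1); exact.
move=> y Vy; apply: VU; move: Vy; rewrite /= /tensor_gen /tensor_elem hq gb bpi.
suff -> : rm_actu y (0, 1) = y by [].
by rewrite /rm_actu /= scale1r (lin0 (rm_act_linr y)) add0r.
Qed.

End OneModule.
End CyclicTensor.

(** * Exactness *)

Section ExactPairs.
Variable R : realType.
Local Notation C := R[i].

Lemma cseminorm_open (E : tvsType C) (p : E -> R) x e : cseminorm p ->
  open [set y | p (y - x) < e].
Proof.
move=> cp; rewrite openE => y /= yx.
have r0 : 0 < e - p (y - x) by rewrite subr_gt0.
apply: filterS (cseminorm_nbhs_at y cp r0) => z /= zy.
by apply: le_lt_trans (sn_tri cp.1 y _ _) _; lra.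
Qed.

(** Openness onto the image in terms of seminorms: a vector with small image can be replaced, within
    its fibre, by a small one. *)
Definition open_onto_image (E F : tvsType C) (f : E -> F) : Prop :=
  forall r, cseminorm r -> exists2 s, cseminorm s &
    forall x e, 0 < e -> s (f x) < e -> exists2 w, f w = f x & r w < e.

(* For linear [f]: injective, with continuous inverse on the image. *)
Definition seminorm_embedding (E F : tvsType C) (f : E -> F) : Prop :=
  forall r, cseminorm r -> exists2 s, cseminorm s & forall x, r x <= s (f x).

Lemma open_onto_imageP (E F : tvsType C) (f : E -> F) : linear f ->
  (forall U : set E, open U ->
    exists2 W : set F, open W & f @` U = W `&` range f) <->
  open_onto_image f.
Proof.
move=> lf; split=> [h r cr|h U oU].
  have oU := cseminorm_open 0 1 cr.
  have [W oW fU] := h _ oU.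
  have W0 : W 0.
    have : (f @` [set y | r (y - 0) < 1]) 0.
      by exists 0; [rewrite /= subrr (sn0 cr.1)|exact: lin0].
    by rewrite fU => -[].
  have [s cs sW] := nbhs0_cseminorm (open_nbhs_nbhs (conj oW W0)).
  exists s => // x e e0 sfx; have ei : 0 <= e^-1 by rewrite invr_ge0 ltW.
  have : (W `&` range f) (f (e^-1%:C *: x)).
    split; last by exists (e^-1%:C *: x).
    by apply: sW; rewrite (linZ lf) (snZr cs.1)// ltr_pdivrMl// mulr1.
  rewrite -fU => -[w /= rw fw]; exists (e%:C *: w).
    by rewrite (linZ lf) fw -(linZ lf) scalerA -rmorphM mulfV ?gt_eqF// scale1r.
  move: rw; rewrite subr0 => rw.
  by rewrite (snZr cr.1) ?(ltW e0)// -ltr_pdivlMl// mulVf ?gt_eqF.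
(* The union of the balls, centred in the image of [U], whose trace on the range of [f] stays inside
   that image. *)
pose W := [set z | exists y s, [/\ U y, cseminorm s, s (z - f y) < 1 &
  forall y', s (f y' - f y) < 1 -> (f @` U) (f y')]].
exists W.
  rewrite openE => z [y [s [Uy cs sz sU]]].
  apply: filterS (open_nbhs_nbhs (conj (cseminorm_open (f y) 1 cs) sz)) => z' sz'.
  by exists y, s.
apply/seteqP; split=> [_ [y Uy <-]|z [[y [s [Uy cs sz sU]]] [y' _ fy']]].
  split; last by exists y.
  have /nbhs_cseminorm[r cr rU] := open_nbhs_nbhs (conj oU Uy).
  have [s cs sr] := h r cr; exists y, s; split=> //.
    by rewrite subrr (sn0 cs.1).
  move=> y'; rewrite -(linB lf) => /(sr _ _ ltr01)[w fw rw].
  exists (y + w); first by apply: rU; rewrite addrC addKr.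
  by rewrite (linD lf) fw (linB lf) addrC subrK.
by rewrite -fy'; apply: sU; rewrite fy'.
Qed.

Lemma open_onto_image_inj (E F : tvsType C) (f : E -> F) :
  injective f -> open_onto_image f -> seminorm_embedding f.
Proof.
move=> fi fo r cr; have [s cs sr] := fo r cr; exists s => // x.
apply/ler_addgt0Pr => e e0; have se : s (f x) < s (f x) + e by rewrite ltrDl.
have [w /fi -> rw] := sr x _ (le_lt_trans (sn_ge0 cs.1 _) se) se.
exact: ltW.
Qed.

Lemma embedding_open_onto_image (E F : tvsType C) (f : E -> F) :
  seminorm_embedding f ->
  open_onto_image f.
Proof.
move=> h r cr; have [s cs rs] := h r cr; exists s => // x e e0 sfx.
by exists x => //; exact: le_lt_trans (rs x) sfx.
Qed.

Lemma embedding_injective (E F : tvsType C) (f : E -> F) :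
  hausdorff_space E -> linear f ->
  seminorm_embedding f ->
  injective f.
Proof.
move=> hE lf h x y fxy; apply: cseminorm_eq => // r cr.
have [s cs rs] := h r cr; apply: le_trans (rs _) _.
by rewrite (linB lf) fxy subrr (sn0 cs.1).
Qed.

Lemma embedding_closed (E F : tvsType C) (f : E -> F) :
  complete_lcs E -> hausdorff_space F -> continuous_linear f ->
  seminorm_embedding f ->
  forall z, closure (range f) z -> exists x, f x = z.
Proof.
move=> [hE cE] hF cf h z zf.
pose base (s : F -> R) := [set x | s (f x - z) < 1].
pose Fz := filter_from [set s : F -> R | cseminorm s] base.
have FF : ProperFilter Fz.
  apply: filter_from_proper.
    apply: filter_from_filter; first by exists (fun=> 0); exact: cseminorm0.
    move=> p q cp cq; exists (fun x => p x + q x); first exact: cseminormD.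
    move=> x /=; rewrite /base /= => h1; have := sn_ge0 cp.1 (f x - z).
    by have := sn_ge0 cq.1 (f x - z); split; lra.
  move=> p cp; have [_ [x _ <-] h1] := closure_cseminorm_lt zf cp ltr01.
  by exists x.
have [|x xF] := cE Fz FF.
  apply/tvs_cauchy_cseminorm => r cr; have [s cs rs] := h r cr.
  exists (base (fun x => 2 * s x)).
    by exists (fun x => 2 * s x) => //; exact: cseminorm_scale.
  move=> x y; rewrite /base /= => h1 h2; apply: le_lt_trans (rs _) _.
  rewrite (linB cf.1); apply: le_lt_trans (sn_tri cs.1 z _ _) _.
  by rewrite (snBC cs.1 z); lra.
exists x; apply: cseminorm_eq => // s cs.
apply: (@le0_small _ _ 2) => e e0; have cr := cseminorm_comp cf cs.
have [s' cs' sub] := xF _ (cseminorm_nbhs_at x cr e0).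
have ei : 0 <= e^-1 by rewrite invr_ge0 ltW.
have c2 := cseminormD cs' (cseminorm_scale ei cs).
have [_ [y _ <-] h1] := closure_cseminorm_lt zf c2 ltr01.
have s'0 := sn_ge0 cs'.1 (f y - z); have s0 := sn_ge0 cs.1 (f y - z).
have es0 : 0 <= e^-1 * s (f y - z) by rewrite mulr_ge0.
have : s (f y - z) < e.
  have : e^-1 * s (f y - z) < 1 by lra.
  by rewrite ltr_pdivrMl// mulr1.
have /sub /= : base s' y by rewrite /base /=; lra.
rewrite (linB cf.1); have := sn_tri cs.1 (f y) (f x) z.
by rewrite (snBC cs.1 (f x) (f y)); lra.
Qed.

Section QuotientOfExactPair.
Variables (E1 E2 E3 T1 T2 T3 : tvsType C).
Variables (N1 : set E1) (N2 : set E2) (N3 : set E3).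
Variables (k1 : E1 -> T1) (k2 : E2 -> T2) (k3 : E3 -> T3).
Variables (i : E1 -> E2) (p : E2 -> E3) (i' : T1 -> T2) (p' : T2 -> T3).
Hypotheses (sN3 : linear_subspace N3).
Hypotheses (cq1 : completed_quotient N1 k1) (cq2 : completed_quotient N2 k2)
  (cq3 : completed_quotient N3 k3).
Hypotheses (ip : exact_pair_lcs i p) (ci' : continuous_linear i')
  (cp' : continuous_linear p').
Hypotheses (ik : forall y, i' (k1 y) = k2 (i y))
  (pk : forall y, p' (k2 y) = k3 (p y)).
(** Only up to closure: since [p] merely has dense range, the image of Y2.I is only dense in
    Y3.I. *)
Hypothesis NN : forall n, N3 n -> closure (p @` N2) n.

Let lk1 := completed_quotient_linear cq1.
Let lk2 := completed_quotient_linear cq2.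
Let lk3 := completed_quotient_linear cq3.
Let ci := exact_lcs_i ip.
Let cp := exact_lcs_p ip.

Let rk2 z : closure (range k2) z.
Proof. exact: (dense_closure _).1 (completed_quotient_dense cq2) z. Qed.

Let pi0 x : p (i x) = 0.
Proof.
have : range i (i x) by exists x.
by rewrite (exact_lcs_i_range ip).
Qed.

Let pi'0 z : p' (i' z) = 0.
Proof.
have e : p' \o i' = (fun=> 0) :> (T1 -> T3).
  have hT3 := (completed_quotient_complete cq3).1.
  apply: (continuous_linear_dense_eq (S := range k1)) => //.
  - exact: continuous_linear_comp.
  - split; first by move=> a x y; rewrite scaler0 addr0.
    by move=> x; exact: cst_continuous.
  - by move=> x; exact: (dense_closure _).1 (completed_quotient_dense cq1) x.
  by move=> _ [y _ <-] /=; rewrite ik pk pi0 (lin0 lk3.1).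
exact: (congr1 (fun f => f z) e).
Qed.

(** Exactness in the middle up to a small error. If [k3 (p y)] is small then [p y] is near [N3], so
    [p (y - m)] is small for some [m] in [N2]; openness of [p] gives a small [w] with the same
    image, and [y - m - w] comes from [E1]. *)
Lemma quotient_ker_approx r : cseminorm r -> exists2 s, cseminorm s &
  forall y e, 0 < e -> s (p' (k2 y)) < e ->
    exists x, r (k2 y - i' (k1 x)) < e.
Proof.
move=> cr; have po := (open_onto_imageP cp.1).1 (exact_lcs_p_open ip).
have [s2 cs2 s2r] := po _ (cseminorm_comp lk2 cr).
have [s cs ss2] := completed_quotient_bound sN3 cq3 cs2.
exists s => // y e e0; rewrite pk => /(ss2 _ _ e0)[n Nn pyn].
have d0 : 0 < e - s2 (p y - n) by rewrite subr_gt0.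
have [_ [m Nm <-] mn] := closure_cseminorm_lt (NN Nn) cs2 d0.
have : s2 (p (y - m)) < e.
  rewrite (linB cp.1); apply: le_lt_trans (sn_tri cs2.1 n _ _) _.
  by rewrite (snBC cs2.1 n); lra.
move=> /(s2r _ _ e0)[w pw /= rw].
have [x _ ix] : range i (y - m - w).
  by rewrite (exact_lcs_i_range ip) /= (linB cp.1) pw subrr.
exists x; rewrite ik ix !(linB lk2.1) (completed_quotient_ker cq2 Nm) subr0.
by rewrite subKr.
Qed.

Lemma quotient_p_open : open_onto_image p'.
Proof.
(* The factor 2 leaves half of [e] for replacing [z] by some [k2 y]. *)
move=> r cr; have cr2 := cseminorm_scale (ler0n R 2) cr.
have [s cs sr] := quotient_ker_approx cr2; exists s => // z e e0 sz.
have d0 : 0 < e - s (p' z) by rewrite subr_gt0.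
have c2 := cseminormD cr2 (cseminorm_comp cp' cs).
have [_ [y _ <-] h] := closure_cseminorm_lt (@rk2 z) c2 d0.
have r0 := sn_ge0 cr.1 (k2 y - z).
have s0 := sn_ge0 cs.1 (p' (k2 y - z)); have s1 := sn_ge0 cs.1 (p' z).
have [] := sr y e e0.
  have := sn_le_sub cs.1 (p' (k2 y)) (p' z).
  by move: h; rewrite /= (linB cp'.1); lra.
move=> x rx; exists (z - i' (k1 x)); first by rewrite (linB cp'.1) pi'0 subr0.
apply: le_lt_trans (sn_tri cr.1 (k2 y) _ _) _; rewrite (snBC cr.1 z).
by move: h; rewrite /=; lra.
Qed.

Lemma quotient_p_dense z : closure (range p') z.
Proof.
apply/closure_cseminorm => q cq; have e2 : 0 < 2^-1 :> R by rewrite invr_gt0.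
have dk3 := (dense_closure _).1 (completed_quotient_dense cq3) z.
have [_ [y _ <-] h1] := closure_cseminorm_lt dk3 cq e2.
have dp := (dense_closure _).1 (exact_lcs_p_dense ip) y.
have [_ [x _ <-] h2] := closure_cseminorm_lt dp (cseminorm_comp lk3 cq) e2.
exists (p' (k2 x)); first by exists (k2 x).
rewrite pk; apply: le_lt_trans (sn_tri cq.1 (k3 y) _ _) _.
by move: h2; rewrite /= (linB lk3.1); lra.
Qed.

Hypothesis emb : seminorm_embedding i'.

Lemma quotient_exact_pair : exact_pair_lcs i' p'.
Proof.
have [hT1 cT1] := completed_quotient_complete cq1.
have [hT2 cT2] := completed_quotient_complete cq2.
split=> //.
- exact: embedding_injective hT1 ci'.1 emb.
- apply/seteqP; split=> [_ [x _ <-]|z /= pz]; first exact: pi'0.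
  have [x <-] : exists x, i' x = z; last by exists x.
  apply: embedding_closed => //; apply/closure_cseminorm => r cr.
  have [s cs sr] := quotient_ker_approx cr.
  have e2 : 0 < 2^-1 :> R by rewrite invr_gt0.
  have c2 := cseminormD cr (cseminorm_comp cp' cs).
  have [_ [y _ <-] h] := closure_cseminorm_lt (@rk2 z) c2 e2.
  have r0 := sn_ge0 cr.1 (k2 y - z).
  have s0 := sn_ge0 cs.1 (p' (k2 y - z)).
  have [] := sr y _ e2.
    by move: h; rewrite /= (linB cp'.1) pz subr0; lra.
  move=> x rx; exists (i' (k1 x)); first by exists (k1 x).
  apply: le_lt_trans (sn_tri cr.1 (k2 y) _ _) _.
  by rewrite (snBC cr.1 (i' _)); move: h; rewrite /=; lra.
- by apply/(open_onto_imageP ci'.1)/embedding_open_onto_image.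
- exact/(open_onto_imageP cp'.1)/quotient_p_open.
- exact/dense_closure/quotient_p_dense.
Qed.

End QuotientOfExactPair.
End ExactPairs.

(** * From an approximate identity to exactness *)

Section Flatness.
Variables (R : realType) (A : arens_michael_algebra R[i]).
Local Notation C := R[i].
Variables (I : set (A * C^o)) (X : left_module A) (pi : A * C^o -> X).
Hypotheses (hI : closed_left_ideal I) (hX : cyclic_module I pi).

Lemma right_module_map_actu (Y Y' : right_module A) (f : Y -> Y') y u :
  right_module_map f -> f (rm_actu y u) = rm_actu (f y) u.
Proof.
by move=> [cf fa]; rewrite /rm_actu (linD cf.1) (linZ cf.1) fa.
Qed.

Lemma image_lsubspace (V W : lmodType C) (f : V -> W) (S : set V) :
  linear f -> linear_subspace S -> linear_subspace (f @` S).
Proof.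
move=> lf sS; split; first by exists 0; [exact: sS.1|exact: lin0].
move=> a _ _ [x Sx <-] [y Sy <-]; exists (a *: x + y); first exact: sS.2.
exact: lf.
Qed.

Lemma ideal_span_dense_image (Y Y' : right_module A) (f : Y -> Y') n :
  right_module_map f -> dense (range f) ->
  ideal_span I (Y := Y') n -> closure (f @` ideal_span I (Y := Y)) n.
Proof.
move=> hf df /(_ (closure (f @` ideal_span I (Y := Y)))); apply; split.
  apply/closure_lsubspace/image_lsubspace; first exact: hf.1.1.
  exact: smallest_lsubspace.
move=> _ [y [u [Iu ->]]].
have := (dense_closure _).1 df y.
apply: continuous_linear_closure (continuous_bilinear_l u (rm_actu_continuous Y')) _.
move=> _ [x _ <-]; exists (rm_actu x u); first exact: ideal_span_act.
exact: right_module_map_actu.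
Qed.

(** The definition measures size and error by the same neighbourhood. Dilating [F] by the inverse of
    [eta] separates the two, so that [c] depends on [Q] alone. *)
Lemma approximate_identity_bound (Q : A * C^o -> R) : cseminorm Q ->
  right_locally_bounded_ai I ->
  exists2 c : R, 0 < c & forall (F : seq (A * C^o)) (eta : R), 0 < eta ->
    (forall a, a \in F -> I a) ->
    exists b, [/\ I b, Q b < c & forall a, a \in F -> Q (a - amu_mul a b) < eta].
Proof.
move=> cQ hai; have sI := ideal_subspace hI.
have [|cC [/gt0_complexE[c c0 ->] hc]] := hai [set u | Q u < 1].
  by apply: filterS cQ.2 => u.
exists c => // F eta eta0 FI; have ei : 0 <= eta^-1 by rewrite invr_ge0 ltW.
have [||u [Iu Qu uF]] := hc [set eta^-1%:C *: a | a in [set` F]].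
- exact/finite_image/finite_seq.
- by move=> _ [a /= aF <-]; apply: lsubspaceZ sI _; exact: FI.
exists (c%:C *: u); split.
- exact: lsubspaceZ sI _.
- by rewrite (snZr cQ.1) ?(ltW c0)// -[ltRHS]mulr1 ltr_pM2l.
move=> a aF; have /= := uF (eta^-1%:C *: a) (ex_intro2 _ _ a aF erefl).
have -> : amu_mul (eta^-1%:C *: a) (c%:C *: u) =
    eta^-1%:C *: amu_mul a (c%:C *: u).
  have ml := bilinear_l (@am_bilinear _ A) (c%:C *: u).1.
  rewrite /amu_mul /unitization_mul /=; congr pair.
    rewrite (linZ ml) !scalerDr !scalerA /=; congr (_ + _ + _ *: _).
    exact: mulrC.
  exact/esym/mulrA.
by rewrite -scalerBr (snZr cQ.1)// ltr_pdivrMl// mulr1.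
Qed.

(** For a finite sum of terms [y u], the list [F] collects the elements [u], and [k] adds up the
    numbers [P y]: the error [y u - y (u b)] is at most [P y] times [Q (u - u b)]. *)
Lemma ideal_span_approx_unit (Y : right_module A) (P : Y -> R)
    (Q : A * C^o -> R) (t : Y -> R) n :
  rseminorm t -> rseminorm P -> rseminorm Q ->
  (forall y u, t (rm_actu y u) <= P y * Q u) ->
  ideal_span I n -> exists (F : seq (A * C^o)) (k : R),
    [/\ 0 <= k, forall a, a \in F -> I a & forall b eta,
      (forall a, a \in F -> Q (a - amu_mul a b) < eta) -> 0 < eta ->
      t (n - rm_actu n b) <= k * eta].
Proof.
move=> st sP sQ tPQ.
pose S := [set n : Y | exists (F : seq (A * C^o)) (k : R),
    [/\ 0 <= k, forall a, a \in F -> I a & forall b eta,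
      (forall a, a \in F -> Q (a - amu_mul a b) < eta) -> 0 < eta ->
      t (n - rm_actu n b) <= k * eta]].
have lY := rm_actu_bilinear Y.
move=> /(_ S); apply; split; first split.
- exists [::], 0; split=> // b eta _ _.
  by rewrite (lin0 (bilinear_l lY b)) subrr (sn0 st) mul0r.
- move=> a x y [F1 [k1 [k10 F1I h1]]] [F2 [k2 [k20 F2I h2]]].
  exists (F1 ++ F2), (normc a * k1 + k2); split.
  + by rewrite addr_ge0// mulr_ge0 ?normc_ge0.
  + by move=> b; rewrite mem_cat => /orP[/F1I|/F2I].
  move=> b eta hb eta0.
  have {}h1 : t (x - rm_actu x b) <= k1 * eta.
    by apply: h1 => // c cF; apply: hb; rewrite mem_cat cF.
  have {}h2 : t (y - rm_actu y b) <= k2 * eta.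
    by apply: h2 => // c cF; apply: hb; rewrite mem_cat cF orbT.
  have -> : a *: x + y - rm_actu (a *: x + y) b =
      a *: (x - rm_actu x b) + (y - rm_actu y b).
    by rewrite (linD (bilinear_l lY b)) (linZ (bilinear_l lY b)) opprD addrACA scalerBr.
  apply: le_trans (sn_add st _ _) _; rewrite (snZ st) mulrDl lerD//.
  by rewrite -mulrA ler_wpM2l ?normc_ge0.
- move=> _ [y [u [Iu ->]]]; exists [:: u], (P y); split.
  + exact: sn_ge0 sP y.
  + by move=> a; rewrite inE => /eqP ->.
  move=> b eta hb _; rewrite rm_actu_mul -(linB (bilinear_r lY y)).
  apply: le_trans (tPQ _ _) _; rewrite ler_wpM2l ?(sn_ge0 sP)// ltW// hb//.
  exact: mem_head.
Qed.

(* If [i y = v + n] with [n] in the span of [Y2 . I] and [b] in [I] satisfies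
   [n b ~ n], then [y] has the same class as [y - y b], and
   [i (y - y b) ~ v - v b], where [v b] is small since [b] is bounded. *)
Lemma approximate_identity_embedding (Y1 Y2 : right_module A) (i : Y1 -> Y2)
    (T1 : module_tensor Y1 X) (T2 : module_tensor Y2 X) (i' : T1 -> T2) :
  right_locally_bounded_ai I -> right_module_map i ->
  seminorm_embedding i ->
  tensor_map i i' ->
  seminorm_embedding i'.
Proof.
move=> hai hi iemb [ci' ii'] r cr.
have cq1 := tensor_gen_quotient hI hX T1; have cq2 := tensor_gen_quotient hI hX T2.
have lk1 := completed_quotient_linear cq1.
have [t ct rt] := iemb _ (cseminorm_comp lk1 cr).
have [P [Q [cP cQ tPQ]]] := continuous_bilinear_bound (rm_actu_continuous Y2) ct.
have [c c0 hc] := approximate_identity_bound cQ hai.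
(* Together with [Q b < c], this seminorm bounds [t (v - v b)] for [v = i y - n]. *)
have cs0 := cseminormD ct (cseminorm_scale (ltW c0) cP).
have sN2 := smallest_lsubspace
  [set z | exists (y : Y2) u, I u /\ z = rm_actu y u].
have [s cs ss0] := completed_quotient_bound sN2 cq2 cs0.
have key y : r (tensor_gen pi T1 y) <= s (i' (tensor_gen pi T1 y)).
  have -> : i' (tensor_gen pi T1 y) = tensor_gen pi T2 (i y) by exact: ii'.
  apply/ler_addgt0Pr => e e0; have e2 : 0 < e / 2 by rewrite divr_gt0.
  set z := tensor_gen pi T2 (i y).
  have se : s z < s z + e / 2 by rewrite ltrDl.
  have [n Nn yn] := ss0 _ _ (le_lt_trans (sn_ge0 cs.1 _) se) se.
  have [F [k [k0 FI hF]]] := ideal_span_approx_unit ct.1 cP.1 cQ.1 tPQ Nn.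
  have k1 : 0 < k + 1 by rewrite ltr_wpDl.
  have eta0 : 0 < e / 2 / (k + 1) by rewrite divr_gt0.
  have [b [Ib Qb bF]] := hc F _ eta0 FI.
  have hn := hF b _ bF eta0.
  have kk : k * (e / 2 / (k + 1)) <= e / 2.
    by rewrite mulrA ler_pdivrMr// [k * _]mulrC ler_wpM2l ?(ltW e2)// lerDl.
  have -> : tensor_gen pi T1 y = tensor_gen pi T1 (y - rm_actu y b).
    rewrite (linB lk1.1) (completed_quotient_ker cq1 (ideal_span_act y Ib)).
    by rewrite subr0.
  apply: le_trans (rt _) _; rewrite (linB hi.1.1) right_module_map_actu//.
  have lY := rm_actu_bilinear Y2.
  have -> : i y - rm_actu (i y) b =
      (i y - n) - rm_actu (i y - n) b + (n - rm_actu n b).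
    by rewrite (linB (bilinear_l lY b)) opprB addrAC !subrKA.
  apply: le_trans (sn_add ct.1 _ _) _.
  have h1 := snB ct.1 (i y - n) (rm_actu (i y - n) b).
  have h2 := tPQ (i y - n) b.
  have h3 : P (i y - n) * Q b <= c * P (i y - n).
    by rewrite mulrC ler_wpM2r ?(sn_ge0 cP.1)// ltW.
  by move: yn; rewrite /=; lra.
exists s => // z; rewrite -subr_le0; apply: (@le0_small _ _ 2) => e e0.
have c2 := cseminormD cr (cseminorm_comp ci' cs).
have dk := (dense_closure _).1 (completed_quotient_dense cq1) z.
have [_ [y _ <-] h] := closure_cseminorm_lt dk c2 e0.
have r0 := sn_ge0 cr.1 (tensor_gen pi T1 y - z).
have s0 := sn_ge0 cs.1 (i' (tensor_gen pi T1 y - z)).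
have h1 := sn_le_sub cr.1 z (tensor_gen pi T1 y).
have h2 := sn_le_sub cs.1 (i' (tensor_gen pi T1 y)) (i' z).
move: h h1 h2 (key y); rewrite /= (snBC cr.1 z) -(linB ci'.1); lra.
Qed.

Lemma embedding_tensor_exact (Y1 Y2 Y3 : right_module A) (i : Y1 -> Y2)
    (p : Y2 -> Y3) (T1 : module_tensor Y1 X) (T2 : module_tensor Y2 X)
    (T3 : module_tensor Y3 X) (i' : T1 -> T2) (p' : T2 -> T3) :
  exact_pair_modules i p -> tensor_map i i' -> tensor_map p p' ->
  seminorm_embedding i' ->
  exact_pair_lcs i' p'.
Proof.
move=> [hi hp ip] [ci' ii'] [cp' pp'] emb.
apply: (quotient_exact_pair (smallest_lsubspace _)
  (tensor_gen_quotient hI hX T1) (tensor_gen_quotient hI hX T2)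
  (tensor_gen_quotient hI hX T3) ip ci' cp') => //.
- by move=> y; exact: ii'.
- by move=> y; exact: pp'.
- by move=> n; apply: ideal_span_dense_image => //; exact: exact_lcs_p_dense ip.
Qed.

Lemma approximate_identity_flat : right_locally_bounded_ai I ->
  tensor_takes X (@exact_pair_modules _ A) (@exact_pair_lcs C).
Proof.
move=> hai Y1 Y2 Y3 i p ip T1 T2 T3 i' p' ti tp.
apply: (embedding_tensor_exact ip ti tp).
have [hi _ ep] := ip.
apply: (approximate_identity_embedding hai hi _ ti).
apply: (open_onto_image_inj (exact_lcs_i_inj ep)).
exact/(open_onto_imageP hi.1.1)/(exact_lcs_i_homeo ep).
Qed.

End Flatness.

(** * Banach spaces *)

Section BanachSpaces.
Variable R : realType.
Local Notation C := R[i].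

Lemma normr_real_complex (x : R) : `|x%:C| = `|x|%:C :> C.
Proof. by rewrite -normc_real. Qed.

Definition norming (E : tvsType C) (p : E -> R) : Prop :=
  cseminorm p /\ forall q, cseminorm q -> exists2 c : R, 0 < c &
    forall x, q x <= c * p x.

Lemma banach_spaceP (E : tvsType C) :
  banach_space E <-> complete_lcs E /\ exists p : E -> R, norming p.
Proof.
split=> [[cE [p [[pD pZ] p0 pg]]]|[cE [p [cp pq]]]]; split=> //.
  have pz : p 0 = 0 by rewrite -(scale0r 0) pZ normr0 mul0r.
  have pN x : p (- x) = p x by rewrite -scaleN1r pZ normrN normr1 mul1r.
  have pge x : 0 <= p x.
    have := pD x (- x); rewrite subrr pz pN -mulr2n -mulr_natr.
    by rewrite pmulr_lge0// ltr0n.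
  have pE x : p x = (Re (p x))%:C.
    by have [y _ ->] := ge0_complexE (pge x).
  exists (fun x => Re (p x)); split; first split; first split.
  - by move=> x y; have := pD x y; rewrite (pE x) (pE y) (pE (x + y)) -raddfD lecR.
  - move=> a x; have : p (a *: x) = (normc a)%:C * p x by exact: pZ.
    by rewrite {1}(pE x) -rmorphM => ->.
  - apply/pg; exists 1%N, (fun=> tt), 1; split=> // x /(_ ord0).
    by rewrite (pE x) ltcR.
  move=> q [sq /pg[n [s [e [/gt0_complexE[t t0 ->] h]]]]].
  exists t^-1; first by rewrite invr_gt0.
  move=> x; apply/ler_addgt0Pr => e' e'0.
  have k0 : 0 < Re (p x) + t * e'.
    by have := pge x; rewrite (pE x) ler0c => p1; rewrite ltr_wpDl// mulr_gt0.
  have ki : 0 <= (t / (Re (p x) + t * e')) by rewrite divr_ge0 ?ltW.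
  have := h ((t / (Re (p x) + t * e'))%:C *: x).
  have -> : t^-1 * Re (p x) + e' = t^-1 * (Re (p x) + t * e').
    by rewrite mulrDr mulrA mulVf ?mul1r// gt_eqF.
  rewrite /= (snZr sq)// => hx; rewrite -ler_pdivrMl ?invr_gt0// invrK.
  rewrite -[leRHS]mulr1 -ler_pdivrMl// mulrA [_^-1 * t]mulrC; apply/ltW/hx.
  move=> k; rewrite pZ (pE x) normr_real_complex.
  rewrite -rmorphM ltcR ger0_norm// mulrAC ltr_pdivrMr// ltr_pM2l// ltrDl.
  by rewrite mulr_gt0.
exists (fun x => (p x)%:C); split.
- split=> [x y|a x]; first by rewrite -raddfD lecR (sn_add cp.1).
  by rewrite (snZ cp.1) rmorphM.
- move=> x [px]; apply: (cseminorm_eq0 cE.1) => q cq.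
  by have [c _ qc] := pq q cq; apply: le_trans (qc x) _; rewrite px mulr0.
- move=> U; split=> [/nbhs0_cseminorm[q cq qU]|[n [s [e [e0 sU]]]]].
    have [c c0 qc] := pq q cq.
    exists 1%N, (fun=> tt), (c^-1)%:C; split; first by rewrite ltcR invr_gt0.
    move=> x /(_ ord0); rewrite ltcR => h; apply: qU.
    apply: le_lt_trans (qc x) _.
    by rewrite -ltr_pdivlMl// mulr1.
  have [t t0 te] := gt0_complexE e0.
  apply: filterS (cseminorm_nbhs cp t0) => x /= pt; apply: sU => k.
  by rewrite te ltcR.
Qed.

Section Sequences.
Variables (E : tvsType C) (p : E -> R).
Hypotheses (cE : complete_lcs E) (np : norming p).

(** Bounding the increments by differences of [rho] makes their sums telescope, which gives both the
    Cauchy property and the final estimate. *)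
Lemma sequence_limit (u : nat -> E) (rho : nat -> R) :
  (forall n, 0 <= rho n) -> (forall e, 0 < e -> exists n, rho n < e) ->
  (forall n, p (u n.+1 - u n) <= rho n - rho n.+1) ->
  exists x, forall n, p (x - u n) <= rho n.
Proof.
move=> rho0 rhoe urho; have [cp pq] := np.
have h n k : p (u (k + n)%N - u n) <= rho n - rho (k + n)%N.
  elim: k => [|k IH]; first by rewrite !subrr (sn0 cp.1).
  apply: le_trans (sn_tri cp.1 (u (k + n)%N) _ _) _.
  by have := urho (k + n)%N; rewrite addSn; lra.
have h' n k : (n <= k)%N -> p (u k - u n) <= rho n.
  by move=> /subnK <-; apply: le_trans (h n _) _; rewrite gerBl.
have [|x xu] := cE.2 (u @ \oo) _.
  apply/tvs_cauchy_cseminorm => q cq; have [c c0 qc] := pq q cq.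
  have [n rn] := rhoe (2 * c)^-1 (ltac:(by rewrite invr_gt0 mulr_gt0)).
  exists (u @` [set k | (n <= k)%N]).
    by exists n => // k /= nk; exists k.
  move=> _ _ [k nk <-] [l nl <-]; apply: le_lt_trans (qc _) _.
  rewrite -ltr_pdivlMl// mulr1; apply: le_lt_trans (sn_tri cp.1 (u n) _ _) _.
  have := h' n k nk; have := h' n l nl; rewrite (snBC cp.1 (u l)).
  move: rn; rewrite invfM; lra.
exists x => n; apply/ler_addgt0Pr => e e0.
have xk : \forall k \near \oo, p (u k - x) < e.
  exact: xu _ (cseminorm_nbhs_at x cp e0).
have [k [/= uk nk]] := filter_ex (filterI xk (nbhs_infty_ge n)).
have := sn_tri cp.1 (u k) x (u n); rewrite (snBC cp.1 x (u k)).
by have := h' n k nk; lra.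
Qed.

End Sequences.

Lemma exp_half_small (c e : R) : 0 < e -> exists n : nat, c * 2^-1 ^+ n < e.
Proof.
move=> e0; have [c0|c0] := leP c 0.
  exists 0%N; rewrite expr0 mulr1; exact: le_lt_trans e0.
have h : 0 < e / c by rewrite divr_gt0.
have /cvgrPdist_lt /(_ _ h) : (2^-1 : R) ^+ n @[n --> \oo] --> 0.
  by apply: cvg_expr; rewrite ger0_norm ?invr_ge0//; lra.
move=> [n _ /(_ n (leqnn n))] /=; rewrite sub0r normrN ger0_norm ?exprn_ge0 ?invr_ge0//.
by move=> hn; exists n; rewrite mulrC -ltr_pdivlMr.
Qed.

(* [x] is a sum of corrections [x_n] with [p x_n < 2^-n], the remainder after
   [x_n] having norm less than [d / 2^n.+1]. *)
Lemma almost_open_surjective (E F : tvsType C) (p : E -> R) (q : F -> R)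
    (f : E -> F) (S : set F) (d : R) :
  complete_lcs E -> norming p -> hausdorff_space F -> norming q ->
  continuous_linear f -> linear_subspace S -> range f `<=` S -> 0 < d ->
  (forall z e, S z -> q z < d -> 0 < e ->
    exists x, p x < 1 /\ q (z - f x) < e) ->
  forall z, S z -> q z < d -> exists x, p x <= 2 /\ f x = z.
Proof.
move=> cE np hF nq cf sS fS d0 ao z Sz qz.
have [cp pq] := np; have [cq qq] := nq.
pose h n : R := 2^-1 ^+ n.
have h0 n : 0 < h n by rewrite exprn_gt0// invr_gt0.
have hS n : h n.+1 = h n / 2 by rewrite /h exprSr.
have step (nz : nat * F) : exists x, S nz.2 -> q nz.2 < d * h nz.1 ->
    p x < h nz.1 /\ q (nz.2 - f x) < d * h nz.1.+1.
  case: nz => n y /=; have hi : 0 <= (h n)^-1 by rewrite invr_ge0 ltW.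
  have [[Sy qy]|nh] := pselect (S y /\ q y < d * h n); last first.
    by exists 0 => Sy qy; exfalso; apply: nh.
  have d2 : 0 < d / 2 by rewrite divr_gt0.
  have [||x [px qx]] := ao ((h n)^-1%:C *: y) (d / 2) _ _ d2.
  - exact: lsubspaceZ.
  - by rewrite (snZr cq.1)// ltr_pdivrMl// mulrC.
  exists ((h n)%:C *: x) => _ _; split.
    by rewrite (snZr cp.1) ?(ltW (h0 n))// -[ltRHS]mulr1 ltr_pM2l.
  have -> : y - f ((h n)%:C *: x) = (h n)%:C *: ((h n)^-1%:C *: y - f x).
    rewrite scalerBr scalerA -rmorphM mulfV ?gt_eqF// scale1r.
    by rewrite (linZ cf.1).
  by rewrite (snZr cq.1) ?(ltW (h0 n))// hS [ltRHS]mulrCA ltr_pM2l.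
have [g hg] := choice step.
pose s := fix s n := if n is m.+1 then s m + g (m, z - f (s m)) else 0.
have inv n : S (z - f (s n)) /\ q (z - f (s n)) < d * h n.
  elim: n => [|n [Sn qn]].
    by rewrite /= (lin0 cf.1) subr0 /h expr0 mulr1.
  have [pg qg] := hg (n, z - f (s n)) Sn qn.
  rewrite /= (linD cf.1) opprD addrA; split=> //.
  by apply: lsubspaceB => //; apply: fS; exists (g (n, z - f (s n))).
(* The corrections from the [n]th on have total norm at most 2 / 2^n. *)
have [|||x hx] := sequence_limit cE np (u := s) (rho := fun n => 2 * h n).
- by move=> n; rewrite mulr_ge0 ?(ltW (h0 n)).
- by move=> e e0; exact: exp_half_small.
- move=> n; rewrite /= addrC addKr; have [Sn qn] := inv n.
  have [pg _] := hg (n, z - f (s n)) Sn qn.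
  by rewrite hS; move: pg; rewrite /=; lra.
exists x; split; first by have := hx 0%N; rewrite /= subr0 /h expr0 mulr1.
apply/esym/cseminorm_eq => // r cr; have [c c0 rc] := qq r cr.
have [c' c'0 fc] := pq _ (cseminorm_comp cf cr).
apply: (@le0_small _ _ 1) => e e0; rewrite mul1r.
have [n hn] := exp_half_small (c * d + c' * 2) e0.
apply: le_trans (sn_tri cr.1 (f (s n)) _ _) _.
have := rc (z - f (s n)); have := fc (s n - x); rewrite /= (linB cf.1).
have := ler_wpM2l (ltW c0) (ltW (inv n).2).
have := ler_wpM2l (ltW c'0) (hx n); rewrite (snBC cp.1 x).
by move: hn; rewrite mulrDl -/(h n) -!mulrA; lra.
Qed.

(** * The open mapping theorem for maps with closed range *)

Section OpenMapping.
Variables (E F : tvsType C) (f : E -> F).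
Hypotheses (bE : banach_space E) (bF : banach_space F).
Hypotheses (cf : continuous_linear f)
  (rf : forall z, closure (range f) z -> range f z).

Lemma baire_almost_open (p : E -> R) (q : F -> R) : norming p -> norming q ->
  exists2 d : R, 0 < d & forall z e, range f z -> q z < d -> 0 < e ->
    exists x, p x < 1 /\ q (z - f x) < e.
Proof.
move=> np nq; have [cp pq] := np; have [cq qq] := nq.
pose D n := [set z | forall e : R, 0 < e ->
  exists x, p x < n.+1%:R /\ q (z - f x) < e].
have sr : linear_subspace (range f).
  by apply: image_lsubspace; [exact: cf.1|].
have [[n [z0 [rho [rho0 rz0 hD]]]]|nD] := pselect (exists n z0 (rho : R),
    [/\ 0 < rho, range f z0 & forall z, range f z -> q (z - z0) < rho -> D n z]).
  have n0 : 0 < 2 * n.+1%:R :> R by rewrite mulr_gt0// ltr0n.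
  (* [z] is a multiple of the difference of two points of [D n], namely [z0] and [z0 + 2 (n + 1) z];
     subtracting their approximants and rescaling gives an argument of norm below 1. *)
  exists (rho / (2 * n.+1%:R)); first by rewrite divr_gt0.
  move=> z e rz qz e0.
  have e'0 : 0 < n.+1%:R * e by rewrite mulr_gt0// ltr0n.
  have ni : 0 <= 2 * n.+1%:R :> R by rewrite ltW.
  have [||x [px qx]] := hD (z0 + (2 * n.+1%:R)%:C *: z) _ _ _ e'0.
  - exact (lsubspaceD sr rz0 (lsubspaceZ _ sr rz)).
  - by rewrite addrC addKr (snZr cq.1)// mulrC -ltr_pdivlMr.
  have [||y [py qy]] := hD z0 _ _ _ e'0 => //.
    by rewrite subrr (sn0 cq.1).
  have ii : 0 <= (2 * n.+1%:R)^-1 :> R by rewrite invr_ge0.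
  exists ((2 * n.+1%:R)^-1%:C *: (x - y)); split.
    rewrite (snZr cp.1)// ltr_pdivrMl// mulr1.
    by apply: le_lt_trans (snB cp.1 _ _) _; lra.
  have -> : z - f ((2 * n.+1%:R)^-1%:C *: (x - y)) = (2 * n.+1%:R)^-1%:C *:
      ((z0 + (2 * n.+1%:R)%:C *: z - f x) - (z0 - f y)).
    have -> : z0 + (2 * n.+1%:R)%:C *: z - f x - (z0 - f y) =
        (2 * n.+1%:R)%:C *: z - f (x - y).
      rewrite (linB cf.1) !opprB [LHS]addrC addrA subrKA [f y + _]addrC.
      by rewrite -addrA.
    have ee : (2 * n.+1%:R)^-1%:C * (2 * n.+1%:R)%:C = 1 :> C.
      by rewrite -[LHS](rmorphM (real_complex R)) mulVf ?gt_eqF.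
    by rewrite [RHS]scalerBr scalerA ee scale1r (linZ cf.1).
  rewrite (snZr cq.1)// ltr_pdivrMl//.
  by apply: le_lt_trans (snB cq.1 _ _) _; lra.
exfalso.
have step (nzr : nat * (F * R)) : exists zr : F * R,
    0 < nzr.2.2 -> range f nzr.2.1 ->
    [/\ 0 < zr.2, zr.2 <= nzr.2.2 / 2, range f zr.1,
        q (zr.1 - nzr.2.1) < nzr.2.2 / 2 &
    forall x, p x < nzr.1.+1%:R -> zr.2 < q (zr.1 - f x)].
  case: nzr => n [z0 rho] /=.
  have [[rho0 rz0]|h] := pselect (0 < rho /\ range f z0); last first.
    by exists (0, 0) => h1 h2; exfalso; apply: h.
  have r2 : 0 < rho / 2 by rewrite divr_gt0.
  have [z [rz zz nDz]] : exists z, [/\ range f z, q (z - z0) < rho / 2 & ~ D n z].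
    apply: contrapT => h; apply: nD; exists n, z0, (rho / 2); split=> // z rz zz.
    by apply: contrapT => nDz; apply: h; exists z.
  have [e e0 he] : exists2 e : R, 0 < e & forall x, p x < n.+1%:R -> e <= q (z - f x).
    apply: contrapT => h; apply: nDz => e e0; apply: contrapT => h'.
    apply: h; exists e => // x px; rewrite leNgt; apply/negP => qe.
    by apply: h'; exists x.
  (* Half of [rho] keeps the new ball inside the old one; half of [e] keeps even the closed new ball
     off the image of the ball of radius [n.+1]. *)
  exists (z, Num.min (rho / 2) (e / 2)) => _ _; split=> //=.
  - by rewrite lt_min r2 divr_gt0.
  - by rewrite ge_min lexx.
  - move=> x /he h; rewrite gt_min; apply/orP; right; lra.
have [g hg] := choice step.
pose s := fix s n := if n is m.+1 then g (m, s m) else (0 : F, 1 : R).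
have inv n : 0 < (s n).2 /\ range f (s n).1.
  elim: n => [|n [r0 rz]]; first by split=> //=; exact: sr.1.
  by have [] := hg (n, s n) r0 rz.
have rhole n : (s n).2 <= 1 * 2^-1 ^+ n.
  elim: n => [|n IH]; first by rewrite expr0 mulr1.
  have [_ + _ _ _] := hg (n, s n) (inv n).1 (inv n).2.
  by rewrite /= exprSr; lra.
have [|||z hz] := sequence_limit bF.1 nq (u := fun n => (s n).1)
    (rho := fun n => (s n).2).
- by move=> n; exact: ltW (inv n).1.
- by move=> e e0; have [n hn] := exp_half_small 1 e0; exists n; exact: le_lt_trans hn.
- move=> n; have [_ h1 _ h2 _] := hg (n, s n) (inv n).1 (inv n).2.
  by move: h1 h2; rewrite /=; lra.
have [x _ fx] : range f z.
  apply: rf; apply/closure_cseminorm => r cr; have [c c0 rc] := qq r cr.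
  have [n hn] := exp_half_small 1 (ltac:(by rewrite invr_gt0) : 0 < c^-1).
  exists (s n).1; first exact: (inv n).2.
  apply: le_lt_trans (rc _) _; rewrite -ltr_pdivlMl// mulr1.
  rewrite (snBC cq.1); apply: le_lt_trans (hz n) _.
  exact: le_lt_trans (rhole n) hn.
have [n pn] : exists n, p x < n.+1%:R.
  exists (Num.truncn (p x)); exact: truncnS_gt.
have [_ _ _ _ /(_ x pn)] := hg (n, s n) (inv n).1 (inv n).2.
have := hz n.+1; rewrite -fx (snBC cq.1) /=.
by move=> /le_lt_trans /[apply]; rewrite ltxx.
Qed.

Lemma open_mapping : open_onto_image f.
Proof.
have [cE [p np]] := (banach_spaceP E).1 bE.
have [cF [q nq]] := (banach_spaceP F).1 bF.
have [d d0 hd] := baire_almost_open np nq.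
have [cp pq] := np; have [cq qq] := nq.
have sr : linear_subspace (range f) by apply: image_lsubspace; [exact: cf.1|].
move=> r cr; have [c c0 rc] := pq r cr.
(* Lifting costs a factor 2 in norm; 3 instead of 2 keeps the final inequality strict. *)
have k0 : 0 < d / (3 * c) by rewrite divr_gt0// mulr_gt0.
exists (fun z => (d / (3 * c))^-1 * q z).
  by apply: cseminorm_scale cq; rewrite invr_ge0 ltW.
move=> x e e0; rewrite ltr_pdivrMl// => qx.
have ei : 0 <= (e / (3 * c))^-1 by rewrite invr_ge0 divr_ge0 ?mulr_ge0 ?ltW.
have ec : 0 < e / (3 * c) by rewrite divr_gt0// mulr_gt0.
have [||w [pw fw]] := almost_open_surjective cE np cF.1 nq cf sr
    (@subset_refl _ _) d0 hd (z := (e / (3 * c))^-1%:C *: f x) => //.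
- by apply: (lsubspaceZ _ sr); exists x.
- rewrite (snZr cq.1)// ltr_pdivrMl//; apply: lt_le_trans qx _.
  by rewrite [leRHS]mulrAC [e * d]mulrC [leRHS]mulrAC.
exists ((e / (3 * c))%:C *: w).
  by rewrite (linZ cf.1) fw scalerA -rmorphM mulfV ?gt_eqF// scale1r.
apply: le_lt_trans (rc _) _; rewrite (snZr cp.1) ?(ltW ec)//.
have := ler_wpM2l (ltW ec) pw.
have := mulfV (lt0r_neq0 c0).
have -> : e / (3 * c) = e * c^-1 / 3 by rewrite invfM mulrA mulrAC.
move=> cc h; have := ler_wpM2l (ltW c0) h.
have -> : c * (e * c^-1 / 3 * 2) = e * (2 / 3) * (c * c^-1) by field; rewrite gt_eqF.
by rewrite cc mulr1; lra.
Qed.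

End OpenMapping.

Lemma completed_quotient_banach (E : tvsType C) (N : set E) (F : tvsType C)
    (k : E -> F) : linear_subspace N -> banach_space E ->
  completed_quotient N k -> banach_space F.
Proof.
move=> sN /banach_spaceP[cE [p [cp pq]]] cq; apply/banach_spaceP.
split; first exact: completed_quotient_complete cq.
have lk := completed_quotient_linear cq.
have [r cr rp] := completed_quotient_bound sN cq cp.
exists r; split=> // s cs; have [c c0 sc] := pq _ (cseminorm_comp lk cs).
have hk x : s (k x) <= c * r (k x).
  apply/ler_addgt0Pr => e e0; have ec : 0 < e / c by rewrite divr_gt0.
  have re : r (k x) < r (k x) + e / c by rewrite ltrDl.
  have [n Nn pn] := rp x _ (le_lt_trans (sn_ge0 cr.1 _) re) re.
  have -> : k x = k (x - n).
    by rewrite (linB lk.1) (completed_quotient_ker cq Nn) subr0.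
  apply: le_trans (sc _) _; rewrite -[leRHS]mulr1.
  have -> : (c * r (k (x - n)) + e) * 1 = c * (r (k x) + e / c).
    rewrite (linB lk.1) (completed_quotient_ker cq Nn) subr0 mulr1 mulrDr.
    by rewrite mulrCA mulfV ?mulr1// gt_eqF.
  by rewrite ler_wpM2l ?(ltW c0)// ltW.
exists c => // z; rewrite -subr_le0; apply: (@le0_small _ _ (c + 1)) => e e0.
have c2 := cseminormD cs cr.
have dk := (dense_closure _).1 (completed_quotient_dense cq) z.
have [_ [x _ <-] h] := closure_cseminorm_lt dk c2 e0.
have s0 := sn_ge0 cs.1 (k x - z); have r0 := sn_ge0 cr.1 (k x - z).
have h1 := sn_le_sub cs.1 z (k x); have h2 := sn_le_sub cr.1 (k x) z.
rewrite (snBC cs.1 z) in h1.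
have h3 : c * r (k x) <= c * (r z + e) by rewrite ler_wpM2l ?(ltW c0)//; lra.
by have := hk x; lra.
Qed.

(** The open mapping theorem applies to [i] because its range is a kernel, hence closed. *)
Lemma exact_pair_banach_lcs (E1 E2 E3 : tvsType C) (i : E1 -> E2) (p : E2 -> E3) :
  exact_pair_banach i p -> exact_pair_lcs i p.
Proof.
move=> [b1 b2 b3 ci cp ii ri rp]; split=> //.
- apply/(open_onto_imageP ci.1)/open_mapping => // z.
  rewrite ri => pz /=.
  have h3 := b3.1.1; apply: continuous_linear_closed_eq0 h3 cp _ pz.
  by [].
- by apply/(open_onto_imageP cp.1)/open_mapping => // z; rewrite rp.
- by rewrite rp; apply/dense_closure => z; exact: subset_closure.
Qed.

(** A map that is open onto a dense subspace is almost open into the whole space, and successive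
    corrections then make it surjective. *)
Lemma exact_pair_lcs_banach (E1 E2 E3 : tvsType C) (i : E1 -> E2) (p : E2 -> E3) :
  banach_space E1 -> banach_space E2 -> banach_space E3 ->
  exact_pair_lcs i p -> exact_pair_banach i p.
Proof.
move=> b1 b2 b3 [ci cp ii ri _ po pd]; split=> //.
have [cE [r nr]] := (banach_spaceP E2).1 b2.
have [cF [q nq]] := (banach_spaceP E3).1 b3.
have [cr _] := nr; have [cq qq] := nq.
have [s cs sr] := (open_onto_imageP cp.1).1 po r cr.
have [c c0 sc] := qq s cs.
have sT : linear_subspace [set: E3] by [].
have ao z e : [set: E3] z -> q z < c^-1 -> 0 < e ->
    exists x, r x < 1 /\ q (z - p x) < e.
  move=> _ qz e0; have d0 : 0 < c^-1 - q z by rewrite subr_gt0.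
  have m0 : 0 < Num.min e (c^-1 - q z) by rewrite lt_min e0.
  have [_ [x _ <-]] := closure_cseminorm_lt ((dense_closure _).1 pd z) cq m0.
  rewrite lt_min => /andP[h1 h2].
  have [||w pw rw] := sr x 1 => //.
    apply: le_lt_trans (sc _) _; rewrite -ltr_pdivlMl// mulr1.
    by have := sn_le_sub cq.1 (p x) z; lra.
  by exists w; split=> //; rewrite pw (snBC cq.1).
apply/seteqP; split=> // z _.
have qz1 : 0 < q z + 1 by rewrite ltr_wpDl ?(sn_ge0 cq.1).
pose a : R := c * (q z + 1); have a0 : 0 < a by rewrite mulr_gt0.
have ci0 : 0 < c^-1 by rewrite invr_gt0.
have [|x [_ px]] := almost_open_surjective cE nr cF.1 nq cp sT
    (fun _ _ => I) ci0 ao (z := a^-1%:C *: z) I.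
  rewrite (snZr cq.1) ?invr_ge0 ?(ltW a0)// ltr_pdivrMl// /a mulrAC mulfV ?gt_eqF//.
  by rewrite mul1r ltrDl.
exists (a%:C *: x) => //; rewrite (linZ cp.1) px scalerA -rmorphM.
by rewrite mulfV ?gt_eqF// scale1r.
Qed.

End BanachSpaces.

Section BanachFlatness.
Variables (R : realType) (A : arens_michael_algebra R[i]).
Local Notation C := R[i].
Variables (I : set (A * C^o)) (X : left_module A) (pi : A * C^o -> X).
Hypotheses (hI : closed_left_ideal I) (hX : cyclic_module I pi).

Lemma approximate_identity_banach_flat : right_locally_bounded_ai I ->
  tensor_takes X (@exact_pair_banach_modules _ A) (@exact_pair_banach C).
Proof.
move=> hai Y1 Y2 Y3 i p [hi hp bp] T1 T2 T3 i' p' ti tp.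
have bT (Y : right_module A) (T : module_tensor Y X) :
    banach_space Y -> banach_space T.
  by move=> bY; apply: completed_quotient_banach bY (tensor_gen_quotient hI hX T);
     exact: smallest_lsubspace.
have [b1 b2 b3 _ _ _ _ _] := bp.
apply: exact_pair_lcs_banach; [exact: bT|exact: bT|exact: bT|].
apply: (approximate_identity_flat hI hX hai _ ti tp).
by split=> //; exact: exact_pair_banach_lcs.
Qed.

End BanachFlatness.

(** * The dual sequence of a weakly complemented ideal *)

Section NormedSpaces.
Variable R : realType.
Local Notation C := R[i].

Definition rnorm (B : normedModType C) (x : B) : R := Re `|x|.

Lemma rnormE (B : normedModType C) (x : B) : `|x| = (rnorm x)%:C.
Proof. by have [y _ e] := ge0_complexE (normr_ge0 x); rewrite /rnorm e. Qed.

Lemma rnorm_seminorm (B : normedModType C) : rseminorm (@rnorm B).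
Proof.
split=> [x y|a x].
  by have := ler_normD x y; rewrite !rnormE -rmorphD lecR.
have : `|a *: x| = (normc a)%:C * `|x| by rewrite normrZ.
by rewrite !rnormE -rmorphM => -[].
Qed.

Lemma rnorm_norming (B : normedModType C) : norming (@rnorm B).
Proof.
have cr : cseminorm (@rnorm B).
  split; first exact: rnorm_seminorm.
  apply/nbhs_normP; exists 1 => //= x /=; rewrite sub0r normrN rnormE.
  by rewrite ltcR.
split=> // q [sq /nbhs_normP[e /= /gt0_complexE[t t0 ->] tq]].
exists t^-1; first by rewrite invr_gt0.
move=> x; apply/ler_addgt0Pr => e' e'0.
have k0 : 0 < rnorm x + t * e'.
  by rewrite ltr_wpDl ?(sn_ge0 cr.1)// mulr_gt0.
have ki : 0 <= t / (rnorm x + t * e') by rewrite divr_ge0 ?ltW.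
have -> : t^-1 * rnorm x + e' = t^-1 * (rnorm x + t * e').
  by rewrite mulrDr mulrA mulVf ?mul1r// gt_eqF.
have := tq ((t / (rnorm x + t * e'))%:C *: x).
rewrite /= (snZr sq)// => hx; rewrite -ler_pdivrMl ?invr_gt0// invrK.
rewrite -[leRHS]mulr1 -ler_pdivrMl// mulrA [_^-1 * t]mulrC; apply/ltW/hx.
rewrite sub0r normrN rnormE (snZr cr.1)// ltcR mulrAC ltr_pdivrMr//.
by rewrite ltr_pM2l// ltrDl mulr_gt0.
Qed.

Lemma normc_norming : norming (fun z : C^o => normc z).
Proof.
split.
  split; first exact: rseminorm_normc.
  by apply/nbhs0_normc; exists 1.
move=> q [sq nq]; exists (q 1 + 1); first by rewrite ltr_wpDl ?(sn_ge0 sq).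
move=> z; have -> : z = z *: (1 : C^o) by rewrite /GRing.scale /= mulr1.
rewrite (snZ sq) mulrC /GRing.scale /= mulr1.
by rewrite ler_wpM2r ?normc_ge0// lerDl.
Qed.

Lemma dual_bounded (B : normedModType C) (f : B -> C^o) : dual f <->
  linear f /\ exists2 c, 0 < c & forall x, normc (f x) <= c * rnorm x.
Proof.
split=> [[lf cf]|[lf [c c0 fc]]].
  split=> //; apply: (rnorm_norming B).2.
  exact: (cseminorm_comp (conj lf cf) normc_norming.1).
have [] // : continuous_linear f.
apply: linear_continuous_cseminorm => // q cq.
have [k k0 qk] := normc_norming.2 q cq.
exists (fun x => k * c * rnorm x).
  by apply: cseminorm_scale (rnorm_norming B).1; rewrite mulr_ge0 ?ltW.
move=> x; apply: le_trans (qk _) _; by rewrite -mulrA ler_wpM2l ?(ltW k0).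
Qed.

Lemma dual_norm_leE (B : normedModType C) (f : B -> C^o) (c : R) :
  dual_norm_le f c%:C <-> forall x, normc (f x) <= c * rnorm x.
Proof.
have e x : (`|f x| <= c%:C * `|x|) = (normc (f x) <= c * rnorm x).
  by rewrite rnormE -rmorphM -lecR.
by split=> h x; have := h x; rewrite e.
Qed.

End NormedSpaces.

(** * Duals, annihilators and duals of subspaces as Banach spaces *)

Section PartialDual.
Variables (R : realType) (B : normedModType R[i]).
Local Notation C := R[i].

Let sn := rnorm_seminorm B.

(* Bounded linear functionals on the subspace [S], extended by [0] outside of
   [S], which vanish on [Z].  This covers B^*, the annihilator and J^*. *)
Definition pdual (S Z : set B) : set (B -> C^o) :=
  [set f | [/\ forall x, ~ S x -> f x = 0,
    forall a x y, S x -> S y -> f (a *: x + y) = a *: f x + f y,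
    forall x, Z x -> f x = 0 &
    exists2 c, 0 < c & forall x, normc (f x) <= c * rnorm x]].

(** All integer radii, so that the balls cover [B] as [fd_cover] requires; radius 1 gives the dual
    norm. *)
Definition pd_ball (n : nat) : set B := [set x | rnorm x <= n%:R].

Let pd_cover (x : B) : exists n, pd_ball n x.
Proof.
exists (Num.truncn (rnorm x)).+1; rewrite /pd_ball /= ltW//.
exact: truncnS_gt.
Qed.

Section Space.
Variables (S Z : set B).
Hypothesis sS : linear_subspace S.

Let pd_subspace : linear_subspace (pdual S Z).
Proof.
split.
  split=> //; first by move=> *; rewrite scaler0 addr0.
  by exists 1 => // x; rewrite normc0 mul1r (sn_ge0 sn).
move=> a f g [f1 f2 f3 [c c0 f4]] [g1 g2 g3 [d d0 g4]].
have e x : (a *: f + g) x = a *: f x + g x by [].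
split.
- by move=> x Sx; rewrite e f1// g1// scaler0 addr0.
- move=> b x y Sx Sy; rewrite !e f2// g2// !scalerDr addrACA; congr (_ + _).
  by rewrite scalerA mulrC -scalerA.
- by move=> x Zx; rewrite e f3// g3// scaler0 addr0.
exists (normc a * c + d); first by rewrite ltr_wpDl ?mulr_ge0 ?normc_ge0 ?ltW.
move=> x; rewrite e; apply: le_trans (normcD _ _) _.
rewrite mulrDl lerD// normcM -mulrA ler_wpM2l ?normc_ge0//.
Qed.

Let pd_bounded f n : pdual S Z f ->
  exists b, forall x, pd_ball n x -> normc (f x) <= b.
Proof.
move=> [_ _ _ [c c0 fc]]; exists (c * n%:R) => x xn.
by apply: le_trans (fc x) _; rewrite ler_wpM2l ?(ltW c0).
Qed.

Definition pd_data : fdata R := FData pd_cover pd_subspace pd_bounded.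
Definition pd_space : tvsType C := fs_lcs pd_data.
Definition pd_fun (f : pd_space) : B -> C^o := fs_of f.

Lemma pd_fun_inj (f g : pd_space) :
  (forall x, pd_fun f x = pd_fun g x) -> f = g.
Proof. by move=> h; apply: fspace_ext => x; exact: h. Qed.

(** The conditions in [pdual] survive uniform limits on balls, so the closure adds nothing and every
    element of [pd_space] is itself such a functional. *)
Lemma pd_funP (f : pd_space) : pdual S Z (pd_fun f).
Proof.
have cf := fspace_closure (fs_of f); rewrite -/(pd_fun f) in cf.
have approx (x y w : B) e : 0 < e -> exists2 g, pdual S Z g &
    [/\ normc (g x - pd_fun f x) <= e, normc (g y - pd_fun f y) <= e &
     normc (g w - pd_fun f w) <= e].
  move=> e0; have [n1 h1] := pd_cover x; have [n2 h2] := pd_cover y.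
  have [n3 h3] := pd_cover w.
  have [g Wg gf] := cf [:: n1; n2; n3] e e0; exists g => //.
  by split; [apply: gf h1|apply: gf h2|apply: gf h3] => /=; auto.
have lin a x y : S x -> S y ->
    pd_fun f (a *: x + y) = a *: pd_fun f x + pd_fun f y.
  move=> Sx Sy; apply/eqP; rewrite -subr_eq0; apply/eqP/normc_eq0/le_anti.
  rewrite normc_ge0 andbT; apply: (@le0_small _ _ (normc a + 2)) => e e0.
  have [g [_ g2 _ _] [h1 h2 h3]] := approx x y (a *: x + y) e e0.
  have -> : pd_fun f (a *: x + y) - (a *: pd_fun f x + pd_fun f y) =
      a * (g x - pd_fun f x) + ((g y - pd_fun f y) -
      (g (a *: x + y) - pd_fun f (a *: x + y))).
    by rewrite g2// /GRing.scale /=; ring.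
  apply: le_trans (normcD _ _) _; rewrite normcM mulrDl lerD//.
    by rewrite ler_wpM2l ?normc_ge0.
  apply: le_trans (normcD _ _) _; rewrite normcN; lra.
have van x : (forall g, pdual S Z g -> g x = 0) -> pd_fun f x = 0.
  move=> h; apply/normc_eq0/le_anti; rewrite normc_ge0 andbT.
  apply: (@le0_small _ _ 1) => e e0; rewrite mul1r.
  by have [g Wg [h1 _ _]] := approx x x x e e0; rewrite h// sub0r normcN in h1.
split=> //.
- by move=> x nSx; apply: van => g [g1 _ _ _]; exact: g1.
- by move=> x Zx; apply: van => g [_ _ g3 _]; exact: g3.
have [g [_ _ _ [c c0 gc]] gf] := cf [:: 1%N] 1 ltr01.
(* [g] has bound [c] and is within 1 of [f] on the unit ball. *)
exists (c + 1); first by rewrite addr_gt0.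
move=> x; have [Sx|nSx] := pselect (S x); last first.
  rewrite van; last by move=> h [h1 _ _ _]; exact: h1.
  by rewrite normc0 mulr_ge0 ?(sn_ge0 sn) ?addr_ge0 ?ltW.
rewrite -subr_le0; apply: (@le0_small _ _ (c + 1)) => e e0.
have t0 : 0 < rnorm x + e by rewrite ltr_wpDl ?(sn_ge0 sn).
have ti : 0 <= (rnorm x + e)^-1 by rewrite invr_ge0 ltW.
have xt : pd_ball 1 ((rnorm x + e)^-1%:C *: x).
  by rewrite /pd_ball /= (snZr sn)// ler_pdivrMl// mulr1 lerDl ltW.
have h0 : pd_fun f 0 = 0.
  have := lin (-1) 0 0 sS.1 sS.1; rewrite scaler0 addr0 scaleN1r addNr.
  exact.
have := gf 1%N _ (or_introl erefl) xt; have := gc ((rnorm x + e)^-1%:C *: x).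
have -> : pd_fun f ((rnorm x + e)^-1%:C *: x) = (rnorm x + e)^-1%:C * pd_fun f x.
  by have := lin (rnorm x + e)^-1%:C x 0 Sx sS.1; rewrite addr0 h0 addr0.
set y := _ *: x => h1 h2.
have : normc ((rnorm x + e)^-1%:C * pd_fun f x) <= c + 1.
  have ny : rnorm y <= 1 by [].
  have := ler_wpM2l (ltW c0) ny; rewrite mulr1 => h3.
  have := normcD (g y - (rnorm x + e)^-1%:C * pd_fun f x) (- g y).
  rewrite addrAC subrr add0r !normcN; lra.
rewrite normcM normc_real ger0_norm// ler_pdivrMl// => h3.
by move: h3; rewrite mulrC; lra.
Qed.

Definition pd_mk (f : B -> C^o) (pf : pdual S Z f) : pd_space :=
  FSpace (introT (asboolP _) (@fd_dense_closure R pd_data f pf)).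

Definition pd_norm : pd_space -> R := @fs_norm R pd_data 1%N.

Lemma pd_norm_seminorm : rseminorm pd_norm.
Proof. exact: (fs_cseminorm (d := pd_data) 1%N).1. Qed.

Lemma pd_norm_le (f : pd_space) c : 0 <= c ->
  (forall x, normc (pd_fun f x) <= c * rnorm x) -> pd_norm f <= c.
Proof.
move=> c0 fc; apply: fs_norm_le => // x x1; apply: le_trans (fc x) _.
by rewrite -[leRHS]mulr1 ler_wpM2l.
Qed.

Lemma pd_fun0 (f : pd_space) : pd_fun f 0 = 0.
Proof.
have [_ lin _ _] := pd_funP f.
by have := lin (-1) 0 0 sS.1 sS.1; rewrite scaler0 addr0 scaleN1r addNr.
Qed.

Lemma pd_norm_eval (f : pd_space) x : normc (pd_fun f x) <= pd_norm f * rnorm x.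
Proof.
have n0 := sn_ge0 pd_norm_seminorm f.
have [f1 lin _ _] := pd_funP f.
have [Sx|nSx] := pselect (S x); last first.
  by rewrite f1// normc0 mulr_ge0 ?(sn_ge0 sn).
rewrite -subr_le0; apply: (@le0_small _ _ (pd_norm f)) => e e0.
have t0 : 0 < rnorm x + e by rewrite ltr_wpDl ?(sn_ge0 sn).
have ti : 0 <= (rnorm x + e)^-1 by rewrite invr_ge0 ltW.
have xt : pd_ball 1 ((rnorm x + e)^-1%:C *: x).
  by rewrite /pd_ball /= (snZr sn)// ler_pdivrMl// mulr1 lerDl ltW.
have := @fs_norm_eval R pd_data 1%N (fs_of f) _ xt; rewrite -/(pd_fun f).
have := lin (rnorm x + e)^-1%:C x 0 Sx sS.1; rewrite addr0 pd_fun0 addr0 => ->.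
rewrite normcM normc_real ger0_norm// ler_pdivrMl// mulrC /pd_norm.
by rewrite -[fs_norm _ _]/(pd_norm f); lra.
Qed.

Lemma pd_norm_norming : norming pd_norm.
Proof.
split; first exact: (fs_cseminorm (d := pd_data)).
move=> q /fs_dominated[s [c [c0 qc]]].
exists (c * (\sum_(n <- s) n)%:R + 1); first by rewrite ltr_wpDl ?mulr_ge0.
move=> f; have n0 := sn_ge0 pd_norm_seminorm f.
apply: (@le_trans _ _ (c * (\sum_(n <- s) n)%:R * pd_norm f)); last first.
  by rewrite ler_wpM2r// lerDl.
rewrite -mulrA; apply: qc; first exact: mulr_ge0.
move=> n x ns xn; apply: le_trans (pd_norm_eval f x) _.
rewrite mulrC ler_wpM2r//; apply: le_trans xn _; rewrite ler_nat.
elim: s ns => // m s IH [->|ns]; rewrite big_cons ?leq_addr//.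
by apply: leq_trans (IH ns) _; rewrite leq_addl.
Qed.

Lemma pd_banach : banach_space pd_space.
Proof.
apply/banach_spaceP; split; first exact: fs_complete.
by exists pd_norm; exact: pd_norm_norming.
Qed.

End Space.

Lemma pd_continuous_linear S Z S' Z' (sS : linear_subspace S)
    (sS' : linear_subspace S') (f : pd_space S Z -> pd_space S' Z') (c : R) :
  0 <= c -> linear f ->
  (forall g x, normc (pd_fun (f g) x) <= c * pd_norm g * rnorm x) ->
  continuous_linear f.
Proof.
move=> c0 lf fc; apply: linear_continuous_cseminorm => // q cq.
have [k k0 qk] := (pd_norm_norming Z' sS').2 q cq.
have cn := (pd_norm_norming Z sS).1.
exists (fun g => k * c * pd_norm g).
  by apply: cseminorm_scale cn; rewrite mulr_ge0 ?(ltW k0).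
move=> g; apply: le_trans (qk _) _; rewrite -mulrA ler_wpM2l ?(ltW k0)//.
by apply: pd_norm_le => //; rewrite mulr_ge0// (sn_ge0 cn.1).
Qed.

End PartialDual.

Section FunctionalModules.
Variables (R : realType) (A : arens_michael_algebra R[i]).
Local Notation C := R[i].
Variables (B : normedModType C) (L : A -> B -> B).
Hypotheses (Lbilin : bilinear_for *:%R *:%R L)
  (Lmul : forall a b x, L (am_mul a b) x = L a (L b x))
  (Lbound : exists2 q, cseminorm q & forall a x, rnorm (L a x) <= q a * rnorm x).

Let sn := rnorm_seminorm B.
Let Ll x : linear (L^~ x) := bilinear_l Lbilin x.
Let Lr a : linear (L a) := bilinear_r Lbilin a.

Section OneModule.
Variables (S Z : set B).
Hypotheses (sS : linear_subspace S) (LS : forall a x, S x -> S (L a x))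
  (LZ : forall a x, Z x -> Z (L a x)).
Local Notation M := (pd_space S Z).

Lemma pd_ext (f g : M) : (forall x, S x -> pd_fun f x = pd_fun g x) -> f = g.
Proof.
move=> fg; apply: pd_fun_inj => x; have [Sx|nSx] := pselect (S x).
  exact: fg.
have [f1 _ _ _] := pd_funP sS f; have [g1 _ _ _] := pd_funP sS g.
by rewrite f1// g1.
Qed.

(** A point outside [S] may be moved into [S] by [a]; the cut-off restores the value 0 outside
    [S]. *)
Lemma pd_act_subproof (f : M) a :
  pdual S Z (fun x => if `[< S x >] then pd_fun f (L a x) else 0).
Proof.
have [f1 f2 f3 [c c0 fc]] := pd_funP sS f; have [q cq Lq] := Lbound.
have qa := sn_ge0 cq.1 a; split.
- by move=> x nSx; rewrite asboolF.
- move=> b x y Sx Sy; rewrite !asboolT//; last exact: sS.2.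
  by rewrite Lr f2//; exact: LS.
- by move=> x Zx; case: ifP => // _; apply: f3; exact: LZ.
exists (c * (q a + 1)); first by rewrite mulr_gt0// ltr_wpDl.
move=> x; have nx := sn_ge0 sn x; case: ifP => _; last first.
  by rewrite normc0 !mulr_ge0 ?addr_ge0 ?(ltW c0).
apply: le_trans (fc _) _; rewrite -mulrA ler_wpM2l ?(ltW c0)//.
by apply: le_trans (Lq _ _) _; rewrite mulrDl mul1r lerDl.
Qed.

Definition pd_act (f : M) (a : A) : M := pd_mk (pd_act_subproof f a).

Lemma pd_actE f a x : S x -> pd_fun (pd_act f a) x = pd_fun f (L a x).
Proof. by move=> Sx; rewrite /pd_act /pd_fun /= asboolT. Qed.

Lemma pd_funL (b : C) (f g : M) x :
  pd_fun (b *: f + g) x = b * pd_fun f x + pd_fun g x.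
Proof. by []. Qed.

Lemma pd_act_bilinear : continuous_bilinear pd_act.
Proof.
have [q cq Lq] := Lbound.
apply: bilinear_continuous.
  split=> [a b f g|f b a a']; apply: pd_ext => x Sx.
    by rewrite pd_actE// !pd_funL !pd_actE.
  rewrite pd_funL !pd_actE// Ll; have [_ f2 _ _] := pd_funP sS f.
  by rewrite f2//; exact: LS.
move=> r cr; have [k k0 rk] := (pd_norm_norming Z sS).2 r cr.
have cn := (pd_norm_norming Z sS).1.
exists (fun f => k * @pd_norm R B S Z f), q; split=> //.
  exact: cseminorm_scale (ltW k0) cn.
move=> f a; apply: le_trans (rk _) _; rewrite -mulrA ler_wpM2l ?(ltW k0)//.
have n0 := sn_ge0 cn.1 f; have qa := sn_ge0 cq.1 a.
apply: pd_norm_le; first exact: mulr_ge0.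
move=> x; have nx := sn_ge0 sn x; have [Sx|nSx] := pselect (S x); last first.
  have [g1 _ _ _] := pd_funP sS (pd_act f a).
  by rewrite g1// normc0 !mulr_ge0.
rewrite pd_actE//; apply: le_trans (pd_norm_eval sS f _) _.
by rewrite -mulrA ler_wpM2l.
Qed.

Lemma pd_act_mul f a b : pd_act f (am_mul a b) = pd_act (pd_act f a) b.
Proof.
apply: pd_ext => x Sx; rewrite !pd_actE//; last exact: LS.
by rewrite Lmul.
Qed.

Definition pd_module : right_module A :=
  @RightModule C A M pd_act (pd_banach Z sS).1 pd_act_bilinear pd_act_mul.

Lemma pd_actuE (f : pd_module) u x : S x ->
  pd_fun (rm_actu f u : M) x = pd_fun (f : M) (L u.1 x + u.2 *: x).
Proof.
move=> Sx; have [_ f2 _ _] := pd_funP sS (f : M).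
rewrite [L _ _ + _]addrC f2//; last exact: LS.
rewrite -[rm_actu f u]/((pd_act f u.1 : M) + u.2 *: (f : M)) addrC pd_funL.
by rewrite pd_actE.
Qed.

End OneModule.
End FunctionalModules.

Section TensorExistence.
Variables (R : realType) (A : arens_michael_algebra R[i]) (X : left_module A).
Local Notation C := R[i].

(** The conditions of the theorem range over realizations of tensor products; this supplies those to
    which the converse applies them. *)
Lemma module_tensor_exists (Y : right_module A) : inhabited (module_tensor Y X).
Proof.
constructor; apply: (ModuleTensor (projective_tensor_exists Y X)).
by apply: completed_quotient_exists; exact/closure_lsubspace/smallest_lsubspace.
Qed.

Lemma tensor_map_exists (Y Y' : right_module A) (T : module_tensor Y X)
    (T' : module_tensor Y' X) (f : Y -> Y') : right_module_map f ->
  exists g : T -> T', tensor_map f g.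
Proof.
move=> hf; have cT' := completed_quotient_complete (@tensor_quotP _ _ Y' X T').
have bt := tensor_elem_bilinear T'.
have cb : continuous_bilinear (fun y x => tensor_elem T' (f y) x).
  apply: bilinear_continuous.
    split=> [x a y y'|y a x x']; last exact: bt.1.2.
    by rewrite hf.1.1 (bt.1.1 x a).
  move=> r cr; have [p [q [cp cq h]]] := continuous_bilinear_bound bt cr.
  by exists (p \o f), q; split=> //; exact: cseminorm_comp hf.1 cp.
have [g [[cg gb] _]] := projective_tensor_univ (@tensor_fullP _ _ Y X T) cT' cb.
have gN n : balancing (@tensor_pure _ _ Y X T) n -> g n = 0.
  apply: continuous_linear_closed_eq0 => //; first exact: cT'.1.
  move=> z /(_ [set z | g z = 0]); apply; split.
    split; first exact: lin0 cg.1.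
    by move=> a x y /= gx gy; rewrite cg.1 gx gy scaler0 addr0.
  move=> _ [y [a [x ->]]] /=.
  by rewrite (linB cg.1) !gb hf.2 tensor_elem_balanced subrr.
have [h ch hq] := completed_quotient_extend (balancing_lsubspace T)
  (@tensor_quotP _ _ Y X T) cT' cg gN.
by exists h; split=> // y x; rewrite /tensor_elem hq gb.
Qed.

End TensorExistence.

(** * The annihilator sequence of one level and its approximate identity *)

Section CyclicNormed.
Variables (R : realType) (A : arens_michael_algebra R[i]).
Local Notation C := R[i].
Variables (I : set (A * C^o)) (X : left_module A) (pi : A * C^o -> X).
Hypotheses (hI : closed_left_ideal I) (hX : cyclic_module I pi).
(* All that is used of the unitization of [A_l] is that it is a normed left
   [A]-module generated by its identity [e]. *)
Variables (B : normedModType C) (L : A -> B -> B) (e : B).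
Hypotheses (Lbilin : bilinear_for *:%R *:%R L)
  (Lmul : forall a b x, L (am_mul a b) x = L a (L b x))
  (Lbound : exists2 q, cseminorm q & forall a x, rnorm (L a x) <= q a * rnorm x).

Let sn := rnorm_seminorm B.
Let Ll x : linear (L^~ x) := bilinear_l Lbilin x.
Let Lr a : linear (L a) := bilinear_r Lbilin a.

(** The orbit map of [e] under the unitization of A; for the unitization of [A_l] and [e = 1] it is
    the unital extension of the canonical map. *)
Definition cyclic_map (u : A * C^o) : B := L u.1 e + u.2 *: e.
Local Notation sg := cyclic_map.
Definition cyclic_closure : set B := closure (sg @` I).
Local Notation J := cyclic_closure.

Lemma cyclic_map_linear : linear sg.
Proof.
move=> a u v; rewrite /cyclic_map /= Ll scalerDl scalerDr -scalerA.
by rewrite addrACA.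
Qed.

Lemma cyclic_map_mul u v : sg (amu_mul u v) = L u.1 (sg v) + u.2 *: sg v.
Proof.
rewrite /cyclic_map /amu_mul /unitization_mul /= (linD (Lr _)) (linZ (Lr _)).
rewrite !(linD (Ll _)) !(linZ (Ll _)) Lmul scalerDr scalerA -!addrA.
by congr (_ + _); rewrite addrCA.
Qed.

Lemma cyclic_closure_lsubspace : linear_subspace J.
Proof.
apply/closure_lsubspace/image_lsubspace; first exact: cyclic_map_linear.
exact: ideal_subspace hI.
Qed.

Lemma cyclic_closure_act a x : J x -> J (L a x).
Proof.
have cL : continuous_linear (L a).
  apply: linear_continuous_cseminorm; first exact: Lr.
  have [q cq Lq] := Lbound; move=> r cr.
  have [k k0 rk] := (rnorm_norming B).2 r cr.
  exists (fun x => k * q a * rnorm x).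
    apply: cseminorm_scale (rnorm_norming B).1.
    by rewrite mulr_ge0 ?(ltW k0) ?(sn_ge0 cq.1).
  by move=> y; apply: le_trans (rk _) _; rewrite -mulrA ler_wpM2l ?(ltW k0).
apply: continuous_linear_closure cL _ => _ [u Iu <-].
exists (amu_mul (a, 0) u); first exact: ideal_mul hI _ _ Iu.
by rewrite cyclic_map_mul /= scale0r addr0.
Qed.

Lemma cyclic_closure_map u : I u -> J (sg u).
Proof. by move=> Iu; apply: subset_closure; exists u. Qed.

Let sT : linear_subspace [set: B]. Proof. by []. Qed.
Let sJ := cyclic_closure_lsubspace.
Let T_act a x : [set: B] x -> [set: B] (L a x). Proof. by []. Qed.
Let set0_act a x : set0 x -> @set0 B (L a x). Proof. by []. Qed.

Definition annihilator_module : right_module A :=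
  pd_module Lbilin Lmul Lbound sT T_act cyclic_closure_act.
Definition dual_module : right_module A :=
  pd_module Lbilin Lmul Lbound sT T_act set0_act.
Definition ideal_dual_module : right_module A :=
  pd_module Lbilin Lmul Lbound sJ cyclic_closure_act set0_act.

Local Notation Y1 := (pd_space [set: B] J).
Local Notation Y2 := (pd_space [set: B] set0).
Local Notation Y3 := (pd_space J set0).

Lemma pdual_dual (f : B -> C^o) : pdual [set: B] set0 f <-> dual f.
Proof.
split=> [[_ lf _ [c c0 fc]]|/dual_bounded[lf [c c0 fc]]].
  by apply/dual_bounded; split; [move=> a x y; exact: lf|exists c].
split=> //; last by exists c.
  by move=> x nT; exfalso; exact: nT.
by move=> a x y _ _; exact: lf.
Qed.

Lemma pdual_annihilator (f : B -> C^o) : pdual [set: B] J f <-> annihilator J f.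
Proof.
split=> [[f1 lf fJ fc]|[/pdual_dual[f1 lf _ fc] fJ]]; last by [].
by split=> //; apply: (pdual_dual f).1.
Qed.

Lemma pd_fun_dual (f : Y2) : dual (pd_fun f).
Proof. exact: (pdual_dual _).1 (pd_funP sT f). Qed.

Lemma dual_inclusion_subproof (f : Y1) : pdual [set: B] set0 (pd_fun f).
Proof. by have [f1 f2 _ f4] := pd_funP sT f. Qed.

Definition dual_inclusion (f : Y1) : Y2 := pd_mk (dual_inclusion_subproof f).

Lemma dual_restriction_subproof (f : Y2) :
  pdual J set0 (fun x => if `[< J x >] then pd_fun f x else 0).
Proof.
have [f1 f2 _ [c c0 fc]] := pd_funP sT f; split=> //.
- by move=> x nJx; rewrite asboolF.
- by move=> a x y Jx Jy; rewrite !asboolT ?f2//; exact: sJ.2.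
exists c => // x; case: ifP => _; first exact: fc.
by rewrite normc0 mulr_ge0 ?(ltW c0) ?(sn_ge0 sn).
Qed.

Definition dual_restriction (f : Y2) : Y3 := pd_mk (dual_restriction_subproof f).

Lemma dual_restrictionE f x : J x -> pd_fun (dual_restriction f) x = pd_fun f x.
Proof. by move=> Jx; rewrite /dual_restriction /pd_fun /= asboolT. Qed.

Lemma dual_inclusion_map :
  @right_module_map C A annihilator_module dual_module dual_inclusion.
Proof.
split.
  apply: (pd_continuous_linear sT sT (c := 1)) => //.
    by move=> a f g; apply: pd_fun_inj.
  by move=> f x; rewrite mul1r; exact: (pd_norm_eval sT f).
move=> f a; apply: (pd_ext sT) => x _.
rewrite [RHS](pd_actE Lbilin Lbound sT T_act set0_act)//.
exact: (pd_actE Lbilin Lbound sT T_act cyclic_closure_act).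
Qed.

Lemma dual_restriction_map :
  @right_module_map C A dual_module ideal_dual_module dual_restriction.
Proof.
split.
  apply: (pd_continuous_linear sT sJ (c := 1)) => //.
    move=> a f g; apply: (pd_ext sJ) => x Jx.
    by rewrite pd_funL !dual_restrictionE.
  move=> f x; have [Jx|nJx] := pselect (J x).
    by rewrite dual_restrictionE// mul1r; exact: (pd_norm_eval sT f).
  have [f1 _ _ _] := pd_funP sJ (dual_restriction f).
  rewrite f1// normc0 mul1r mulr_ge0 ?(sn_ge0 sn)//.
  exact: sn_ge0 (pd_norm_seminorm _ _) _.
move=> f a; apply: (pd_ext sJ) => x Jx.
rewrite [RHS](pd_actE Lbilin Lbound sJ cyclic_closure_act set0_act)//.
rewrite !dual_restrictionE//; last exact: cyclic_closure_act.
exact: (pd_actE Lbilin Lbound sT T_act set0_act).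
Qed.

Section WeaklyComplemented.
Variables (P : (B -> C^o) -> (B -> C^o)) (m : R).
Hypotheses (Pann : forall f, dual f -> annihilator J (P f))
  (Pid : forall f, annihilator J f -> P f = f)
  (Plin : forall (a : C) f g, dual f -> dual g ->
     forall x, P (fun y => a *: f y + g y) x = a *: P f x + P g x)
  (m0 : 0 <= m)
  (Pm : forall f c, dual f -> dual_norm_le f c -> dual_norm_le (P f) (m%:C * c)).

Definition annihilator_projection (f : Y2) : Y1 :=
  pd_mk ((pdual_annihilator _).2 (Pann (pd_fun_dual f))).

Lemma annihilator_projection_norm f x :
  normc (pd_fun (annihilator_projection f) x) <= m * pd_norm f * rnorm x.
Proof.
have h : dual_norm_le (P (pd_fun f)) (m * pd_norm f)%:C.
  rewrite rmorphM; apply: Pm (pd_fun_dual f) _.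
  exact: (dual_norm_leE _ _).2 (pd_norm_eval sT f).
exact: (dual_norm_leE _ _).1 h x.
Qed.

Lemma annihilator_projection_linear : linear annihilator_projection.
Proof.
move=> a f g; apply: pd_fun_inj => x; rewrite pd_funL.
exact: Plin (pd_fun_dual f) (pd_fun_dual g) x.
Qed.

Lemma ideal_dual_extension (h : Y3) : exists2 f : Y2,
  (forall x, J x -> pd_fun f x = pd_fun h x) &
  forall x, normc (pd_fun f x) <= pd_norm h * rnorm x.
Proof.
have n0 := sn_ge0 (pd_norm_seminorm _ _) h.
have [_ h2 _ _] := pd_funP sJ h.
have [|F [lF Fb Fh]] := hahn_banach_extension (rseminorm_scale n0 sn) sJ h2.
  by move=> x _; exact: (pd_norm_eval sJ h).
have dF : dual F.
  apply/dual_bounded; split=> //; exists (pd_norm h + 1).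
    by rewrite ltr_wpDl.
  by move=> x; apply: le_trans (Fb x) _; rewrite mulrDl mul1r lerDl (sn_ge0 sn).
by exists (pd_mk ((pdual_dual _).2 dF)).
Qed.

Definition ideal_dual_lift (h : Y3) : Y2 := sval (cid2 (ideal_dual_extension h)).

(** The Hahn-Banach lift is a mere choice and need not be linear. Two lifts differ by an element of
    J^perp, which the projection fixes, so subtracting the projection removes the dependence on the
    choice. *)
Definition ideal_dual_section (h : Y3) : Y2 :=
  ideal_dual_lift h - dual_inclusion (annihilator_projection (ideal_dual_lift h)).

Lemma dual_inclusion_linear : linear dual_inclusion.
Proof. exact: dual_inclusion_map.1.1. Qed.

Lemma dual_restriction_linear : linear dual_restriction.
Proof. exact: dual_restriction_map.1.1. Qed.

Lemma projection_inclusion f : annihilator_projection (dual_inclusion f) = f.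
Proof.
apply: pd_fun_inj => x.
have := Pid ((pdual_annihilator _).1 (pd_funP sT f)).
exact: (congr1 (fun g => g x)).
Qed.

Lemma restriction_eq0 f : dual_restriction f = 0 ->
  dual_inclusion (annihilator_projection f) = f.
Proof.
move=> f0; have af : annihilator J (pd_fun f).
  split; first exact: pd_fun_dual.
  by move=> x Jx; rewrite -dual_restrictionE// f0.
apply: pd_fun_inj => x; exact: (congr1 (fun g => g x) (Pid af)).
Qed.

Lemma ideal_dual_section_restriction f :
  ideal_dual_section (dual_restriction f) =
  f - dual_inclusion (annihilator_projection f).
Proof.
rewrite /ideal_dual_section /ideal_dual_lift; case: cid2 => g gf _ /=.
have /restriction_eq0 : dual_restriction (g - f) = 0.
  apply: (pd_ext sJ) => x Jx; rewrite dual_restrictionE//.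
  rewrite -[LHS]/(pd_fun g x - pd_fun f x) gf// dual_restrictionE//.
  exact: subrr.
rewrite (linB annihilator_projection_linear) (linB dual_inclusion_linear).
move=> h; apply: (addIr (dual_inclusion (annihilator_projection g) - f)).
by rewrite subrKA [RHS]addrC subrKA h.
Qed.

Lemma dual_restriction_lift h : dual_restriction (ideal_dual_lift h) = h.
Proof.
rewrite /ideal_dual_lift; case: cid2 => g gf _ /=.
by apply: (pd_ext sJ) => x Jx; rewrite dual_restrictionE// gf.
Qed.

Lemma dual_restriction_section h : dual_restriction (ideal_dual_section h) = h.
Proof.
apply: (pd_ext sJ) => x Jx; rewrite dual_restrictionE//.
rewrite -[in RHS](dual_restriction_lift h) dual_restrictionE//.
have [_ _ van _] := pd_funP sT (annihilator_projection (ideal_dual_lift h)).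
rewrite -[LHS]/(pd_fun (ideal_dual_lift h) x -
  pd_fun (annihilator_projection (ideal_dual_lift h)) x).
by rewrite van// subr0.
Qed.

(** Every [h] is a restriction, and on the restriction of [f] the section is [f] minus its
    projection, which is linear in [f]. *)
Lemma ideal_dual_section_linear : linear ideal_dual_section.
Proof.
move=> a h h'; rewrite -{1}(dual_restriction_lift h).
rewrite -{1}(dual_restriction_lift h') -dual_restriction_linear.
rewrite ideal_dual_section_restriction annihilator_projection_linear.
by rewrite dual_inclusion_linear opprD addrACA -scalerBr.
Qed.

Lemma ideal_dual_section_norm h x :
  normc (pd_fun (ideal_dual_section h) x) <= (1 + m) * pd_norm h * rnorm x.
Proof.
have n0 := sn_ge0 (pd_norm_seminorm _ _) h; have nx := sn_ge0 sn x.
rewrite -[pd_fun _ x]/(pd_fun (ideal_dual_lift h) x -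
  pd_fun (annihilator_projection (ideal_dual_lift h)) x).
have bl y : normc (pd_fun (ideal_dual_lift h) y) <= pd_norm h * rnorm y.
  by rewrite /ideal_dual_lift; case: cid2 => g _ gb /=; exact: gb.
have nl : pd_norm (ideal_dual_lift h) <= pd_norm h by exact: pd_norm_le.
apply: le_trans (normcD _ _) _; rewrite normcN -mulrA mulrDl mul1r.
rewrite lerD//; apply: le_trans (annihilator_projection_norm _ _) _.
by rewrite -mulrA ler_wpM2l// ler_wpM2r.
Qed.

Lemma dual_sequence_splits :
  @splits C annihilator_module dual_module ideal_dual_module
    dual_inclusion dual_restriction.
Proof.
exists annihilator_projection, ideal_dual_section; split.
- apply: (pd_continuous_linear sT sT m0); first exact: annihilator_projection_linear.
  exact: annihilator_projection_norm.
- apply: (pd_continuous_linear sJ sT (c := 1 + m)).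
  + by rewrite addr_ge0.
  + exact: ideal_dual_section_linear.
  + exact: ideal_dual_section_norm.
- exact: projection_inclusion.
- exact: dual_restriction_section.
- by move=> f; rewrite ideal_dual_section_restriction addrC subrK.
Qed.

Lemma dual_sequence_exact :
  @exact_pair_banach_modules C A annihilator_module dual_module
    ideal_dual_module dual_inclusion dual_restriction.
Proof.
split; [exact: dual_inclusion_map|exact: dual_restriction_map|].
split.
- exact: (pd_banach _ sT).
- exact: (pd_banach _ sT).
- exact: (pd_banach _ sJ).
- exact: dual_inclusion_map.1.
- exact: dual_restriction_map.1.
- by move=> f g /(congr1 annihilator_projection); rewrite !projection_inclusion.
- apply/seteqP; split=> [_ [f _ <-] /=|f /= /restriction_eq0 <-]; last first.
    by exists (annihilator_projection f).
  apply: (pd_ext sJ) => x Jx; rewrite dual_restrictionE//.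
  by have [_ _ van _] := pd_funP sT f; exact: van.
- by apply/seteqP; split=> // h _; exists (ideal_dual_section h) => //;
    exact: dual_restriction_section.
Qed.

Section ApproximateIdentity.
Variables (T1 : module_tensor annihilator_module X)
  (T2 : module_tensor dual_module X) (i' : T1 -> T2).
Hypotheses
  (ti : tensor_map (dual_inclusion : annihilator_module -> dual_module) i')
  (emb : seminorm_embedding i').

(* The evaluation at [e] vanishes on [J^\perp . I], hence it factors through
   J^\perp (x)_A X, which embeds into B^* (x)_A X. *)
Lemma evaluation_bound : exists2 k : R, 0 < k &
  forall (f : Y1) (g : dual_module), ideal_span I g ->
    normc (pd_fun f e) <= k * pd_norm (dual_inclusion f - (g : Y2)).
Proof.
have cq1 := tensor_gen_quotient hI hX T1.
have cq2 := tensor_gen_quotient hI hX T2.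
have lk2 := completed_quotient_linear cq2.
pose r0 (f : annihilator_module) := normc (pd_fun (f : Y1) e).
have cr0 : cseminorm r0.
  apply: (@cseminorm_le _ annihilator_module (fun f => rnorm e * pd_norm (f : Y1))).
  - by split=> [f g|a f]; [exact: normcD|exact: normcM].
  - apply: cseminorm_scale; first exact: (sn_ge0 sn).
    exact: (pd_norm_norming _ sT).1.
  - by move=> f; rewrite mulrC; exact: (pd_norm_eval sT).
have r0N (n : annihilator_module) : ideal_span I n -> r0 n = 0.
  move=> /(_ [set f | r0 f = 0]); apply; split.
    split; first exact: (sn0 cr0.1).
    move=> a f g /= hf hg; apply/le_anti; rewrite (sn_ge0 cr0.1) andbT.
    apply: le_trans (sn_add cr0.1 _ _) _.
    by rewrite (snZ cr0.1) hf hg mulr0 addr0.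
  move=> _ [f [u [Iu ->]]]; rewrite /= /r0.
  (* The value of [f u] at [e] is that of [f] at [sg u], which lies in [J]. *)
  have -> := pd_actuE (f : annihilator_module) u (x := e) Logic.I.
  have [_ _ van _] := pd_funP sT (f : Y1).
  by rewrite van ?normc0//; exact: cyclic_closure_map.
have [r cr rr0] := completed_quotient_bound (smallest_lsubspace _) cq1 cr0.
have [s cs rs] := emb cr.
have [k k0 sk] := (pd_norm_norming set0 sT).2 _ (cseminorm_comp lk2 cs).
exists k => // f g Ng; apply: le_trans (sk _).
(* Subtracting [g], an element of B^*.I, does not change the class of [f]. *)
have -> : (s \o tensor_gen pi T2) (dual_inclusion f - (g : Y2)) =
    s (i' (tensor_gen pi T1 f)).
  rewrite /= (linB lk2.1) (completed_quotient_ker cq2 Ng) subr0.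
  by congr s; apply/esym/ti.2.
apply: le_trans (rs _); apply/ler_addgt0Pr => d d0.
set t := r _; have td : t < t + d by rewrite ltrDl.
have [n Nn /ltW] := rr0 f _ (le_lt_trans (sn_ge0 cr.1 _) td) td.
apply: le_trans; apply: le_trans (sn_le_sub cr0.1 (f : annihilator_module) n) _.
by rewrite (r0N n Nn) add0r.
Qed.

(* Otherwise Hahn-Banach separates the tuple of the images of the elements of [F]
   from its products with the elements of norm less than [c]: this gives [g] in
   B^* . I with [g e = 1] whose restriction to [J] has norm at most [1 / c], and
   the weak complement and [evaluation_bound] bound [g e] by that norm. *)
Lemma cyclic_approximate_identity : exists2 c : R, 0 < c &
  forall (F : seq (A * C^o)) (eps : R), 0 < eps -> (forall a, a \in F -> I a) ->
  exists u, [/\ I u, rnorm (sg u) < c &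
    forall a, a \in F -> rnorm (sg (a - amu_mul a u)) < eps].
Proof.
have [k k0 hk] := evaluation_bound.
have ne := sn_ge0 sn e; have m1 : 0 < 1 + m by rewrite ltr_pwDl.
(* The argument ends with [1 <= c^-1 * ((1 + m) * (rnorm e + k))], which the last summand 1 makes
   false. *)
pose c := (1 + m) * (rnorm e + k) + 1.
have c0 : 0 < c by rewrite ltr_wpDl// mulr_ge0 ?(ltW m1)// addr_ge0// ltW.
exists c => // F eps eps0 FI; apply: contrapT => nF.
pose n := size F; pose a (j : 'I_n) := nth 0 F j.
have aI j : I (a j) by apply: FI; rewrite mem_nth.
have ei : 0 <= eps^-1 by rewrite invr_ge0 ltW.
have ci : 0 <= c^-1 by rewrite invr_ge0 ltW.
pose V : lmodType C := (B * ('I_n -> B))%type.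
(* For the point [z] of [N] given by [u], [q (x0 - z) < 1] makes [u] small and all its errors small
   at once; so [nF] keeps [N] at distance at least 1 from [x0]. *)
pose q (z : V) := c^-1 * rnorm z.1 + eps^-1 * \sum_j rnorm (z.2 j).
have ssum : rseminorm (fun y : 'I_n -> B => \sum_j rnorm (y j)).
  split=> [x y|b x].
    by rewrite -big_split /= ler_sum// => j _; exact: sn_add sn _ _.
  by rewrite mulr_sumr; apply: eq_bigr => j _; exact: snZ sn _ _.
have sq : rseminorm q.
  apply: rseminormD; first exact: (rseminorm_comp (f := fst) _ (rseminorm_scale ci sn)).
  exact: (rseminorm_comp (f := snd) _ (rseminorm_scale ei ssum)).
pose row u : 'I_n -> B := fun j => sg (amu_mul (a j) u).
pose N : set V := [set z | exists2 u, I u & z = (- sg u, row u)].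
have rowL : linear row.
  move=> b u v; apply/funext => j.
  rewrite -[RHS]/(b *: sg (amu_mul (a j) u) + sg (amu_mul (a j) v)) /row.
  rewrite !cyclic_map_mul cyclic_map_linear Lr !scalerDr addrACA !scalerA.
  by rewrite [_ * b]mulrC.
have sI := ideal_subspace hI.
have sN : linear_subspace N.
  split.
    exists 0; first exact: sI.1.
    by rewrite (lin0 cyclic_map_linear) oppr0 (lin0 rowL).
  move=> b _ _ [u Iu ->] [v Iv ->]; exists (b *: u + v); first exact: sI.2.
  rewrite rowL cyclic_map_linear.
  have <- : (b *: - sg u - sg v, b *: row u + row v) =
    b *: (- sg u, row u) + (- sg v, row v) :> V by [].
  by rewrite scalerN -opprD.
pose x0 : V := (0, fun j => sg (a j)).
have [|Phi [lP Pq PN P1]] := hahn_banach_quotient (x0 := x0) sq sN.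
  move=> _ [u Iu ->]; rewrite /q /= sub0r opprK leNgt; apply/negP => hlt.
  apply: nF; exists u; have nu := sn_ge0 sn (sg u).
  have sg0 : 0 <= \sum_j rnorm ((fun j => sg (a j)) j - row u j).
    by apply: sumr_ge0 => j _; exact: (sn_ge0 sn).
  split=> //.
    have : c^-1 * rnorm (sg u) < 1.
      by apply: le_lt_trans hlt; rewrite lerDl mulr_ge0.
    by rewrite ltr_pdivrMl// mulr1.
  move=> b bF; rewrite (linB cyclic_map_linear).
  have : eps^-1 * (\sum_j rnorm (sg (a j) - row u j)) < 1.
    by apply: le_lt_trans hlt; rewrite lerDr mulr_ge0.
  rewrite ltr_pdivrMl// mulr1; apply: le_lt_trans.
  have jF : (index b F < n)%N by rewrite index_mem.
  rewrite (bigD1 (Ordinal jF))//= /row /a /= nth_index// lerDl.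
  by apply: sumr_ge0 => j _; exact: (sn_ge0 sn).
pose single j (x : B) : 'I_n -> B := fun i => if i == j then x else 0.
have Psi_lin : linear (fun y : 'I_n -> B => Phi (0, y)).
  move=> b y y'; rewrite -lP; congr Phi.
  have <- : (b *: 0 + 0, b *: y + y') = b *: (0, y) + (0, y') :> V by [].
  by rewrite scaler0 addr0.
have sumE (y : 'I_n -> B) : \sum_j Phi (0, single j (y j)) = Phi (0, y).
  rewrite -(big_morph (fun y : 'I_n -> B => Phi (0, y)) (linD Psi_lin) (lin0 Psi_lin)).
  congr (Phi (0, _)); apply/funext => i; rewrite fct_sumE (bigD1 i)//=.
  rewrite /single eqxx big1 ?addr0// => j ji.
  by rewrite eq_sym (negbTE ji).
have dualf j : pdual [set: B] set0 (fun x => Phi (0, single j x)).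
  split=> //.
  - by move=> x nT; exfalso; exact: nT.
  - move=> b x y _ _; rewrite -Psi_lin; congr (Phi (0, _)).
    apply/funext => i; rewrite /single -[RHS]/(b *: (if i == j then x else 0) +
      (if i == j then y else 0)).
    by case: eqP => // _; rewrite scaler0 addr0.
  exists eps^-1; first by rewrite invr_gt0.
  move=> x; apply: le_trans (Pq _) _; rewrite /q /= (sn0 sn) mulr0 add0r.
  rewrite ler_wpM2l// (bigD1 j)//= /single eqxx big1 ?addr0// => i ij.
  by rewrite (negbTE ij) (sn0 sn).
pose fj j : dual_module := pd_mk (dualf j).
(* [g] sends [x] to [Phi] at 0 and the family of all [a j] applied to [x], so its value at [e] is
   [Phi x0 = 1]. As [Phi] vanishes on [N], its value at [sg u] is [Phi (sg u, 0)], bounded by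
   [c^-1 * rnorm (sg u)]. *)
pose g : dual_module := \sum_j rm_actu (fj j) (a j).
have Ng : ideal_span I g.
  have sS := smallest_lsubspace
    [set z | exists (y : dual_module) u, I u /\ z = rm_actu y u].
  apply: (big_ind (fun z => ideal_span I z)); first exact: sS.1.
    by move=> x y; exact: lsubspaceD sS.
  by move=> j _; exact: ideal_span_act.
have gE x : pd_fun (g : Y2) x = Phi (0, fun j => L (a j).1 x + (a j).2 *: x).
  rewrite -sumE /g; elim/big_rec2 : _ => [|j y1 y2 _ IH]; first by [].
  rewrite -IH; congr (_ + _).
  exact: (pd_actuE (fj j : dual_module) (a j) (x := x) Logic.I).
have ge : pd_fun (g : Y2) e = 1 by rewrite gE.
have gsg u : I u -> normc (pd_fun (g : Y2) (sg u)) <= c^-1 * rnorm (sg u).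
  move=> Iu; have := PN (- sg u, row u) (ex_intro2 _ _ u Iu erefl).
  have <- : (0, row u) - (sg u, 0) = (- sg u, row u) :> V.
    have <- : (0 - sg u, row u - 0) = (0, row u) - (sg u, 0) :> V by [].
    by rewrite sub0r subr0.
  rewrite (linB lP) => /eqP; rewrite subr_eq0 => /eqP h.
  rewrite gE; have -> : (fun j => L (a j).1 (sg u) + (a j).2 *: sg u) = row u.
    by apply/funext => j; rewrite /row cyclic_map_mul.
  rewrite h; apply: le_trans (Pq _) _; rewrite /q /= big1 ?mulr0 ?addr0//.
  by move=> j _; exact: (sn0 sn).
have ng := sn_ge0 (pd_norm_seminorm _ _) (g : Y2).
have pg : pd_norm (dual_restriction g) <= c^-1.
  apply: pd_norm_le => // x; have nx := sn_ge0 sn x.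
  have [Jx|nJx] := pselect (J x); last first.
    have [f1 _ _ _] := pd_funP sJ (dual_restriction g).
    by rewrite f1// normc0 mulr_ge0.
  rewrite dual_restrictionE// -subr_le0.
  apply: (@le0_small _ _ (c^-1 + pd_norm (g : Y2))) => d d0.
  have [_ [u Iu <-] ux] := closure_cseminorm_lt Jx (rnorm_norming B).1 d0.
  have [_ gl _ _] := pd_funP sT (g : Y2).
  have h1 := gsg u Iu; have h2 := pd_norm_eval sT (g : Y2) (sg u - x).
  have h3 : pd_fun (g : Y2) (sg u - x) = pd_fun (g : Y2) (sg u) - pd_fun (g : Y2) x.
    have := gl (-1) x (sg u) Logic.I Logic.I.
    by rewrite !scaleN1r addrC => ->; rewrite addrC.
  rewrite h3 in h2.
  have h4 := normcD (pd_fun (g : Y2) (sg u))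
    (- (pd_fun (g : Y2) (sg u) - pd_fun (g : Y2) x)).
  rewrite normcN opprB addrCA subrr addr0 in h4.
  have h5 : rnorm (sg u) <= rnorm x + d.
    by have := sn_le_sub sn (sg u) x; lra.
  have h6 := ler_wpM2l ci h5.
  have h7 := ler_wpM2l ng (ltW ux).
  by rewrite mulrDl; lra.
have h := hk (annihilator_projection g) g Ng.
have sp : normc (pd_fun (ideal_dual_section (dual_restriction g)) e) <=
    (1 + m) * c^-1 * rnorm e.
  apply: le_trans (ideal_dual_section_norm _ _) _.
  by rewrite ler_wpM2r// ler_wpM2l// ltW.
have np : pd_norm (dual_inclusion (annihilator_projection g) - (g : Y2)) <=
    (1 + m) * c^-1.
  rewrite (snBC (pd_norm_seminorm _ _)) -ideal_dual_section_restriction.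
  apply: pd_norm_le; first by rewrite mulr_ge0 ?(ltW m1).
  move=> x; apply: le_trans (ideal_dual_section_norm _ _) _.
  by rewrite ler_wpM2r ?(sn_ge0 sn)// ler_wpM2l// ltW.
rewrite ideal_dual_section_restriction in sp.
have h1 : normc (pd_fun (g : Y2) e) <=
    normc (pd_fun ((g : Y2) - dual_inclusion (annihilator_projection g)) e) +
    normc (pd_fun (annihilator_projection g) e).
  apply: le_trans (normcD _ _).
  rewrite -[pd_fun (_ - _) e]/(pd_fun (g : Y2) e -
    pd_fun (annihilator_projection g) e).
  by rewrite subrK.
rewrite ge normc1 in h1.
have h2 := ler_wpM2l (ltW k0) np.
have h3 : 1 <= c^-1 * ((1 + m) * (rnorm e + k)) by lra.
by move: h3; rewrite ler_pdivlMl// mulr1 /c; lra.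
Qed.

End ApproximateIdentity.
End WeaklyComplemented.
End CyclicNormed.

(** * The levels of an Arens-Michael decomposition *)

Section UnitizationNorm.
Variables (R : realType) (B : normedModType R[i]).
Local Notation C := R[i].

Lemma rnorm_pair (x : (B * C^o)%type) :
  rnorm x = Num.max (rnorm x.1) (normc x.2).
Proof.
have : `|x| = Num.max (rnorm x.1)%:C (normc x.2)%:C :> C.
  by rewrite -rnormE; exact: prod_normE.
rewrite rnormE /Num.max /Order.max ltcR.
by case: ifP => _ [].
Qed.

End UnitizationNorm.

Section Decomposition.
Variables (R : realType) (A : arens_michael_algebra R[i]).
Local Notation C := R[i].
Variables (D : arens_michael_decomposition A) (l : amd_index D).
Local Notation sigma := (amd_map D l).
Local Notation B := (amd_alg l * C^o)%type.

Definition level_act (a : A) (x : B) : B :=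
  unitization_mul (@ba_mul _ (amd_alg l)) (sigma a, 0) x.

Let mulr_lin x : linear (fun y => @ba_mul _ (amd_alg l) y x).
Proof. exact: bilinear_l (@ba_bilinear _ _) x. Qed.

Let mull_lin x : linear (@ba_mul _ (amd_alg l) x).
Proof. exact: bilinear_r (@ba_bilinear _ _) x. Qed.

Lemma level_actE a x :
  level_act a x = (ba_mul (sigma a) x.1 + x.2 *: sigma a, 0).
Proof. by rewrite /level_act /unitization_mul /= scale0r addr0 mul0r. Qed.

Lemma level_act_bilinear : bilinear_for *:%R *:%R level_act.
Proof.
split=> [x b a a'|a b x y]; rewrite !level_actE.
  have <- : (b *: (ba_mul (sigma a) x.1 + x.2 *: sigma a) +
      (ba_mul (sigma a') x.1 + x.2 *: sigma a'), b *: 0 + 0) =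
    b *: (ba_mul (sigma a) x.1 + x.2 *: sigma a, 0) +
      (ba_mul (sigma a') x.1 + x.2 *: sigma a', 0) :> B by [].
  rewrite amd_map_linear mulr_lin scaler0 addr0 !scalerDr addrACA !scalerA.
  by rewrite [_ * b]mulrC.
have <- : (b *: (ba_mul (sigma a) x.1 + x.2 *: sigma a) +
      (ba_mul (sigma a) y.1 + y.2 *: sigma a), b *: 0 + 0) =
    b *: (ba_mul (sigma a) x.1 + x.2 *: sigma a, 0) +
      (ba_mul (sigma a) y.1 + y.2 *: sigma a, 0) :> B by [].
rewrite /= mull_lin scaler0 addr0 scalerDl !scalerDr addrACA.
by rewrite scalerA.
Qed.

Lemma level_act_mul a b x :
  level_act (am_mul a b) x = level_act a (level_act b x).
Proof.
rewrite !level_actE /= amd_map_mul scale0r addr0.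
by rewrite (linD (mull_lin _)) (linZ (mull_lin _)) ba_assoc.
Qed.

Lemma cseminorm_level : cseminorm (fun a => rnorm (sigma a)).
Proof.
split.
  apply: (rseminorm_comp (f := sigma)) (rnorm_seminorm _).
  exact: amd_map_linear.
apply/(amd_generates D); exists 1%N, (fun=> l), 1; split=> // a /(_ ord0).
by rewrite -amd_map_norm rnormE ltcR.
Qed.

Lemma level_act_bound : exists2 q, cseminorm q &
  forall a x, rnorm (level_act a x) <= q a * rnorm x.
Proof.
(* The unitization carries the maximum norm, so each of the two summands of the first component
   contributes [rnorm (sigma a) * rnorm x]. *)
exists (fun a => 2 * rnorm (sigma a)).
  exact: cseminorm_scale cseminorm_level.
move=> a x; rewrite level_actE [leLHS]rnorm_pair /= normc0.
have sn := rnorm_seminorm (amd_alg l).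
have na := sn_ge0 sn (sigma a).
have x1 : rnorm x.1 <= rnorm x by rewrite [leRHS]rnorm_pair le_max lexx.
have x2 : normc x.2 <= rnorm x by rewrite [leRHS]rnorm_pair le_max lexx orbT.
have nx : 0 <= rnorm x by apply: le_trans x2; exact: normc_ge0.
rewrite ge_max mulr_ge0 ?mulr_ge0// andbT.
apply: le_trans (sn_add sn _ _) _; rewrite (snZ sn).
have := ba_submult (sigma a) x.1; rewrite !rnormE -rmorphM lecR.
have := ler_wpM2l na x1; have := ler_wpM2l na x2; lra.
Qed.

(** Identifies [cyclic_closure] at level [l] with the ideal I_l whose annihilator is assumed to be
    complemented. *)
Lemma level_cyclic_map :
  cyclic_map level_act (0, 1) = unitization_map sigma.
Proof.
apply/funext => -[a s]; rewrite /cyclic_map level_actE /unitization_map /=.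
have <- : (ba_mul (sigma a) 0 + 1 *: sigma a + s *: 0, 0 + s * 1) =
    (ba_mul (sigma a) 0 + 1 *: sigma a, 0) + s *: (0, 1) :> B by [].
by rewrite (lin0 (mull_lin _)) add0r scale1r scaler0 addr0 add0r mulr1.
Qed.

End Decomposition.

(** * From exactness to an approximate identity *)

Section Converse.
Variables (R : realType) (A : arens_michael_algebra R[i]).
Local Notation C := R[i].
Variables (I : set (A * C^o)) (X : left_module A) (pi : A * C^o -> X).
Hypotheses (hI : closed_left_ideal I) (hX : cyclic_module I pi).
Variable D : arens_michael_decomposition A.
Hypothesis hD : forall l : amd_index D,
  weakly_complemented (closure [set unitization_map (amd_map D l) u | u in I]).

Lemma amd_directed_seq n (s : 'I_n -> amd_index D) :
  exists l : amd_index D, forall k x, amd_norm (s k) x <= amd_norm l x.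
Proof.
elim: n s => [s|n IH s].
  by have [l] := amd_inhabited D; exists l => -[].
have [l hl] := IH (fun k => s (lift ord0 k)).
have [l' hl'] := amd_directed l (s ord0); exists l' => k x.
case: (unliftP ord0 k) => [j ->|->]; last by have [] := hl' x.
by apply: le_trans (hl j x) _; have [] := hl' x.
Qed.

(** By directedness each neighbourhood is controlled at one level, so the approximate identities of
    different levels never have to be compatible. *)
Lemma nbhs0_level (U : set (A * C^o)) : nbhs (0 : A * C^o) U ->
  exists (l : amd_index D) (t : R), 0 < t /\
    forall u, rnorm (unitization_map (amd_map D l) u) < t -> U u.
Proof.
move=> [[U1 U2] [/= nU1 nU2] UU].
have [n [s [e [/gt0_complexE[r r0 ->] sU]]]] := (amd_generates D U1).1 nU1.
have [t t0 tU] := (nbhs0_normc U2).1 nU2.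
have [l hl] := amd_directed_seq s.
exists l, (Num.min r t); split; first by rewrite lt_min r0.
move=> [a c]; rewrite rnorm_pair /= gt_max !lt_min.
move=> /andP[/andP[ar _] /andP[_ ct]].
apply: (UU (a, c)); split=> /=; last exact: tU.
apply: sU => k; apply: le_lt_trans (hl k a) _.
by rewrite -amd_map_norm rnormE ltcR.
Qed.

(** The hypothesis is a common consequence of (iv) and (v): the input is a split exact pair of
    Banach modules, the output an exact pair of locally convex spaces. *)
Lemma flat_approximate_identity :
  (forall (Y1 Y2 Y3 : right_module A) (i : Y1 -> Y2) (p : Y2 -> Y3),
    exact_pair_banach_modules i p -> splits i p ->
    forall (T1 : module_tensor Y1 X) (T2 : module_tensor Y2 X)
      (T3 : module_tensor Y3 X) (i' : T1 -> T2) (p' : T2 -> T3),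
    tensor_map i i' -> tensor_map p p' -> exact_pair_lcs i' p') ->
  right_locally_bounded_ai I.
Proof.
move=> flat U /nbhs0_level[l [t [t0 tU]]].
have sI := ideal_subspace hI; pose e : (amd_alg l * C^o)%type := (0, 1).
have Lb := level_act_bilinear l; have Lm := @level_act_mul _ _ D l.
have Lq := level_act_bound l.
have := hD l; rewrite -level_cyclic_map.
move=> [P [Pann Pid Plin [M [/ge0_complexE[m m0 ->] Pm]]]].
have ex := dual_sequence_exact hI Lb Lm Lq Pann Pid.
have sp := dual_sequence_splits hI Lb Lm Lq Pann Pid Plin m0 Pm.
have [hi hp _] := ex.
have [T1] := module_tensor_exists X (@annihilator_module _ _ _ hI _ _ e Lb Lm Lq).
have [T2] := module_tensor_exists X (dual_module Lb Lm Lq).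
have [T3] := module_tensor_exists X (@ideal_dual_module _ _ _ hI _ _ e Lb Lm Lq).
have [i' ti] := tensor_map_exists T1 T2 hi.
have [p' tp] := tensor_map_exists T2 T3 hp.
have ex' := flat _ _ _ _ _ ex sp T1 T2 T3 i' p' ti tp.
have emb : seminorm_embedding i'.
  apply: (open_onto_image_inj (exact_lcs_i_inj ex')).
  exact/(open_onto_imageP (exact_lcs_i ex').1)/(exact_lcs_i_homeo ex').
have [c c0 hc] := cyclic_approximate_identity hX Pann Pid Plin m0 Pm ti emb.
(* [u] has norm below [c] at level [l]; the element taken from [U] is [u] scaled by [t / c], and the
   factor [c / t] gives back [u], whose errors are below [t]. *)
exists (c / t)%:C; split; first by rewrite ltcR divr_gt0.
move=> F /finite_seqP[s ->] FI.
have [u [Iu uc us]] := hc s t t0 FI.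
rewrite level_cyclic_map in uc us.
exists ((t / c)%:C *: u); split.
- exact: lsubspaceZ.
- apply: tU; last exact: lsubspaceZ.
  rewrite -level_cyclic_map (linZ (cyclic_map_linear _ Lb)) level_cyclic_map.
  rewrite (snZr (rnorm_seminorm _)) ?divr_ge0 ?ltW//.
  by rewrite mulrAC ltr_pdivrMr// ltr_pM2l.
move=> a aF; rewrite scalerA -rmorphM.
have -> : c / t * (t / c) = 1.
  by rewrite mulrA mulfVK ?gt_eqF// mulfV ?gt_eqF.
rewrite rmorph1 scale1r; apply: tU; first exact: us.
by apply: lsubspaceB => //; [exact: FI|exact: (ideal_mul hI)].
Qed.

End Converse.

Theorem theorem9p1 (R : realType) (A : arens_michael_algebra R[i])
    (I : set (A * R[i]^o)) (X : left_module A) (pi : A * R[i]^o -> X)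
    (hI : closed_left_ideal I) (hX : cyclic_module I pi)
    (D : arens_michael_decomposition A)
    (hD : forall l : amd_index D,
      weakly_complemented
        (closure [set unitization_map (amd_map D l) u | u in I])) :
  [<->
    (* i *) right_locally_bounded_ai I;
    (* ii *) tensor_takes X (@exact_pair_modules _ A) (@exact_pair_lcs R[i]);
    (* iii *) tensor_takes X (@exact_pair_banach_modules _ A)
      (@exact_pair_banach R[i]);
    (* iv *) tensor_takes X
      (fun Y1 Y2 Y3 i p => exact_pair_modules i p /\ splits i p)
      (@exact_pair_lcs R[i]);
    (* v *) tensor_takes X
      (fun Y1 Y2 Y3 i p => exact_pair_banach_modules i p /\ splits i p)
      (@exact_pair_banach R[i])].
Proof.
have i_ii := approximate_identity_flat hI hX.
have i_iii := approximate_identity_banach_flat hI hX.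
have iv_i : tensor_takes X (fun Y1 Y2 Y3 i p => exact_pair_modules i p /\ splits i p)
    (@exact_pair_lcs R[i]) -> right_locally_bounded_ai I.
  move=> iv; apply: (flat_approximate_identity hI hX hD).
  move=> Y1 Y2 Y3 i p [hi hp ex] sp T1 T2 T3 i' p' ti tp.
  apply: (iv Y1 Y2 Y3 i p _ T1 T2 T3 i' p' ti tp).
  by split=> //; split=> //; exact: exact_pair_banach_lcs.
have v_i : tensor_takes X
    (fun Y1 Y2 Y3 i p => exact_pair_banach_modules i p /\ splits i p)
    (@exact_pair_banach R[i]) -> right_locally_bounded_ai I.
  move=> v; apply: (flat_approximate_identity hI hX hD).
  move=> Y1 Y2 Y3 i p ex sp T1 T2 T3 i' p' ti tp.
  apply: exact_pair_banach_lcs.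
  exact: (v Y1 Y2 Y3 i p (conj ex sp) T1 T2 T3 i' p' ti tp).
have ii_iv : tensor_takes X (@exact_pair_modules _ A) (@exact_pair_lcs R[i]) ->
    tensor_takes X (fun Y1 Y2 Y3 i p => exact_pair_modules i p /\ splits i p)
      (@exact_pair_lcs R[i]).
  by move=> ii Y1 Y2 Y3 i p [ex _]; exact: ii.
have iii_v : tensor_takes X (@exact_pair_banach_modules _ A)
      (@exact_pair_banach R[i]) ->
    tensor_takes X
      (fun Y1 Y2 Y3 i p => exact_pair_banach_modules i p /\ splits i p)
      (@exact_pair_banach R[i]).
  by move=> iii Y1 Y2 Y3 i p [ex _]; exact: iii.
(* The three remaining implications of the cycle, from (ii), (iii) and (iv), all return through
   (i). *)
tfae => // h.
- exact/i_iii/iv_i/ii_iv.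
- exact/ii_iv/i_ii/v_i/iii_v.
- exact/iii_v/i_iii/iv_i.
Qed.
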